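(* Let $p\in(1,+\infty)$, let $k\ge 0$ be an integer, let $(\mathcal T_h)_{h\in\mathcal H}$ be an admissible mesh sequence of $\Omega$, and let $h\in\mathcal H$. Assume that $\mathbf a$ and $f$ satisfy the Leray--Lions assumptions (A1)--(A5) listed in the context. Then there exists at least one $\underline{u}_h\in \underline U_{h,0}^k$ such that $$A(\underline u_h,\underline v_h)=\int_\Omega f(x)\,v_h(x)\,dx\qquad\text{for all }\underline v_h\in\underline U_{h,0}^k,$$ where $A$ is the form of the Hybrid High-Order scheme defined in the context.
   Context: **Mesh.** Let $d\ge 1$ and let $\Omega\subset\mathbb R^d$ be a bounded connected polytopal domain with boundary $\partial\Omega$. A polyhedral set is an open, connected, bounded set whose boundary is a finite union of parts of hyperplanes and which lies locally on only one side of its boundary. Let $\mathcal H\subset(0,+\infty)$ be countable with $0$ as its unique accumulation point. For $h\in\mathcal H$, $\mathcal T_h$ is a finite collection of nonempty pairwise disjoint polyhedral elements $T$ with $\overline\Omega=\bigcup_{T\in\mathcal T_h}\overline T$ and $h=\max_{T\in\mathcal T_h}h_T$, $h_T$ being the diameter of $T$. A face $F$ is a hyperplanar closed connected subset of $\overline\Omega$ with positive $(d-1)$-dimensional Hausdorff measure such that either $F\subset\partial T_1\cap\partial T_2$ for two distinct $T_1,T_2\in\mathcal T_h$ (interface), or $F\subset\partial T\cap\partial\Omega$ for some $T\in\mathcal T_h$ (boundary face). Interfaces are collected in $\mathcal F_h^{\rm i}$, boundary faces in $\mathcal F_h^{\rm b}$, and $\mathcal F_h=\mathcal F_h^{\rm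 i}\cup\mathcal F_h^{\rm b}$; the faces in $\mathcal F_h$ have pairwise disjoint relative interiors and the boundary of each element is the union of the faces it contains. $h_F$ is the diameter of $F$ (if $d=1$, $h_F$ is a positive number satisfying $\varrho^2h_T\le h_F\le h_T$ for every element $T$ having $F$ as a face, with $\varrho$ as below). For $T\in\mathcal T_h$, $\mathcal F_T=\{F\in\mathcal F_h: F\subset\partial T\}$ and, for $F\in\mathcal F_T$, $n_{TF}$ is the unit normal to $F$ pointing out of $T$. The mesh sequence $(\mathcal T_h)_{h\in\mathcal H}$ is admissible (with parameter $\varrho>0$) if for all $h\in\mathcal H$ there is a matching simplicial submesh $\mathfrak T_h$ of $\mathcal T_h$ (a conforming simplicial mesh of $\Omega$, each simplex being contained in one element of $\mathcal T_h$, each simplicial face being contained in at most one $F\in\mathcal F_h$, and each $F\in\mathcal F_h$ being a union of simplicial faces) such that (i) every $S\in\mathfrak T_h$ with diameter $h_S$ and inradius $r_S$ satisfies $\varrho h_S\le r_S$, and (ii) for all $T\in\mathcal T_h$ and $S\in\mathfrak T_h$ with $S\subset T$, $\varrho h_T\le h_S$. **Discrete spaces.** For $X$ an element or a face, $\mathbb P^l(X)$ is the space of polynomials on $X$ of total degree $\le l$ (in $d$ variables for elements; in $d-1$ variables, on the hyperplane containing $X$, for faces), and $\pi_X^l:L^1(X)\to\mathbb P^l(X)$ is the $L^2$-projector: $\int_X(\pi_X^lw)v=\int_X wv$ for all $v\in\mathbb P^l(X)$. Set $\underline U_T^k=\mathbb P^k(T)\times\prod_{F\in\mathcal F_T}\mathbb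 P^k(F)$, with elements $\underline v_T=(v_T,(v_F)_{F\in\mathcal F_T})$, and $\underline U_h^k=\prod_{T\in\mathcal T_h}\mathbb P^k(T)\times\prod_{F\in\mathcal F_h}\mathbb P^k(F)$, with elements $\underline v_h=((v_T)_{T},(v_F)_{F})$; $\underline v_T$ denotes the restriction of $\underline v_h$ to $\underline U_T^k$, and $v_h$ is the piecewise polynomial function on $\Omega$ with $v_h|_T=v_T$. Set $\underline U_{h,0}^k=\{\underline v_h\in\underline U_h^k: v_F=0\ \forall F\in\mathcal F_h^{\rm b}\}$. **Reconstructions.** The discrete gradient $G_T^k:\underline U_T^k\to\mathbb P^k(T)^d$ is defined by $\int_T G_T^k\underline v_T\cdot\phi=\int_T\nabla v_T\cdot\phi+\sum_{F\in\mathcal F_T}\int_F(v_F-v_T)\,\phi\cdot n_{TF}$ for all $\phi\in\mathbb P^k(T)^d$. The potential reconstruction $p_T^{k+1}:\underline U_T^k\to\mathbb P^{k+1}(T)$ is defined by $\int_T(\nabla p_T^{k+1}\underline v_T-G_T^k\underline v_T)\cdot\nabla w=0$ for all $w\in\mathbb P^{k+1}(T)$ and $\int_T(p_T^{k+1}\underline v_T-v_T)=0$. Set $P_T^{k+1}\underline v_T=v_T+(p_T^{k+1}\underline v_T-\pi_T^kp_T^{k+1}\underline v_T)$. **Scheme.** $A(\underline u_h,\underline v_h)=\sum_{T\in\mathcal T_h}A_T(\underline u_T,\underline v_T)$ with $$A_T(\underline u_T,\underline v_T)=\int_T\mathbf a(x,u_T(x),G_T^k\underline u_T(x))\cdot G_T^k\underline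 v_T(x)\,dx+s_T(\underline u_T,\underline v_T),$$ $$s_T(\underline u_T,\underline v_T)=\sum_{F\in\mathcal F_T}h_F^{1-p}\int_F|\pi_F^k(u_F-P_T^{k+1}\underline u_T)|^{p-2}\,\pi_F^k(u_F-P_T^{k+1}\underline u_T)\,\pi_F^k(v_F-P_T^{k+1}\underline v_T)\,ds,$$ with the convention $|t|^{p-2}t=0$ for $t=0$. **Leray--Lions assumptions.** Let $p'=\frac{p}{p-1}$, and $p^*=\frac{dp}{d-p}$ if $p<d$, $p^*=+\infty$ if $p\ge d$. (A1) $\mathbf a:\Omega\times\mathbb R\times\mathbb R^d\to\mathbb R^d$ is a Carathéodory function ($\mathbf a(x,\cdot,\cdot)$ is continuous for a.e. $x$, and $\mathbf a(\cdot,s,\xi)$ is measurable for all $(s,\xi)$). (A2) There exist $\overline a\in L^{p'}(\Omega)$, $\beta_{\mathbf a}\in(0,+\infty)$ and $0\le r<\frac{p^*}{p'}$ such that $|\mathbf a(x,s,\xi)|\le\overline a(x)+\beta_{\mathbf a}|s|^r+\beta_{\mathbf a}|\xi|^{p-1}$ for a.e. $x\in\Omega$ and all $(s,\xi)\in\mathbb R\times\mathbb R^d$. (A3) $[\mathbf a(x,s,\xi)-\mathbf a(x,s,\eta)]\cdot[\xi-\eta]\ge0$ for a.e. $x\in\Omega$ and all $(s,\xi,\eta)\in\mathbb R\times\mathbb R^d\times\mathbb R^d$. (A4) There exists $\lambda_{\mathbf a}\in(0,+\infty)$ such that $\mathbf a(x,s,\xi)\cdot\xi\ge\lambda_{\mathbf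 a}|\xi|^p$ for a.e. $x\in\Omega$ and all $(s,\xi)\in\mathbb R\times\mathbb R^d$. (A5) $f\in L^{p'}(\Omega)$. *)

(* Defs.v *)
Set Warnings "-notation-overridden,-ambiguous-paths,-notation-incompatible-prefix".
From HB Require Import structures.
From mathcomp Require Import all_boot all_order all_algebra.
(* The notations of mpoly clash with those of MathComp-Analysis. *)
From mathcomp Require Import -(notations) mpoly.
From mathcomp Require Import all_classical all_reals all_analysis.
Set Implicit Arguments.
Unset Strict Implicit.
Unset Printing Implicit Defensive.
Import Order.TTheory GRing.Theory Num.Theory.
Import numFieldNormedType.Exports.
Local Open Scope classical_set_scope.
Local Open Scope ring_scope.

(* Vectors of R^n are rows 'rV[R]_n.  The ambient space has dimension n.+1, so
   that hyperplanes have dimension n, the case d = 1 being n = 0. *)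

Section Lebesgue.
Context {R : realType}.

Definition rV_display : measure_display. Proof. exact. Qed.

Let coord n (i : 'I_n) (x : 'rV[R]_n) : measurableTypeR R := x 0 i.

Let rV_set0 n : g_sigma_preimage (@coord n) set0.
Proof. exact: sigma_algebra0. Qed.
Let rV_setC n A : g_sigma_preimage (@coord n) A ->
  g_sigma_preimage (@coord n) (~` A).
Proof. exact: sigma_algebraC. Qed.
Let rV_bigcup n (F : _^nat) : (forall i, g_sigma_preimage (@coord n) (F i)) ->
  g_sigma_preimage (@coord n) (\bigcup_i (F i)).
Proof. exact: sigma_algebra_bigcup. Qed.

(* The sigma-algebra generated by the coordinates: the Borel sets of R^n. *)
HB.instance Definition _ n := @isMeasurable.Build rV_display
  'rV[R]_n (g_sigma_preimage (@coord n)) (@rV_set0 n) (@rV_setC n)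
  (@rV_bigcup n).

Lemma measurable_coord n (i : 'I_n) :
  measurable_fun [set: 'rV[R]_n] (fun x => x 0 i : measurableTypeR R).
Proof.
move=> _ Y mY; rewrite setTI; apply: sub_sigma_algebra => /=.
rewrite -bigcup_seq/=; exists i => /=; first by rewrite mem_index_enum.
by exists Y => //; rewrite setTI.
Qed.

Lemma measurable_coordP d (T : measurableType d) n (f : T -> 'rV[R]_n) :
  (forall i, measurable_fun [set: T] (fun t => f t 0 i : measurableTypeR R)) ->
  measurable_fun [set: T] f.
Proof.
move=> mf _ B mB; rewrite setTI.
have : preimage_set_system setT f (g_sigma_preimage (@coord n)) `<=` measurable.
  rewrite -g_sigma_preimage_comp; apply: smallest_sub.
    exact: sigma_algebra_measurable.
  case: n f mf {B mB} => [|n] f mf; first by rewrite big_ord0.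
  rewrite -bigcup_mkord_ord; apply: bigcup_sub => i Ii.
  by move=> A [C mC <-]; exact: mf.
by apply; exists B => //; rewrite setTI.
Qed.

Definition cons_vec n (z : measurableTypeR R * 'rV[R]_n) : 'rV[R]_n.+1 :=
  row_mx (const_mx z.1 : 'rV_1) z.2.

Lemma cons_vec0 n z : @cons_vec n z 0 0 = z.1.
Proof.
transitivity ((row_mx (const_mx z.1 : 'rV_1) z.2) 0 (lshift n 0)).
  by congr (cons_vec z 0 _); exact: val_inj.
by rewrite row_mxEl mxE.
Qed.

Lemma cons_vecS n z i : @cons_vec n z 0 (lift 0 i) = z.2 0 i.
Proof.
transitivity ((row_mx (const_mx z.1 : 'rV_1) z.2) 0 (rshift 1 i)).
  by congr (cons_vec z 0 _); exact: val_inj.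
by rewrite row_mxEr.
Qed.

Lemma measurable_cons_vec n : measurable_fun [set: _] (@cons_vec n).
Proof.
apply: measurable_coordP => i; case: (unliftP 0 i) => [j ->|->].
  under eq_fun do rewrite cons_vecS.
  exact: (measurableT_comp (@measurable_coord n j) measurable_snd).
under eq_fun do rewrite cons_vec0.
exact: measurable_fst.
Qed.

Section step.
Variables (n : nat) (mu : {sigma_finite_measure set 'rV[R]_n -> \bar R}).

Definition leb_step : set 'rV[R]_n.+1 -> \bar R :=
  pushforward (lebesgue_measure \x mu)%E (@cons_vec n).

Let prod_leb : {measure set (measurableTypeR R * 'rV[R]_n) -> \bar R} :=
  (lebesgue_measure \x mu)%E.

Let leb_step0 : leb_step set0 = 0%E.
Proof. by rewrite /leb_step /pushforward preimage_set0 measure0. Qed.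

Let leb_step_ge0 A : (0 <= leb_step A)%E.
Proof. by rewrite /leb_step /pushforward (measure_ge0 prod_leb). Qed.

Let leb_step_sigma_additive : semi_sigma_additive leb_step.
Proof.
move=> F mF tF mUF.
have mpre A : measurable A -> measurable (@cons_vec n @^-1` A).
  by move=> mA; rewrite -[X in measurable X]setTI; exact: measurable_cons_vec.
rewrite /leb_step /pushforward preimage_bigcup.
have := @measure_semi_sigma_additive _ _ _ prod_leb
  (fun i => @cons_vec n @^-1` F i).
apply.
- by move=> i; exact: mpre.
- apply/trivIsetP => i j _ _ ij; rewrite -preimage_setI.
  by move/trivIsetP : tF => /(_ _ _ _ _ ij) ->//; rewrite preimage_set0.
- by rewrite -preimage_bigcup; exact: mpre.
Qed.

HB.instance Definition _ := isMeasure.Build _ _ _ leb_step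
  leb_step0 leb_step_ge0 leb_step_sigma_additive.

Lemma leb_stepX (A : set (measurableTypeR R)) (B : set 'rV[R]_n) :
  measurable A -> measurable B ->
  leb_step [set x | A (x 0 0) /\ B (\row_i x 0 (lift 0 i))] =
  (lebesgue_measure A * mu B)%E.
Proof.
move=> mA mB; rewrite -(product_measure1E lebesgue_measure mu)//.
rewrite /leb_step /pushforward; congr (_ _); apply/seteqP.
have rowE z : \row_i @cons_vec n z 0 (lift 0 i) = z.2.
  by apply/rowP => i; rewrite mxE cons_vecS.
by split=> -[x y]/=; rewrite cons_vec0 rowE.
Qed.

Let leb_step_sigma_finite : sigma_finite setT leb_step.
Proof.
have /sigma_finiteP[F [FT ndF Foo]] := sigma_finiteT (@lebesgue_measure R).
have /sigma_finiteP[G [GT ndG Goo]] := sigma_finiteT mu.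
pose B k := [set x : 'rV[R]_n.+1 |
  F k (x 0 0) /\ G k (\row_i x 0 (lift 0 i))].
exists B.
  apply/seteqP; split=> // x _.
  have : [set: R] (x 0 0) by [].
  rewrite FT => -[k _ Fk].
  have : [set: 'rV[R]_n] (\row_i x 0 (lift 0 i)) by [].
  rewrite GT => -[l _ Gl].
  exists (maxn k l) => //; split.
    by have /subsetPset := ndF _ _ (leq_maxl k l); exact.
  by have /subsetPset := ndG _ _ (leq_maxr k l); exact.
move=> k; have [mF Fk] := Foo k; have [mG Gk] := Goo k; split.
  have -> : B k = (fun x : 'rV[R]_n.+1 => x 0 0) @^-1` F k `&`
      (fun x : 'rV[R]_n.+1 => \row_i x 0 (lift 0 i)) @^-1` G k by [].
  apply: measurableI.
    by rewrite -[X in measurable X]setTI; exact: measurable_coord.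
  rewrite -[X in measurable X]setTI.
  have mtl : measurable_fun [set: 'rV[R]_n.+1]
      (fun x : 'rV[R]_n.+1 => \row_i x 0 (lift 0 i)).
    apply: measurable_coordP => i; under eq_fun do rewrite mxE.
    exact: measurable_coord.
  exact: mtl.
by rewrite leb_stepX// lte_mul_pinfty// ge0_fin_numE.
Qed.

HB.instance Definition _ := Measure_isSigmaFinite.Build _ _ _ leb_step
  leb_step_sigma_finite.
End step.

Fixpoint leb n : {sigma_finite_measure set 'rV[R]_n -> \bar R} :=
  match n with
  | 0%N => dirac (0 : 'rV[R]_0)
  | m.+1 => leb_step (leb m)
  end.

Lemma leb_box n (A : 'I_n -> set (measurableTypeR R)) :
  (forall i, measurable (A i)) ->
  leb n [set x | forall i, A i (x 0 i)] =
  (\big[mule/1%E]_(i < n) lebesgue_measure (A i))%E.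
Proof.
elim: n A => [|n IHn] A mA.
  by rewrite big_ord0 /= diracE mem_set// => -[].
rewrite big_ord_recl -IHn//.
have mB : measurable [set y : 'rV[R]_n | forall i, A (lift 0 i) (y 0 i)].
  have -> : [set y : 'rV[R]_n | forall i, A (lift 0 i) (y 0 i)] =
      \bigcap_(i in [set: 'I_n])
        ((fun y : 'rV[R]_n => y 0 i) @^-1` A (lift 0 i)).
    by apply/seteqP; split=> y yA i; [move=> _|]; exact: yA.
  apply: fin_bigcap_measurable => [|i _]; first exact: finite_finset.
  rewrite -[X in measurable X]setTI; exact: measurable_coord.
rewrite -leb_stepX//; congr (leb_step _ _); apply/seteqP; split=> x /=.
  by move=> xA; split=> // i; rewrite mxE.
move=> [x0 xA] i; case: (unliftP 0 i) => [j ->|->//].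
by have := xA j; rewrite mxE.
Qed.
End Lebesgue.

Section Geometry.
Context {R : realType}.

Definition dotv n (x y : 'rV[R]_n) : R := \sum_i x 0 i * y 0 i.

(* Euclidean norm; the library norm on 'rV[R]_n is the sup norm. *)
Definition enorm n (x : 'rV[R]_n) : R := Num.sqrt (dotv x x).

Definition eball n (c : 'rV[R]_n) (r : R) : set 'rV[R]_n :=
  [set x | enorm (x - c) < r].

Definition diam n (A : set 'rV[R]_n) : R :=
  sup [set enorm (z.1 - z.2) | z in A `*` A].

Definition inradius n (A : set 'rV[R]_n) : R :=
  sup [set r | exists c, eball c r `<=` A].

Definition boundary n (A : set 'rV[R]_n) : set 'rV[R]_n := closure A `\` A°.

Definition hausdorff_premeasure n (s : nat) (delta : R) (A : set 'rV[R]_n)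
    : \bar R :=
  ereal_inf
    [set (\sum_(0 <= i <oo) (if U i == set0 then 0 else diam (U i) ^+ s)%:E)%E
    | U in [set U : nat -> set 'rV[R]_n |
        A `<=` \bigcup_i U i /\
        forall i, bounded_set (U i) /\ diam (U i) <= delta]].

(* The s-dimensional Hausdorff outer measure without its normalizing
   constant: it only serves to express positivity. *)
Definition hausdorff n (s : nat) (A : set 'rV[R]_n) : \bar R :=
  ereal_sup [set hausdorff_premeasure s delta A | delta in [set d | 0 < d]].

Definition hyperplane n (nu : 'rV[R]_n) (c : R) : set 'rV[R]_n :=
  [set x | dotv nu x = c].

Definition polytopal n (A : set 'rV[R]_n) : Prop :=
  [/\ open A, connected A, bounded_set A &
    exists2 s : seq ('rV[R]_n * R), (forall z, z \in s -> z.1 != 0) &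
      forall x, boundary A x -> exists2 z, z \in s & hyperplane z.1 z.2 x].

(* (closure A)° = A says that every boundary point of A is a limit of points
   exterior to A, i.e. A lies on one side only of its boundary. *)
Definition polyhedral n (A : set 'rV[R]_n) : Prop :=
  polytopal A /\ (closure A)° = A.

(* Closed convex hull of the vertices v i, i \in I. *)
Definition hull n m (v : 'I_m -> 'rV[R]_n) (I : {set 'I_m}) : set 'rV[R]_n :=
  [set x | exists c : 'I_m -> R,
    [/\ forall i, 0 <= c i, forall i, i \notin I -> c i = 0,
        \sum_i c i = 1 & x = \sum_i c i *: v i]].

Definition affinely_independent n m (v : 'I_m -> 'rV[R]_n) : Prop :=
  forall c : 'I_m -> R,
    \sum_i c i = 0 -> \sum_i c i *: v i = 0 -> forall i, c i = 0.

Definition simplex n (v : 'I_n.+1 -> 'rV[R]_n) : set 'rV[R]_n :=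
  (hull v [set: 'I_n.+1])°.

Definition simplex_face n (v : 'I_n.+1 -> 'rV[R]_n) (i : 'I_n.+1)
    : set 'rV[R]_n := hull v [set~ i].

End Geometry.

Section Mesh.
Context {R : realType} {n : nat}.

(* Raw data of a mesh; the faces carry an isometric chart y |-> org + y *m frm
   of their hyperplane by R^n, through which polynomials and integrals on
   faces are expressed. *)
Record mesh := Mesh {
  telt : finType;
  tface : finType;
  elt : telt -> set 'rV[R]_n.+1;
  face : tface -> set 'rV[R]_n.+1;
  org : tface -> 'rV[R]_n.+1;
  frm : tface -> 'M[R]_(n, n.+1);
  hface : tface -> R;
  normal : telt -> tface -> 'rV[R]_n.+1 }.

Implicit Type M : mesh.

Definition chart M (F : tface M) (y : 'rV[R]_n) : 'rV[R]_n.+1 :=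
  org F + y *m frm F.

Definition fdom M (F : tface M) : set 'rV[R]_n := chart F @^-1` face F.

Definition relint M (F : tface M) : set 'rV[R]_n.+1 := chart F @` (fdom F)°.

Definition face_of M (T : telt M) (F : tface M) : bool :=
  `[< face F `<=` boundary (elt T) >].

Definition interface M (F : tface M) : Prop :=
  exists T1 T2 : telt M, [/\ T1 != T2, face F `<=` boundary (elt T1) &
    face F `<=` boundary (elt T2)].

Definition boundary_face (Omega : set 'rV[R]_n.+1) M (F : tface M) : Prop :=
  exists T : telt M,
    face F `<=` boundary (elt T) /\ face F `<=` boundary Omega.

(* nu is the unit normal to F out of T: almost everywhere on F for the surface
   measure, T lies on the side of -nu. *)
Definition outward M (T : telt M) (F : tface M) (nu : 'rV[R]_n.+1) : Prop :=
  [/\ enorm nu = 1, nu *m (frm F)^T = 0 &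
    {ae leb n, forall y, fdom F y ->
      \forall t \near (0 : R)^'+,
        elt T (chart F y - t *: nu) /\ ~ elt T (chart F y + t *: nu)}].

Definition is_mesh (Omega : set 'rV[R]_n.+1) (h : R) M : Prop :=
  [/\
  [/\ forall T : telt M, polyhedral (elt T) /\ elt T !=set0,
      trivIset setT (@elt M),
      closure Omega = \bigcup_(T in [set: telt M]) closure (elt T),
      (exists T : telt M, h = diam (elt T)) &
      forall T : telt M, diam (elt T) <= h],
  [/\ injective (@face M),
      forall F : tface M, frm F *m (frm F)^T = 1%:M /\
        face F `<=` range (chart F),
      forall F : tface M, [/\ closed (face F), connected (face F),
        face F `<=` closure Omega & (0 < hausdorff n (face F))%E],
      forall F : tface M, interface F \/ boundary_face Omega F &
      trivIset setT (@relint M)],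
  forall T : telt M,
    boundary (elt T) = \bigcup_(F in [set F | face_of T F]) face F,
  forall (T : telt M) (F : tface M), face_of T F -> outward T F (normal T F) &
  forall F : tface M, 0 < hface F /\ ((0 < n)%N -> hface F = diam (face F))].

Definition matching_simplicial_submesh (Omega : set 'rV[R]_n.+1) M
    (S : finType) (V : S -> 'I_n.+2 -> 'rV[R]_n.+1) : Prop :=
  [/\
  [/\ forall s, affinely_independent (V s),
      trivIset setT (fun s => simplex (V s)),
      closure Omega = \bigcup_s closure (simplex (V s)) &
      forall s s', s != s' -> exists I I' : {set 'I_n.+2},
        closure (simplex (V s)) `&` closure (simplex (V s')) = hull (V s) I /\
        hull (V s) I = hull (V s') I'],
  forall s, exists T : telt M, simplex (V s) `<=` elt T,
  forall s i (F F' : tface M), simplex_face (V s) i `<=` face F ->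
    simplex_face (V s) i `<=` face F' -> F = F' &
  forall F : tface M, face F =
    \bigcup_(z in [set z : S * 'I_n.+2 |
      simplex_face (V z.1) z.2 `<=` face F]) simplex_face (V z.1) z.2].

Definition admissible_mesh_sequence (Omega : set 'rV[R]_n.+1) (rho : R)
    (H : set R) (Mh : R -> mesh) : Prop :=
  [/\ 0 < rho, countable H, H `<=` [set h | 0 < h], limit_point H = [set 0] &
    forall h, H h ->
    [/\ is_mesh Omega h (Mh h),
        n = 0%N -> forall (T : telt (Mh h)) (F : tface (Mh h)), face_of T F ->
          rho ^+ 2 * diam (elt T) <= hface F <= diam (elt T) &
        exists (S : finType) (V : S -> 'I_n.+2 -> 'rV[R]_n.+1),
        [/\ matching_simplicial_submesh Omega (Mh h) V,
            forall s, rho * diam (simplex (V s)) <= inradius (simplex (V s)) &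
            forall (T : telt (Mh h)) s, simplex (V s) `<=` elt T ->
              rho * diam (elt T) <= diam (simplex (V s))]]].

End Mesh.
Arguments mesh : clear implicits.

Section Polynomials.
Context {R : realType}.

Definition Pk n (l : nat) : set ('rV[R]_n -> R) :=
  [set v | exists2 q : mpoly n R, (msize q <= l.+1)%N &
    forall x : 'rV[R]_n, v x = meval (fun i => x 0 i) q].

Definition Pkv n (l : nat) : set ('rV[R]_n -> 'rV[R]_n) :=
  [set phi | forall i, Pk l (fun x => phi x 0 i)].

Definition grad n (v : 'rV[R]_n.+1 -> R) (x : 'rV[R]_n.+1) : 'rV[R]_n.+1 :=
  \row_i 'D_(delta_mx 0 i) v x.

Definition l2proj n (l : nat) (D : set 'rV[R]_n) (w : 'rV[R]_n -> R)
    : 'rV[R]_n -> R :=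
  xget (fun=> 0) [set v | Pk l v /\ forall z, Pk l z ->
    \int[leb n]_(x in D) (v x * z x) = \int[leb n]_(x in D) (w x * z x)].

End Polynomials.

Section Scheme.
Context {R : realType} {n : nat} (M : mesh R n) (k : nat) (p : R).

(* Families ((v_T)_T, (v_F)_F).  Polynomials on an element are extended to the
   whole space, polynomials on a face are functions of the coordinates y of
   its chart.  The local operators below only use v.1 T and the v.2 F for the
   faces F of T. *)
Definition hybrid : Type :=
  ((telt M -> 'rV[R]_n.+1 -> R) * (tface M -> 'rV[R]_n -> R))%type.

Implicit Types (u v : hybrid) (T : telt M) (F : tface M).

Definition Uh : set hybrid :=
  [set v | (forall T, Pk k (v.1 T)) /\ (forall F, Pk k (v.2 F))].

Definition Uh0 (Omega : set 'rV[R]_n.+1) : set hybrid :=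
  [set v | Uh v /\ forall F, boundary_face Omega F -> v.2 F = fun=> 0].

Definition broken v (x : 'rV[R]_n.+1) : R := \sum_T \1_(elt T) x * v.1 T x.

Definition is_dgrad T v (G : 'rV[R]_n.+1 -> 'rV[R]_n.+1) : Prop :=
  Pkv k G /\ forall phi, Pkv k phi ->
    \int[leb n.+1]_(x in elt T) dotv (G x) (phi x) =
    \int[leb n.+1]_(x in elt T) dotv (grad (v.1 T) x) (phi x) +
    \sum_(F | face_of T F) \int[leb n]_(y in fdom F)
      ((v.2 F y - v.1 T (chart F y)) * dotv (phi (chart F y)) (normal T F)).

Definition dgrad T v : 'rV[R]_n.+1 -> 'rV[R]_n.+1 :=
  xget (fun=> 0) [set G | is_dgrad T v G].

Definition is_potential T v (q : 'rV[R]_n.+1 -> R) : Prop :=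
  [/\ Pk k.+1 q,
      forall w, Pk k.+1 w ->
        \int[leb n.+1]_(x in elt T)
          dotv (grad q x - dgrad T v x) (grad w x) = 0 &
      \int[leb n.+1]_(x in elt T) (q x - v.1 T x) = 0].

Definition potential T v : 'rV[R]_n.+1 -> R :=
  xget (fun=> 0) [set q | is_potential T v q].

Definition Ppotential T v (x : 'rV[R]_n.+1) : R :=
  v.1 T x + (potential T v x - l2proj k (elt T) (potential T v) x).

Definition face_residual T F v : 'rV[R]_n -> R :=
  l2proj k (fdom F) (fun y => v.2 F y - Ppotential T v (chart F y)).

(* For r = 0 the summand `|r| `^ (p - 2) * r is 0 whatever p. *)
Definition stab T u v : R :=
  \sum_(F | face_of T F) hface F `^ (1 - p) *
    \int[leb n]_(y in fdom F)
      (`|face_residual T F u y| `^ (p - 2) * face_residual T F u y *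
       face_residual T F v y).

Definition hho_form (a : 'rV[R]_n.+1 -> R -> 'rV[R]_n.+1 -> 'rV[R]_n.+1) u v
    : R :=
  \sum_T (\int[leb n.+1]_(x in elt T)
            dotv (a x (u.1 T x) (dgrad T u x)) (dgrad T v x) + stab T u v).

End Scheme.

Section LerayLions.
Context {R : realType} {n : nat}.
Variables (Omega : set 'rV[R]_n.+1) (p : R).

(* Lebesgue measurability, as the measurable sets of 'rV[R]_n are the Borel
   sets. *)
Definition leb_measurable_fun (g : 'rV[R]_n.+1 -> R) : Prop :=
  exists2 g' : 'rV[R]_n.+1 -> R, measurable_fun Omega g' &
    {ae leb n.+1, forall x, Omega x -> g x = g' x}.

Definition in_Lq (q : R) (g : 'rV[R]_n.+1 -> R) : Prop :=
  leb_measurable_fun g /\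
  (\int[leb n.+1]_(x in Omega) (`|g x| `^ q)%:E < +oo)%E.

Definition conjugate_exponent : R := p / (p - 1).

Definition sobolev_exponent : \bar R :=
  if p < n.+1%:R then (n.+1%:R * p / (n.+1%:R - p))%:E else +oo%E.

Variable a : 'rV[R]_n.+1 -> R -> 'rV[R]_n.+1 -> 'rV[R]_n.+1.

Definition caratheodory_fun : Prop :=
  {ae leb n.+1, forall x, Omega x ->
    continuous (fun z : R * 'rV[R]_n.+1 => a x z.1 z.2)} /\
  forall s xi i, leb_measurable_fun (fun x => a x s xi 0 i).

Definition growth : Prop :=
  exists (abar : 'rV[R]_n.+1 -> R) (beta r : R),
  [/\ in_Lq conjugate_exponent abar, 0 < beta, 0 <= r,
      (r%:E < sobolev_exponent * (conjugate_exponent^-1)%:E)%E &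
      {ae leb n.+1, forall x, Omega x -> forall s xi,
        enorm (a x s xi) <=
        abar x + beta * `|s| `^ r + beta * enorm xi `^ (p - 1)}].

Definition monotone : Prop :=
  {ae leb n.+1, forall x, Omega x -> forall s xi eta,
    0 <= dotv (a x s xi - a x s eta) (xi - eta)}.

Definition coercive : Prop :=
  exists2 lambda : R, 0 < lambda &
  {ae leb n.+1, forall x, Omega x -> forall s xi,
    lambda * enorm xi `^ p <= dotv (a x s xi) xi}.

Definition leray_lions (f : 'rV[R]_n.+1 -> R) : Prop :=
  [/\ caratheodory_fun, growth, monotone, coercive &
      in_Lq conjugate_exponent f].

End LerayLions.

(* Main.v *)
(* A zero of a continuous coercive map F on R^N is found from a combinatorial
   lemma of Scarf, which yields approximate solutions of a variational inequality
   on a simplex, then an exact one by compactness.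
   The scheme is F c = 0, where c runs over the coordinates of U_{h,0}^k in a
   basis; F is continuous by dominated convergence, after a has been replaced by
   0 off Omega and on a null set so that (A1) and (A2) hold at every point.
   By (A4), F c . c dominates a continuous p-homogeneous energy minus a linear
   term, so that it remains to see that the energy vanishes only at 0.  If it
   vanishes at v then v is constant on each element and equals this constant on
   the faces of the element; the elements where it is nonzero form a cluster
   without boundary faces, which contains all the neighbours of its elements.
   Such a cluster is empty, as a generic segment from it to infinity crosses its
   boundary at a point interior to the union of two of its elements. *)

(* The mesh is fixed, so no constant has to be uniform in h and no discrete Sobolev inequality
   enters: a continuous p-homogeneous energy that vanishes only at 0 has a positive minimum on the
   unit sphere, and since p > 1 it beats the linear load far from 0. What remains is continuity and
   the computation of a kernel. The reconstructions are chosen by [xget], so nothing is known of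
   them before their defining equations are shown to have exactly one solution. Existence is linear
   algebra for a definite form on a finite-dimensional space, and linearity follows from uniqueness.
   Definiteness, like the passage from zero energy to zero polynomials, rests on the fact that a
   polynomial vanishing on an open set is 0. Elements are open; a face acquires interior points in
   its chart from the simplicial submesh. *)
Require Import Defs.
Set Warnings "-notation-overridden,-ambiguous-paths,-notation-incompatible-prefix".
From HB Require Import structures.
From mathcomp Require Import all_boot all_order all_algebra.
From mathcomp Require Import -(notations) mpoly.
From mathcomp Require Import ring lra zify.
From mathcomp Require Import all_classical all_reals all_analysis.
From mathcomp Require Import measurable_realfun.
Set Implicit Arguments.
Unset Strict Implicit.
Unset Printing Implicit Defensive.

(** * Scarf's lemma *)

(* Dominant sets with #|I| elements are the rooms of Scarf's argument, those with
   one element less are its doors. *)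
Section Dominant.
Variables (Y I : finType) (r : I -> Y -> nat).
Hypothesis r_inj : forall i, injective (r i).

(** Scarf's primitive sets: no [y] lies, in every order at once, strictly above some element of
    [S]. *)
Definition dominant (S : {set Y}) :=
  [forall y, [exists i, [forall x in S, r i y <= r i x]]].

Lemma dominantP (S : {set Y}) :
  reflect (forall y, exists i, forall x, x \in S -> r i y <= r i x) (dominant S).
Proof.
apply: (iffP forallP) => H y.
  by have /existsP[i /forall_inP h] := H y; exists i.
by have [i h] := H y; apply/existsP; exists i; apply/forall_inP.
Qed.

Lemma dominantS (S S' : {set Y}) : S' \subset S -> dominant S -> dominant S'.
Proof.
move=> /fintype.subsetP sub /dominantP dS; apply/dominantP => y.
by have [i h] := dS y; exists i => x /sub /h.
Qed.

Section door.
Variables (D : {set Y}) (m : I -> Y) (a b : I).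
Hypotheses (mD : forall i, m i \in D)
  (mmin : forall i x, x \in D -> r i (m i) <= r i x)
  (ab : a != b) (mab : m a = m b)
  (coll : forall i j, i != j -> m i = m j -> (i = a /\ j = b) \/ (i = b /\ j = a))
  (domD : dominant D).

Definition beats (j : I) (y : Y) := [forall i, (i != j) ==> (r i (m i) < r i y)].

Let beatsP j z : reflect (forall i, i != j -> r i (m i) < r i z) (beats j z).
Proof.
apply: (iffP forallP) => h i; first by move=> ij; have := h i; rewrite ij.
by apply/implyP; apply: h.
Qed.

Definition top_beater j y := beats j y && [forall z, beats j z ==> (r j z <= r j y)].

(* In a door, exactly two of the orders, [a] and [b], have the same minimum; a room
   is obtained by adding the element which is maximal for one of these two among
   the elements above the minima of all the other orders. *)
Lemma room_of_door y : (y \notin D) && dominant (y |: D) =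
  top_beater a y || top_beater b y.
Proof.
have ltm i z : z \notin D -> r i (m i) <= r i z -> r i (m i) < r i z.
  move=> zD; rewrite leq_eqVlt => /orP[/eqP/r_inj e|//].
  by rewrite -e mD in zD.
(* Adding [y] can lower only the minimum of the order [j]. Dominance is thus at risk only at those
   [z] that are dominated through [j] alone, and these satisfy [beats j], so that [y] is above
   them. *)
have top_room j : (j = a \/ j = b) -> top_beater j y -> (y \notin D) && dominant (y |: D).
  move=> jab /andP[/beatsP bj /forallP maxj].
  have yD : y \notin D.
    apply/negP => yD; have /dominantP/(_ y)[i hi] := domD.
    have [ij|ij] := eqVneq i j; last by have := bj _ ij; rewrite ltnNge hi.
    have [j' j'j mj'] : exists2 j', j' != j & m j' = m j.
      by case: jab => ->; [exists b; rewrite // eq_sym|exists a].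
    have ymj : y = m j.
      by subst i; apply: (r_inj (i := j)); apply/eqP; rewrite eqn_leq hi// mmin.
    by have := bj _ j'j; rewrite mj' -ymj ltnn.
  rewrite yD; apply/dominantP => z; have [bz|/beatsP bz] := boolP (beats j z).
    have /dominantP/(_ z)[i hi] := domD.
    have ij : i = j.
      apply/eqP; apply/negPn/negP => ij; have /beatsP/(_ _ ij) := bz.
      by rewrite ltnNge hi.
    subst i; exists j => x; rewrite !inE => /orP[/eqP ->|/hi//].
    by have := maxj z; rewrite bz.
  have [i ij hi] : exists2 i, i != j & r i z <= r i (m i).
    apply: contrapT => h; apply: bz => i ij; rewrite ltnNge; apply/negP => hi.
    by apply: h; exists i.
  exists i => x; rewrite !inE => /orP[/eqP ->|xD].
    exact: leq_trans hi (ltnW (bj _ ij)).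
  exact: leq_trans hi (mmin _ xD).
apply/idP/orP => [/andP[yD /dominantP dom]|[]];
  [|by apply: top_room; left|by apply: top_room; right].
(* Once [y] falls below [m i] in the order [i], the element [m i] can be dominated only through
   another order, of which it is the minimum too. *)
have minS i : r i y < r i (m i) -> exists2 i', r i' (m i') <= r i' y & m i' = m i.
  move=> lt; have [i' hi'] := dom (m i); exists i'; last first.
    by apply: (r_inj (i := i')); apply/eqP; rewrite eqn_leq mmin// hi'// inE mD orbT.
  by apply: leq_trans (mmin _ (mD i)) _; apply: hi'; rewrite setU11.
have [j hj] := dom y.
have yj : r j y < r j (m j).
  rewrite ltn_neqAle hj ?inE ?mD ?orbT// andbT; apply: contraNneq yD => /r_inj ->.
  exact: mD.
have [j' hj' mj'] := minS _ yj.
have j'j : j' != j by apply: contraTneq yj => <-; rewrite -leqNgt.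
have jab := coll j'j mj'.
have bj : beats j y.
  apply/beatsP => i ij; rewrite ltnNge; apply/negP => le_i.
  have yi : r i y < r i (m i).
    rewrite ltn_neqAle le_i andbT; apply: contraNneq yD => /r_inj ->.
    exact: mD.
  have [i' hi' mi'] := minS _ yi.
  have i'i : i' != i by apply: contraTneq yi => <-; rewrite -leqNgt.
  have e : i = j'.
    by have := coll i'i mi'; move/eqP: ij; intuition congruence.
  by move: yi; rewrite e ltnNge hj'.
suff tj : top_beater j y by case: jab => -[_ <-]; [right|left].
rewrite /top_beater bj; apply/forallP => z; apply/implyP => /beatsP bz.
have [i hi] := dom z.
have [<-|/bz] := eqVneq i j; first by apply: hi; rewrite setU11.
by rewrite ltnNge hi// inE mD orbT.
Qed.

Lemma card_top_beater j : #|[set y | top_beater j y]| = [exists y, beats j y].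
Proof.
case: existsP => [[y0 by0]|nb]; last first.
  apply/eqP; rewrite cards_eq0; apply/eqP/setP => y; rewrite !inE.
  by apply/negbTE; apply/negP => /andP[bjy _]; apply: nb; exists y.
have [y bjy ymax] := arg_maxnP (r j) by0.
apply/eqP/cards1P; exists y; apply/setP => z; rewrite !inE.
apply/andP/eqP => [[bz /forallP/(_ y)]|->].
  by rewrite bjy /= => h; apply: (r_inj (i := j)); apply/eqP; rewrite eqn_leq h andbT; exact: ymax.
by split=> //; apply/forallP => w; apply/implyP => /ymax.
Qed.

(** Each of [a] and [b] accounts for at most one room, and the two rooms differ: an element counted
    for both would be above the minima of all the orders, against the dominance of [D]. *)
Lemma card_rooms_of_door :
  #|[set y | (y \notin D) && dominant (y |: D)]| =
  [exists y, beats a y] + [exists y, beats b y].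
Proof.
rewrite -!card_top_beater -cardsUI.
have -> : [set y | top_beater a y] :&: [set y | top_beater b y] = finset.set0.
  apply/setP => y; rewrite !inE; apply/negbTE; apply/negP.
  move=> /andP[/andP[/beatsP ba _] /andP[/beatsP bb _]].
  have /dominantP/(_ y)[i hi] := domD.
  have [ia|ia] := eqVneq i a; last by have := ba _ ia; rewrite ltnNge hi.
  by have := bb i; rewrite ia ltnNge -ia hi// ia ab => /(_ isT).
rewrite cards0 addn0; apply: eq_card => y; rewrite !inE; exact: room_of_door.
Qed.

End door.

(** Dominance applied to an element of [D] makes it the minimum of some order. Hence [m] maps [I]
    onto a set with one element less, and exactly one pair of orders collides. *)
Lemma door_minima (D : {set Y}) : dominant D -> #|D|.+1 = #|I| -> D != finset.set0 ->
  exists (m : I -> Y) (a b : I), [/\ forall i, m i \in D,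
    forall i x, x \in D -> r i (m i) <= r i x, a != b, m a = m b &
    forall i j, i != j -> m i = m j -> (i = a /\ j = b) \/ (i = b /\ j = a)].
Proof.
move=> domD cardD /finset.set0Pn[x0 x0D].
have exm i : exists2 y, y \in D & forall x, x \in D -> r i y <= r i x.
  by have [y yD ymin] := arg_minnP (r i) x0D; exists y.
have [m /= mP] : exists m : I -> Y, forall i, (m i \in D) && [forall x in D, r i (m i) <= r i x].
  have /fin_all_exists : forall i, exists y, (y \in D) && [forall x in D, r i y <= r i x].
    by move=> i; have [y yD h] := exm i; exists y; rewrite yD; apply/forall_inP.
  by [].
have mD i : m i \in D by have /andP[] := mP i.
have mmin i x : x \in D -> r i (m i) <= r i x by have /andP[_ /forall_inP h] := mP i; apply: h.
have msurj (A : {set I}) : (forall i, i \notin A -> exists2 j, j \in A & m j = m i) -> m @: A = D.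
  move=> hA; apply/setP => x; apply/imsetP/idP => [[i _ ->]//|xD].
  have /dominantP/(_ x)[i hi] := domD.
  have xm : x = m i.
    by apply: (r_inj (i := i)); apply/eqP; rewrite eqn_leq mmin// hi.
  have [iA|/hA[j jA mj]] := boolP (i \in A); first by exists i.
  by exists j; rewrite // mj.
have /injectivePn[a [b ab mab]] : ~~ injectiveb m.
  apply/injectivePn; apply: contrapT => ninj.
  have minj : injective m.
    move=> i j mij; apply/eqP; apply/negPn/negP => ij.
    by apply: ninj; exists i; exists j; rewrite // mij.
  have := card_imset finset.setT minj; rewrite msurj ?cardsT; last by move=> i; rewrite inE.
  by move=> e; move: cardD; rewrite e => /eqP; rewrite eq_sym -{1}[#|I|]addn0 -addn1 eqn_add2l.
exists m, a, b; split=> //.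
have inj_off c d : c != d -> m c = m d -> {in [set~ c] &, injective m}.
  move=> cd mcd; apply/imset_injP.
  rewrite msurj; first by rewrite cardsC1 -cardD.
  by move=> i; rewrite !inE negbK => /eqP ->; exists d; rewrite // !inE eq_sym.
have ia := inj_off _ _ ab mab.
have ba : b != a by rewrite eq_sym.
have ib := inj_off _ _ ba (esym mab).
move=> i j ij mij.
have [ea|na] := eqVneq i a.
  left; split=> //; apply/eqP; apply/negPn/negP => jb.
  have ja : j != a by rewrite eq_sym -ea.
  have e : b = j by apply: ia; rewrite ?inE// -mab -ea.
  by rewrite e eqxx in jb.
have [ja|nja] := eqVneq j a; last first.
  have e : i = j by apply: ia; rewrite ?inE.
  by rewrite e eqxx in ij.
right; split=> //; apply/eqP; apply/negPn/negP => nib.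
have e : i = b by apply: ia; rewrite ?inE// mij ja.
by rewrite e eqxx in nib.
Qed.

End Dominant.

Section Parity.
Variables (Y I : finType) (r : I -> Y -> nat) (c : Y -> I) (i0 : I).

(* A flag is a room [S] with the door [S :\ x] having all colors but [i0]. *)
Let flag (S : {set Y}) x := (x \in S) && (c @: (S :\ x) == [set~ i0]).

(** There are 0 or 2 flags: if removing [x] leaves all colors but [i0], each once, then the color of
    [x] is shared with exactly one other [y], and [x] and [y] are the only elements that can be
    removed. *)
Lemma odd_flags (S : {set Y}) : #|S| = #|I| -> c @: S != finset.setT ->
  ~~ odd #|[set x | flag S x]|.
Proof.
move=> cardS colS; have [->|/finset.set0Pn[x]] := eqVneq [set x | flag S x] finset.set0.
  by rewrite cards0.
rewrite inE => /andP[xS /eqP cSx].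
have cx0 : c x != i0.
  apply: contraNneq colS => cx0.
  by rewrite -(finset.setD1K xS) imsetU1 cSx cx0; apply/eqP/finset.setP => i; rewrite !inE orbN.
have inj : {in S :\ x &, injective c}.
  apply/imset_injP; rewrite cSx cardsC1 -cardS (cardsD1 x S) xS //.
have : c x \in c @: (S :\ x) by rewrite cSx !inE.
move=> /imsetP[y yS cxy].
have /andP[yx yS'] : (y != x) && (y \in S) by move: yS; rewrite !inE.
have -> : [set z | flag S z] = [set x; y].
  apply/finset.setP => z; rewrite !inE /flag; apply/andP/orP => [[zS /eqP cSz]|].
    have [->|zx] := eqVneq z x; first by left.
    right; apply/eqP/inj; rewrite ?inE ?zx ?zS ?yx ?yS' //.
    have zi0 : c z != i0.
      have : c z \in c @: (S :\ x) by apply: imset_f; rewrite !inE zx.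
      by rewrite cSx !inE.
    have : c z \in c @: (S :\ z) by rewrite cSz !inE.
    move=> /imsetP[w]; rewrite !inE => /andP[wz wS].
    have [->|wx] := eqVneq w x; first by rewrite cxy.
    move=> cw; have e : z = w by apply: inj; rewrite ?inE ?zx ?wx.
    by rewrite e eqxx in wz.
  move=> [/eqP ->|/eqP ->]; first by rewrite xS cSx.
  split=> //; apply/eqP/finset.setP => i; apply/imsetP/idP => [[w]|].
    rewrite !inE => /andP[wy wS] ->; have [->//|wx] := eqVneq w x.
    have : c w \in c @: (S :\ x) by apply: imset_f; rewrite !inE wx.
    by rewrite cSx !inE.
  rewrite -cSx => /imsetP[w]; rewrite !inE => /andP[wx wS] ->.
  have [->|wy] := eqVneq w y; first by exists x; rewrite ?inE ?xS ?(eq_sym x y) ?yx.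
  by exists w; rewrite ?inE ?wy.
by rewrite cards2 eq_sym yx.
Qed.

(** Double counting of the flags. Grouped by room, their number is even as long as no room has all
    the colors. Grouped by door, it is odd, since [D0] contributes 1 and every other door 2 or
    nothing. *)
Lemma colorful_room (D0 : {set Y}) :
  let rooms (D : {set Y}) := #|[set y | (y \notin D) && dominant r (y |: D)]| in
  #|D0|.+1 = #|I| -> c @: D0 = [set~ i0] -> rooms D0 = 1 ->
  (forall D : {set Y}, #|D|.+1 = #|I| -> dominant r D -> c @: D = [set~ i0] -> D != D0 ->
     rooms D = 2) ->
  exists S : {set Y}, [/\ #|S| = #|I|, dominant r S & c @: S = finset.setT].
Proof.
move=> rooms D0card D0c D0rooms roomsD; apply: contrapT => noS.
pose P := [set z : {set Y} * Y |
  [&& #|z.1| == #|I|, dominant r z.1 & flag z.1 z.2]].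
pose P' := [set z : {set Y} * Y | [&& #|z.1|.+1 == #|I|, c @: z.1 == [set~ i0],
  z.2 \notin z.1 & dominant r (z.2 |: z.1)]].
have cardP : #|P| = #|P'|.
  have -> : P' = (fun z => (z.1 :\ z.2, z.2)) @: P.
    apply/finset.setP => -[D y]; apply/idP/imsetP => [|[[S x]]]; rewrite !inE /flag /=.
      move=> /and4P[cD cc yD dom]; exists (y |: D, y); rewrite ?setU1K// inE /flag /=.
      by rewrite cardsU1 yD add1n cD dom finset.setU11 setU1K.
    move=> /and4P[/eqP cS dom xS cc] [-> ->].
    by rewrite cc finset.setD1K// dom setD11 -cS (cardsD1 x S) xS add1n eqxx.
  rewrite card_in_imset// => -[S x] [S' x']; rewrite !inE /flag /=.
  move=> /and4P[_ _ xS _] /and4P[_ _ xS' _] [e ex]; subst x'; congr pair.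
  by rewrite -(finset.setD1K xS) e finset.setD1K.
have evenP : ~~ odd #|P|.
  have -> : #|P| = \sum_S \sum_(x | (S, x) \in P) 1.
    by rewrite pair_big_dep /= -sum1_card; apply: eq_bigl => -[].
  elim/big_ind : _ => // [x y xe ye|S _]; first by rewrite oddD (negbTE xe).
  have [/andP[/eqP cS dS]|nS] := boolP ((#|S| == #|I|) && dominant r S); last first.
    rewrite big1// => x; rewrite inE /= => /and3P[cS dS _].
    by rewrite cS dS in nS.
  have -> : \sum_(x | (S, x) \in P) 1 = #|[set x | flag S x]|.
    by rewrite -sum1_card; apply: eq_bigl => x; rewrite !inE /= cS eqxx dS.
  apply: odd_flags => //; apply/eqP => cT; apply: noS; by exists S.
have sumP' (D : {set Y}) : #|D|.+1 = #|I| -> c @: D = [set~ i0] ->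
    \sum_(x | (D, x) \in P') 1 = rooms D.
  move=> cD cc; rewrite /rooms -sum1_card; apply: eq_bigl => x.
  by rewrite [in RHS]inE inE /= cD cc !eqxx.
have : odd #|P'|.
  have -> : #|P'| = \sum_D \sum_(x | (D, x) \in P') 1.
    by rewrite pair_big_dep /= -sum1_card; apply: eq_bigl => -[].
  rewrite (bigD1 D0)//= oddD.
  rewrite sumP' // D0rooms.
  suff : ~~ odd (\sum_(D | D != D0) \sum_(x | (D, x) \in P') 1) by move/negbTE => ->.
  elim/big_ind : _ => // [x y xe ye|D DD0]; first by rewrite oddD (negbTE xe).
  have [->|[y yP]] : (\sum_(x | (D, x) \in P') 1 = 0) \/ exists y, (D, y) \in P'.
  - have [[y]|ny] := pselect (exists y, (D, y) \in P'); first by right; exists y.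
    by left; rewrite big1// => y yP; exfalso; apply: ny; exists y.
  - by [].
  move: yP; rewrite inE /= => /and4P[/eqP cD /eqP cc yD dom].
  rewrite sumP'// roomsD//.
  by apply: dominantS dom; apply: finset.subsetUr.
by rewrite -cardP (negbTE evenP).
Qed.

End Parity.

Section Scarf.
Variables (X I : finType) (q : I -> X -> nat) (c : X -> I) (x0 : X).
Hypotheses (q_inj : forall i, injective (q i)) (I_gt1 : 1 < #|I|).

Let top i := (\max_x q i x).+1.

(* The slack element [inr i] is below every other element in the order [i] and
   above every element of [X] in the other orders. *)
Let r (i : I) (y : X + I) : nat :=
  match y with
  | inl x => (q i x).+1
  | inr j => if j == i then 0 else (top i + enum_rank j).+1
  end.

Let r_inj i : injective (r i).
Proof.
have lt x (j : I) : q i x < top i + enum_rank j.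
  by rewrite ltn_addr// ltnS leq_bigmax.
move=> [x|j] [y|k]; rewrite /r /=.
- by move=> [/q_inj ->].
- by case: eqP => // _ [e]; have := lt x k; rewrite e ltnn.
- by case: eqP => // _ [e]; have := lt y j; rewrite e ltnn.
- case: (eqVneq j i) => [->|_]; case: (eqVneq k i) => [->|_] // [] /eqP.
  by rewrite eqn_add2l => /eqP/ord_inj/enum_rank_inj ->.
Qed.

Let r_slack i j x : i != j -> r i (inl x) < r i (inr j).
Proof.
rewrite eq_sym /r => /negbTE ->; rewrite ltnS ltn_addr// ltnS.
exact: leq_bigmax.
Qed.

Let r_bot i y : r i y <= r i (inr i) -> y = inr i.
Proof.
by rewrite {2}/r eqxx; case: y => [x|j] //=; case: eqP => // ->.
Qed.

Let color (y : X + I) := match y with inl x => c x | inr j => j end.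

(** The slack elements provide the exceptional door of the parity argument: the set [D0] of all of
    them but one lies in a single room, whereas any other door with the same colors contains an
    element of [X] and lies in two. *)
Lemma scarf : exists (s : {set X}) (C : {set I}),
  (forall i, i \in C -> exists2 x, x \in s & c x = i) /\
  (forall y, exists2 i, i \in C & forall x, x \in s -> q i y <= q i x).
Proof.
have [i0 [i1 i01]] : exists i0 : I, exists i1 : I, i1 != i0.
  by have /card_gt1P[a [b [_ _ ab]]] := I_gt1; exists b; exists a.
pose D0 : {set X + I} := inr @: [set~ i0].
have cD0 : #|D0|.+1 = #|I|.
  by rewrite card_imset; [rewrite cardsC1 prednK// ltnW|move=> ? ? []].
have colD0 : color @: D0 = [set~ i0].
  by rewrite -imset_comp; apply/finset.setP => i; rewrite imset_id.
have inD0 y : y \in D0 -> exists2 j, j != i0 & y = inr j.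
  by move=> /imsetP[j]; rewrite !inE => ? ->; exists j.
have D0in j : j != i0 -> inr j \in D0 by move=> ?; apply: imset_f; rewrite !inE.
have domD0 : dominant r D0.
  apply/dominantP => -[x|j].
    by exists i0 => _ /inD0[j ji ->]; apply: ltnW; apply: r_slack; rewrite eq_sym.
  by exists j => y _; rewrite /r eqxx.
have D0ne : D0 != finset.set0 by apply/finset.set0Pn; exists (inr i1); apply: D0in.
have minD0 m (mD : forall i, m i \in D0)
    (mmin : forall i x, x \in D0 -> r i (m i) <= r i x) i : i != i0 -> m i = inr i.
  by move=> ii0; apply: r_bot; apply: mmin; apply: D0in.
have [S [cS dS colS]] : exists S : {set X + I},
    [/\ #|S| = #|I|, dominant r S & color @: S = finset.setT].
  apply: (@colorful_room _ _ r color i0 D0) => //.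
    (* Every order except [i0] has its own slack element as minimum in [D0], so [i0] collides with
       some [j]. Elements of [X] are above the minima of all orders but [i0], while nothing is above
       those of all orders but [j]: one room. *)
    have [m [a [b [mD mmin ab mab coll]]]] := door_minima r_inj domD0 cD0 D0ne.
    have mi := minD0 m mD mmin.
    rewrite (card_rooms_of_door r_inj mD mmin ab mab coll domD0).
    have [j ji0 mj] := inD0 _ (mD i0).
    have mjj : m i0 = m j by rewrite mj mi.
    have i0j : i0 != j by rewrite eq_sym.
    have Nj : [exists y, beats r m j y] = false.
      apply/negbTE; apply/existsPn => y; apply/negP => /forallP h.
      have := h i0; rewrite i0j /= mj; case: y h => [x|k] h.
        by move=> lt; have := r_slack x i0j; rewrite ltnNge (ltnW lt).
      have [->|kj] := eqVneq k j; first by rewrite ltnn.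
      have [->|ki] := eqVneq k i0; first by rewrite {2}/r eqxx.
      by have := h k; rewrite kj mi//= ltnn.
    have ij : [exists y, beats r m i0 y].
      apply/existsP; exists (inl x0); apply/forallP => i; apply/implyP => ii0.
      by rewrite mi// /r eqxx.
    by case: (coll _ _ i0j mjj) => -[ea eb]; rewrite -ea -eb ij Nj.
  move=> D cD dD colD DD0.
  have [x xD] : exists x, inl x \in D.
    apply: contrapT => nx; move/eqP: DD0; apply; apply/eqP.
    have sub : D \subset D0.
      apply/fintype.subsetP => -[x xD|j jD]; first by exfalso; apply: nx; exists x.
      apply: D0in; have : j \in color @: D by apply/imsetP; exists (inr j).
      by rewrite colD !inE.
    by rewrite eqEcard sub /= -ltnS cD0 cD.
  have Dne : D != finset.set0 by apply/finset.set0Pn; exists (inl x).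
  have [m [a [b [mD mmin ab mab coll]]]] := door_minima r_inj dD cD Dne.
  rewrite (card_rooms_of_door r_inj mD mmin ab mab coll dD).
  (* The element [inl x] of [D] bounds all the minima from above, and [inr j] exceeds it in every
     order but [j], so both colliding orders give a room. *)
  have ex j : [exists y, beats r m j y].
    apply/existsP; exists (inr j); apply/forallP => i; apply/implyP => ij.
    by apply: leq_ltn_trans (mmin _ _ xD) _; apply: r_slack.
  by rewrite !ex.
(* If [inr i] is in the room, no element of [X] can be dominated through the order [i]. The
   remaining orders form [C], and their colors can only be carried by elements of [X]. *)
exists [set x | inl x \in S], [set i | inr i \notin S]; split.
  move=> i; rewrite inE => iS; have : i \in color @: S by rewrite colS inE.
  move=> /imsetP[[x|j] yS e]; first by exists x; rewrite ?inE.
  by rewrite e yS in iS.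
move=> y; have /dominantP/(_ (inl y))[i hi] := dS; exists i.
  by rewrite inE; apply/negP => /hi /r_bot.
by move=> x; rewrite inE => /hi; rewrite /r ltnS.
Qed.

End Scarf.

(** * Integer points of a dilated simplex *)

Section Grid.
Variables (m N : nat).
Local Notation I := 'I_m.+2.

Definition grid_point := {t : {ffun I -> 'I_N.+1} | \sum_i t i == N}.
HB.instance Definition _ := [Finite of grid_point by <:].

Lemma grid_point_of (t : I -> nat) : \sum_i t i = N ->
  exists x : grid_point, forall i, val x i = t i :> nat.
Proof.
move=> tN; have tlt i : t i < N.+1 by rewrite ltnS -tN (bigD1 i)//= leq_addr.
have h : \sum_i [ffun i => Ordinal (tlt i)] i == N.
  by apply/eqP; rewrite -[RHS]tN; apply: eq_bigr => i _; rewrite ffunE.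
by exists (exist (fun t : {ffun I -> 'I_N.+1} => \sum_i t i == N) _ h) => i /=; rewrite ffunE.
Qed.

Lemma grid_sperner (c : grid_point -> I) : exists x : grid_point, forall i,
  val x i <= m.+2 \/
  exists x' : grid_point, c x' = i /\
    forall j, val x j <= val x' j + m.+2 /\ val x' j <= val x j + m.+2.
Proof.
have [g0 _] : exists x : grid_point, forall i, val x i = (if i == ord0 then N else 0) :> nat.
  by apply: grid_point_of; rewrite -big_mkcond big_pred1_eq.
(* Ties between equal coordinates are broken by rank, as the orders have to be injective. *)
pose q (i : I) (x : grid_point) := val x i * #|{: grid_point}| + enum_rank x.
have q_inj i : injective (q i).
  move=> x y; rewrite /q => e; apply: enum_rank_inj; apply: ord_inj.
  have := congr1 (modn^~ #|{: grid_point}|) e.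
  by rewrite !modnMDl !modn_small.
have q_le i x y : q i x <= q i y -> val x i <= val y i.
  rewrite /q; apply: contraTT; rewrite -!ltnNge => lt.
  apply: (@leq_trans ((val y i).+1 * #|{: grid_point}|)).
    by rewrite mulSn addnC ltn_add2r.
  by apply: leq_trans (leq_addr _ _); rewrite leq_mul2r lt orbT.
have [|s [C [colC domC]]] := @scarf _ I q c g0 q_inj; first by rewrite card_ord.
have [i1 i1C _] := domC g0.
have [x1 x1s _] := colC _ i1C.
pose mn (i : I) : nat := val [arg min_(y < x1 in s) val y i] i.
have mnP i : (forall y, y \in s -> mn i <= val y i) /\ exists2 y, y \in s & mn i = val y i.
  rewrite /mn; case: arg_minnP => // y ys ymin; split=> //; by exists y.
(* Otherwise some grid point would be larger than [mn] in every coordinate of [C],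
   against [domC]. *)
have sumC : N < \sum_(i in C) (mn i).+1.
  rewrite ltnNge; apply/negP => le.
  pose K := N - \sum_(i in C) (mn i).+1.
  pose t i := if i \in C then (mn i).+1 + (if i == i1 then K else 0) else 0.
  have tN : \sum_i t i = N.
    rewrite /t -big_mkcond big_split /= -big_mkcondr /= [X in _ + X](big_pred1 i1) /=.
      by rewrite /K subnKC.
    by move=> i; rewrite /=; case: (eqVneq i i1) => [->|_]; rewrite ?i1C ?andbF.
  have [y yt] := grid_point_of tN.
  have [i iC hi] := domC y; have [_ [z zs ez]] := mnP i.
  by have := q_le _ _ _ (hi _ zs); rewrite yt /t iC ez leqNgt ltnS leq_addr.
(* The coordinates of [x] sum to [N], which by [sumC] is less than the minima plus [#|C|]; so the
   excess over the minima, together with the mass off [C], stays below [#|C|]. *)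
have bound x : x \in s -> \sum_(i in C) (val x i - mn i) + \sum_(i | i \notin C) val x i <= m.+2.
  move=> xs; set S2 := \sum_(i in C) _; set S3 := \sum_(i | _) _.
  pose S1 := \sum_(i in C) mn i.
  have e1 : \sum_(i in C) (mn i).+1 = S1 + #|C|.
    by under eq_bigr do rewrite -addn1; rewrite big_split sum1_card.
  have e2 : \sum_(i in C) (val x i : nat) = S1 + S2.
    by rewrite -big_split; apply: eq_bigr => i _; rewrite /= subnKC//; case: (mnP i) => ->.
  have e3 : S1 + S2 + S3 = N.
    by rewrite -e2 -[RHS](eqP (valP x)) [RHS](bigID (mem C)).
  have cC : #|C| <= m.+2 by rewrite -[X in _ <= X]card_ord max_card.
  by move: sumC; rewrite e1; move: S1 S2 S3 e3 {e1 e2} => S1 S2 S3; lia.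
have close x i : x \in s -> (i \in C -> val x i <= mn i + m.+2) /\ (i \notin C -> val x i <= m.+2).
  move=> xs; have := bound _ xs => b; split=> iC; move: b.
    by rewrite (bigD1 i iC)/=; lia.
  by rewrite [X in _ + X](bigD1 i iC)/=; lia.
exists x1 => i; have [iC|iC] := boolP (i \in C); last by left; apply: (close _ _ x1s).2.
have [x' x's cx'] := colC _ iC; right; exists x'; split=> // j.
have [jC|jC] := boolP (j \in C); last first.
  by split; apply: leq_trans (leq_addl _ _); [apply: (close _ _ x1s).2|apply: (close _ _ x's).2].
have le_close u v w : u <= w + m.+2 -> w <= v -> u <= v + m.+2 by lia.
split; first exact: le_close ((close _ _ x1s).1 jC) ((mnP j).1 _ x's).
exact: le_close ((close _ _ x's).1 jC) ((mnP j).1 _ x1s).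
Qed.
End Grid.

Import Order.TTheory GRing.Theory Num.Theory.
Import numFieldNormedType.Exports.
Local Open Scope classical_set_scope.
Local Open Scope ring_scope.

(** * Row vectors *)

Section RowVectors.
Context {R : realType}.

Lemma normr_coord n (x : 'rV[R]_n) i : `|x 0 i| <= `|x|.
Proof.
rewrite [leRHS]/Num.Def.normr /= mx_normrE; apply/bigmax_geP; right => /=.
by exists (0, i).
Qed.

Lemma normr_rV_le n (x : 'rV[R]_n) e : 0 <= e -> (forall i, `|x 0 i| <= e) -> `|x| <= e.
Proof.
move=> e0 h; rewrite [leLHS]/Num.Def.normr /= mx_normrE; apply/bigmax_leP; split=> // -[j i] _ /=.
by rewrite ord1.
Qed.

Lemma closed_normr_le n (K : R) : closed [set x : 'rV[R]_n | `|x| <= K].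
Proof.
apply: (@closed_comp _ _ (fun x : 'rV[R]_n => `|x|) [set y | y <= K]); last exact: closed_le.
by move=> x _; exact: norm_continuous.
Qed.

Lemma bounded_normr_le n (K : R) : bounded_set [set x : 'rV[R]_n | `|x| <= K].
Proof. by exists K; split=> [|N KN x /= /le_trans]; [exact: num_real|apply; exact: ltW]. Qed.

Lemma bounded_continuous n (D : set 'rV[R]_n) (f : 'rV[R]_n -> R) : bounded_set D ->
  continuous f -> exists2 K : R, 0 <= K & forall x, D x -> `|f x| <= K.
Proof.
move=> [M [_ hM]] cf; have MM : M < M + 1 by rewrite ltrDl.
have cB : compact [set x : 'rV[R]_n | `|x| <= M + 1].
  by apply: bounded_closed_compact; [exact: bounded_normr_le|exact: closed_normr_le].
have cB' : compact (f @` [set x : 'rV[R]_n | `|x| <= M + 1]).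
  apply: continuous_compact => //; exact: continuous_subspaceT.
have [K [_ hK]] := compact_bounded cB'.
exists (`|K| + 1); first by rewrite addr_ge0.
move=> x Dx; apply: hK; first by rewrite (le_lt_trans (ler_norm K))// ltrDl.
by exists x => //; exact: (hM _ MM).
Qed.

Lemma rV_continuous (T : topologicalType) n (f : T -> 'rV[R]_n) :
  (forall i, continuous (fun x => f x 0 i)) -> continuous f.
Proof.
move=> cf x A /= -[B hB sub].
apply: (@filterS _ _ _ (fun y => forall i, B 0 i (f y 0 i))).
  by move=> y hy; apply: sub => j i /=; rewrite ord1; apply: hy.
by apply: filter_forall => i; apply: (cf i x); exact: hB.
Qed.

Lemma continuous_coord (T : topologicalType) n (f : T -> 'rV[R]_n) i :
  continuous f -> continuous (fun x => f x 0 i).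
Proof.
move=> cf x; apply: (@continuous_comp _ _ _ f (fun y : 'rV[R]_n => y 0 i)).
  exact: cf.
exact: (@coord_continuous R 1 n 0 i (f x)).
Qed.

Lemma continuous_nbhs_gt (T : topologicalType) (f : T -> R) x a :
  {for x, continuous f} -> a < f x -> nbhs x [set y | a < f y].
Proof. by move=> cf afx; exact: (cvgr_gt (f x) cf). Qed.

Section continuous_fun.
Variable T : topologicalType.
Implicit Types f g : T -> R.

Lemma mul_fun_continuous f g : continuous f -> continuous g -> continuous (fun x => f x * g x).
Proof. by move=> cf cg x; apply: cvgM; [exact: cf|exact: cg]. Qed.

Lemma add_fun_continuous f g : continuous f -> continuous g -> continuous (fun x => f x + g x).
Proof. by move=> cf cg x; apply: cvgD; [exact: cf|exact: cg]. Qed.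

Lemma sub_fun_continuous f g : continuous f -> continuous g -> continuous (fun x => f x - g x).
Proof. by move=> cf cg x; apply: cvgB; [exact: cf|exact: cg]. Qed.

Lemma opp_fun_continuous f : continuous f -> continuous (fun x => - f x).
Proof. by move=> cf x; apply: cvgN; exact: cf. Qed.

Lemma norm_fun_continuous f : continuous f -> continuous (fun x => `|f x|).
Proof. by move=> cf x; apply: cvg_norm; exact: cf. Qed.

Lemma const_fun_continuous (a : R) : continuous (fun _ : T => a).
Proof. by move=> x; exact: cvg_cst. Qed.

End continuous_fun.

Lemma sum_fun_continuous (T : topologicalType) (I : Type) (s : seq I) (P : pred I)
    (f : I -> T -> R) :
  (forall i, continuous (f i)) -> continuous (fun x => \sum_(i <- s | P i) f i x).
Proof.
move=> cf; elim: s => [|i s IHs].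
  by rewrite (_ : (fun x => _) = cst 0) => [x|];
    [exact: cvg_cst|apply/funext => x; rewrite big_nil].
have [Pi|Pi] := boolP (P i); last first.
  by rewrite (_ : (fun x => _) = fun x => \sum_(i <- s | P i) f i x)//;
    apply/funext => x; rewrite big_cons (negbTE Pi).
rewrite (_ : (fun x => _) = f i \+ fun x => \sum_(i <- s | P i) f i x).
  by move=> x; apply: cvgD; [apply: cf|apply: IHs].
by apply/funext => x; rewrite big_cons Pi.
Qed.

Lemma dotv_fun_continuous (T : topologicalType) n (f g : T -> 'rV[R]_n) :
  continuous f -> continuous g -> continuous (fun x => dotv (f x) (g x)).
Proof.
move=> cf cg; apply: sum_fun_continuous => i x; by apply: cvgM; apply: continuous_coord.
Qed.

Lemma dotv_continuous_r n (nu : 'rV[R]_n) : continuous (dotv nu).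
Proof. by apply: dotv_fun_continuous; [exact: cst_continuous|move=> ?; exact: cvg_id]. Qed.

Lemma dotvC n (x y : 'rV[R]_n) : dotv x y = dotv y x.
Proof. by apply: eq_bigr => i _; rewrite mulrC. Qed.

Lemma dotvDl n (x y z : 'rV[R]_n) : dotv (x + y) z = dotv x z + dotv y z.
Proof. by rewrite -big_split; apply: eq_bigr => i _; rewrite mxE mulrDl. Qed.

Lemma dotvZl n a (x z : 'rV[R]_n) : dotv (a *: x) z = a * dotv x z.
Proof. by rewrite mulr_sumr; apply: eq_bigr => i _; rewrite mxE mulrA. Qed.

Lemma dotvDr n (x y z : 'rV[R]_n) : dotv z (x + y) = dotv z x + dotv z y.
Proof. by rewrite !(dotvC z) dotvDl. Qed.

Lemma dotvZr n a (x z : 'rV[R]_n) : dotv z (a *: x) = a * dotv z x.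
Proof. by rewrite !(dotvC z) dotvZl. Qed.

Lemma dotv_ge0 n (x : 'rV[R]_n) : 0 <= dotv x x.
Proof. by apply: sumr_ge0 => i _; rewrite -expr2 sqr_ge0. Qed.

Lemma dotvNl n (x y : 'rV[R]_n) : dotv (- x) y = - dotv x y.
Proof. by rewrite -scaleN1r dotvZl mulN1r. Qed.

Lemma dotvNr n (x y : 'rV[R]_n) : dotv x (- y) = - dotv x y.
Proof. by rewrite !(dotvC x) dotvNl. Qed.

Lemma dotv_eq0 n (x : 'rV[R]_n) : dotv x x = 0 -> x = 0.
Proof.
move=> /eqP; rewrite psumr_eq0 => [/allP h|i _]; last by rewrite -expr2 sqr_ge0.
apply/rowP => i; have := h i (mem_index_enum i); rewrite -expr2 sqrf_eq0 mxE.
by move/eqP.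
Qed.

Lemma dotv_neq0 n (x : 'rV[R]_n) : x != 0 -> 0 < dotv x x.
Proof.
by move=> x0; rewrite lt_def dotv_ge0 andbT; apply: contraNneq x0 => /dotv_eq0 ->.
Qed.

Lemma enorm_eq0 n (x : 'rV[R]_n) : enorm x = 0 -> x = 0.
Proof.
move/eqP; rewrite sqrtr_eq0 => le0; apply: dotv_eq0; apply/eqP.
by rewrite eq_le le0 dotv_ge0.
Qed.

Lemma enorm_ge0 n (x : 'rV[R]_n) : 0 <= enorm x.
Proof. exact: sqrtr_ge0. Qed.

Lemma enormZ n (a : R) (x : 'rV[R]_n) : enorm (a *: x) = `|a| * enorm x.
Proof.
by rewrite /enorm dotvZl dotvZr mulrA -expr2 sqrtrM ?sqr_ge0// sqrtr_sqr.
Qed.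

Lemma enorm_coord n (x : 'rV[R]_n) i : `|x 0 i| <= enorm x.
Proof.
rewrite -sqrtr_sqr ler_sqrt ?dotv_ge0// expr2 /dotv (bigD1 i)//= lerDl.
by apply: sumr_ge0 => j _; rewrite -expr2 sqr_ge0.
Qed.

Lemma enorm_fun_continuous (T : topologicalType) n (f : T -> 'rV[R]_n) :
  continuous f -> continuous (fun x => enorm (f x)).
Proof.
move=> cf x; apply: (@continuous_comp _ _ _ (fun x => dotv (f x) (f x)) (@Num.sqrt R)).
  exact: dotv_fun_continuous.
exact: sqrt_continuous.
Qed.

Lemma dotv_le n (x y : 'rV[R]_n) : `|dotv x y| <= enorm x * \sum_i `|y 0 i|.
Proof.
rewrite mulr_sumr; apply: le_trans (ler_norm_sum _ _ _) _; apply: ler_sum => i _.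
by rewrite normrM ler_wpM2r// enorm_coord.
Qed.

End RowVectors.

(** * Zeros of coercive maps *)

Section Zero.
Context {R : realType}.

(** Each grid point is colored by a coordinate at which [G] is least, so that a nearby point of
    color [i] is one where [G] is least at [i]. The number of subdivisions is [N.+1] to allow
    division. *)
Lemma approximate_vi m (G : 'rV[R]_m.+2 -> 'rV[R]_m.+2) (N : nat) :
  exists t : 'rV[R]_m.+2, [/\ forall i, 0 <= t 0 i, \sum_i t 0 i = 1 &
    forall i, t 0 i <= m.+2%:R / N.+1%:R \/
      exists t' : 'rV[R]_m.+2, (forall j, G t' 0 i <= G t' 0 j) /\
        `|t - t'| <= m.+2%:R / N.+1%:R].
Proof.
pose pt (x : grid_point m N.+1) : 'rV[R]_m.+2 := \row_i ((val x i : nat)%:R / N.+1%:R).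
pose c x := [arg min_(i < ord0 : 'I_m.+2) G (pt x) 0 i]%O.
have cP x j : G (pt x) 0 (c x) <= G (pt x) 0 j.
  by rewrite /c; case: arg_minP => // i _; apply.
have N0 : 0 < N.+1%:R^-1 :> R by rewrite invr_gt0 ltr0n.
have [x hx] := grid_sperner c; exists (pt x); split.
- by move=> i; rewrite mxE mulr_ge0// ltW.
- under eq_bigr do rewrite mxE.
  rewrite -mulr_suml -natr_sum (_ : (\sum_i _)%N = N.+1); last exact: (eqP (valP x)).
  by rewrite divff// pnatr_eq0.
move=> i; have [xi|[x' [cx' h]]] := hx i.
  by left; rewrite mxE ler_pM2r// ler_nat.
right; exists (pt x'); rewrite -cx'; split=> //.
apply: normr_rV_le => [|j]; first by rewrite mulr_ge0// ltW.
rewrite !mxE -mulrBl normrM [X in _ * X]gtr0_norm// ler_pM2r//.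
have [h1 h2] := h j; rewrite ler_norml; apply/andP; split.
  by rewrite lerBrDr addrC lerBlDr -natrD ler_nat.
by rewrite lerBlDr -natrD ler_nat addnC.
Qed.

(** Any cluster point [s] of the approximate solutions works. If [s 0 i] is positive and
    [G s 0 j < G s 0 i], both inequalities persist near [s]; but a late approximate solution close
    to [s] has a neighbour at which [G] is least at [i]. *)
Lemma simplex_vi m (G : 'rV[R]_m.+2 -> 'rV[R]_m.+2) : continuous G ->
  exists t : 'rV[R]_m.+2, [/\ forall i, 0 <= t 0 i, \sum_i t 0 i = 1 &
    forall i, 0 < t 0 i -> forall j, G t 0 i <= G t 0 j].
Proof.
move=> cG; have [t /all_and3[t0 t1 tG]] := choice (approximate_vi G).
pose D := [set t : 'rV[R]_m.+2 | (forall i, 0 <= t 0 i) /\ \sum_i t 0 i = 1].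
have cD : compact D.
  apply: bounded_closed_compact.
    exists 1; split=> // M M1 x [x0 x1] /=; apply: le_trans (ltW M1).
    apply: normr_rV_le => // i; rewrite ger0_norm// -x1 (bigD1 i)//= lerDl.
    exact: sumr_ge0.
  rewrite (_ : D = (\bigcap_(i in [set: 'I_m.+2])
      ((fun x : 'rV[R]_m.+2 => x 0 i) @^-1` [set y | 0 <= y]))
     `&` ((fun x : 'rV[R]_m.+2 => \sum_i x 0 i) @^-1` [set 1])).
    apply: closedI.
      apply: closed_bigI => i _; apply: closed_comp; last exact: closed_ge.
      by move=> x _; apply: coord_continuous.
    apply: closed_comp; last exact: closed_eq.
    by move=> x _; apply: sum_fun_continuous => i y; apply: coord_continuous.
  by apply/seteqP; split=> x [h1 h2]; split=> // i; [move=> _|]; apply: h1.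
have [|s [sD scl]] := cD (t @ \oo).
  have tD k : D (t k) by split; [apply: t0|apply: t1].
  by exists 0%N => // k _; exact: tD.
move: (s : 'rV[R]_m.+2) sD scl => {}s [s0 s1] scl; exists s; split=> // i si j.
rewrite leNgt; apply/negP => Gij.
have [e e0 he] : exists2 e : R, 0 < e & forall y : 'rV[R]_m.+2, `|s - y| < e ->
    s 0 i / 2 < y 0 i /\ G y 0 j < G y 0 i.
  have : nbhs s ([set y : 'rV[R]_m.+2 | s 0 i / 2 < y 0 i] `&`
      [set y | G y 0 j < G y 0 i]).
    apply: filterI.
      apply: continuous_nbhs_gt; first exact: coord_continuous.
      by rewrite gtr_pMr// invf_lt1// ltr1n.
    have cf : continuous (fun y : 'rV[R]_m.+2 => G y 0 i - G y 0 j).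
      by apply: sub_fun_continuous; apply: continuous_coord.
    have : nbhs s [set y | 0 < G y 0 i - G y 0 j].
      by apply: continuous_nbhs_gt; [exact: cf|rewrite subr_gt0].
    by apply: filterS => y /=; rewrite subr_gt0.
  by move=> /nbhs_ballP[e /= e0 he]; exists e => // y sy; apply: he; rewrite -ball_normE.
have ev : \forall k \near \oo, m.+2%:R / k.+1%:R < Num.min (e / 2) (s 0 i / 2).
  have mn0 : 0 < Num.min (e / 2) (s 0 i / 2) by rewrite lt_min !divr_gt0.
  near=> k; rewrite ltr_pdivrMr// -ltr_pdivrMl//.
  apply: (@lt_trans _ _ k%:R); last by rewrite ltr_nat.
  near: k; exact: nbhs_infty_gtr.
pose late := [set k : nat | m.+2%:R / k.+1%:R < Num.min (e / 2) (s 0 i / 2)].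
have [y /= [[k hk <-] sy]] : exists y, [set t k | k in late] y /\ `|s - y| < e / 2.
  apply: (scl [set t k | k in late] [set y | `|s - y| < e / 2]).
    by move: ev; apply: filterS => k hk; exists k.
  by apply/nbhs_ballP; exists (e / 2); rewrite /= ?divr_gt0// -ball_normE.
move: hk; rewrite /late /= lt_min => /andP[hk1 hk2].
have ee : e / 2 < e by rewrite gtr_pMr// invf_lt1// ltr1n.
have [sk _] := he _ (lt_trans sy ee).
have [tk|[t' [min_t' tt']]] := tG k i.
  by have := lt_trans sk (le_lt_trans tk hk2); rewrite ltxx.
have [|_] := he t'; last by rewrite ltNge min_t'.
rewrite -(subrKA (t k)); apply: le_lt_trans (ler_normD _ _) _.
by rewrite [ltRHS]splitr; apply: ltrD => //; apply: le_lt_trans hk1.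
Unshelve. all: by end_near.
Qed.

(* The vertices [V 0 = - sum_i e_i] and [V (i+1) = e_i], scaled by [L], span a
   simplex whose barycenter is the origin: averaging the variational inequality
   over them gives [dotv (F x) x <= 0]. *)
Lemma coercive_zero N (F : 'rV[R]_N.+1 -> 'rV[R]_N.+1) (r : R) :
  continuous F -> (forall x, r <= `|x| -> 0 < dotv (F x) x) ->
  exists x, F x = 0.
Proof.
move=> cF coer; wlog r0 : r coer / 0 < r.
  move=> h; apply: (h (Num.max r 1)); last by rewrite lt_max ltr01 orbT.
  by move=> x; rewrite ge_max => /andP[/coer].
(* Large enough for [|X t| < r] to put all the coordinates of [t] within [1 / (2 (N + 2))] of
   [t 0 ord0], which keeps [t] off the boundary of the simplex. *)
pose L : R := 2 * N.+2%:R * r.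
have L0 : 0 < L by rewrite !mulr_gt0.
pose X (t : 'rV[R]_N.+2) : 'rV[R]_N.+1 := \row_i (L * (t 0 (lift ord0 i) - t 0 ord0)).
(* The coordinate [j] of [G t] is [F (X t)] paired with the unscaled vertex [V j]. The vertices sum
   to 0, hence so do the coordinates of [G t], and their least value [mu] is at most 0. *)
pose G (t : 'rV[R]_N.+2) : 'rV[R]_N.+2 :=
  \row_j (if unlift ord0 j is Some i then F (X t) 0 i else - \sum_i F (X t) 0 i).
have cX : continuous X.
  apply: rV_continuous => i; under eq_fun do rewrite mxE.
  apply: mul_fun_continuous; first exact: const_fun_continuous.
  by apply: sub_fun_continuous; apply: coord_continuous.
have cFX i : continuous (fun t => F (X t) 0 i).
  apply: (@continuous_coord _ _ _ (F \o X)) => t.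
  by apply: continuous_comp; [apply: cX|apply: cF].
have cG : continuous G.
  apply: rV_continuous => j; under eq_fun do rewrite mxE.
  case: unliftP => [i _|_]; first exact: cFX.
  by apply: opp_fun_continuous; apply: sum_fun_continuous.
have [t [t0 t1 tG]] := simplex_vi cG.
have G0 : G t 0 ord0 = - \sum_i F (X t) 0 i by rewrite mxE unlift_none.
have GS i : G t 0 (lift ord0 i) = F (X t) 0 i by rewrite mxE liftK.
have sG : \sum_j G t 0 j = 0.
  rewrite big_ord_recl G0 addrC.
  by rewrite (eq_bigr _ (fun i _ => GS i)) subrr.
have [j0 tj0] : exists j, 0 < t 0 j.
  apply: contrapT => h; have /eqP := t1; rewrite big1 ?(eq_sym 0) ?oner_eq0// => j _.
  apply/eqP; rewrite eq_le t0 andbT leNgt; apply/negP => tj; by apply: h; exists j.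
pose mu := G t 0 j0.
have mumin j : mu <= G t 0 j by exact: tG.
have mu_le0 : mu <= 0.
  have : \sum_(j < N.+2) mu <= 0 by rewrite -[leRHS]sG; apply: ler_sum.
  by rewrite sumr_const card_ord pmulrn_lle0.
have mueq j : 0 < t 0 j -> G t 0 j = mu.
  by move=> tj; apply/eqP; rewrite eq_le mumin tG.
have tGmu : \sum_j t 0 j * G t 0 j = mu.
  rewrite -[RHS]mul1r -t1 mulr_suml; apply: eq_bigr => j _.
  have := t0 j; rewrite le_eqVlt => /orP[/eqP <-|/mueq ->//].
  by rewrite !mul0r.
have dot_mu : dotv (F (X t)) (X t) = L * mu.
  rewrite -tGmu big_ord_recl G0 mulrDr mulrN mulrN mulr_sumr mulr_sumr -sumrN mulr_sumr -big_split.
  by apply: eq_bigr => i _; rewrite /= GS mxE; ring.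
have Xr : `|X t| < r.
  rewrite ltNge; apply/negP => /coer; rewrite dot_mu.
  by rewrite pmulr_rgt0// ltNge mu_le0.
have close i : `|t 0 (lift ord0 i) - t 0 ord0| < (2 * N.+2%:R)^-1.
  have := le_lt_trans (normr_coord _ i) Xr; rewrite mxE normrM gtr0_norm//.
  by rewrite /L mulrAC gtr_pMl// -ltr_pdivlMl ?mulr1// mulr_gt0.
have inv2 : (2 * N.+2%:R)^-1 + (2 * N.+2%:R)^-1 = N.+2%:R^-1 :> R.
  by rewrite invfM -mulrDl -[2^-1]mul1r -splitr mul1r.
(* Otherwise all the coordinates would be at most [1 / (N + 2)], the first one strictly less, and
   could not sum to 1. So every vertex has positive weight, and all the coordinates of [G t] equal
   [mu], which is then 0. *)
have t00 : (2 * N.+2%:R)^-1 <= t 0 ord0.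
  rewrite leNgt; apply/negP => lt0.
  have : \sum_j t 0 j < 1; last by rewrite t1 ltxx.
  have inv_lt : (2 * N.+2%:R)^-1 < N.+2%:R^-1 :> R.
    by rewrite ltf_pV2 ?posrE ?mulr_gt0// ltr_pMl// ltr1n.
  rewrite big_ord_recl; apply: (@lt_le_trans _ _ (N.+2%:R^-1 + \sum_(i < N.+1) N.+2%:R^-1)).
    apply: ltr_leD; first exact: lt_trans inv_lt.
    apply: ler_sum => i _; rewrite -inv2 -[leLHS](subrK (t 0 ord0)) lerD// ltW//.
    exact: le_lt_trans (ler_norm _) (close i).
  by rewrite sumr_const card_ord -mulrS -[leLHS]mulr_natl mulfV// pnatr_eq0.
have tpos j : 0 < t 0 j.
  have d0 : 0 < (2 * N.+2%:R)^-1 :> R by rewrite invr_gt0 mulr_gt0.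
  case: (unliftP ord0 j) => [i ->|->]; last exact: lt_le_trans t00.
  have := close i; rewrite ltr_norml => /andP[+ _].
  by rewrite ltrBrDr addrC; apply: le_lt_trans; rewrite subr_ge0.
have mu0 : mu = 0.
  have : \sum_(j < N.+2) mu = 0.
    by rewrite -[RHS]sG; apply: eq_bigr => j _; rewrite mueq.
  by rewrite sumr_const card_ord => /eqP; rewrite mulrn_eq0 => /eqP.
by exists (X t); apply/rowP => i; rewrite -GS mueq// mu0 mxE.
Qed.
End Zero.

(** * Lebesgue measure *)

Section LebesgueRowVectors.
Context {R : realType}.

Lemma measurable_box n (A : 'I_n -> set (measurableTypeR R)) :
  (forall i, measurable (A i)) -> measurable [set x : 'rV[R]_n | forall i, A i (x 0 i)].
Proof.
move=> mA.
have -> : [set x : 'rV[R]_n | forall i, A i (x 0 i)] =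
    \bigcap_(i in [set: 'I_n]) ((fun y : 'rV[R]_n => y 0 i) @^-1` A i).
  by apply/seteqP; split=> y yA i; [move=> _|]; exact: yA.
apply: fin_bigcap_measurable => [|i _]; first exact: finite_finset.
rewrite -[X in measurable X]setTI; exact: measurable_coord.
Qed.

(** The sigma-algebra is generated by the coordinates and not by the topology, so [O] is written as
    a countable union of boxes with rational centers. *)
Lemma open_measurable_rV n (O : set 'rV[R]_n) : open O -> measurable O.
Proof.
move=> oO.
pose box (z : {ffun 'I_n -> rat} * nat) : set 'rV[R]_n :=
  [set x | forall i,
    (`]ratr (z.1 i) - z.2.+1%:R^-1, ratr (z.1 i) + z.2.+1%:R^-1[%classic : set R) (x 0 i)].
have -> : O = \bigcup_z (if `[< box z `<=` O >] then box z else set0).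
  apply/seteqP; split=> [x Ox|x [z _]]; last by case: ifPn => // /asboolP; apply.
  have : nbhs x O by apply: open_nbhs_nbhs.
  move=> /nbhs_ballP[e /= e0 he].
  have [k ke] : exists k : nat, k.+1%:R^-1 < e / 2.
    have e2 : 0 < e / 2 by rewrite divr_gt0.
    by have [k _ hk] := near_infty_natSinv_lt (PosNum e2); exists k; exact: (hk k (leqnn k)).
  have k0 : 0 < k.+1%:R^-1 :> R by rewrite invr_gt0.
  have hq i : exists q : rat, x 0 i - k.+1%:R^-1 < ratr q < x 0 i + k.+1%:R^-1.
    have [|q] := @rat_in_itvoo R (x 0 i - k.+1%:R^-1) (x 0 i + k.+1%:R^-1).
      by rewrite ltrD2l gtrN.
    by rewrite in_itv/=; exists q.
  have [q hqP] := fin_all_exists hq.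
  exists ([ffun i => q i], k) => //; case: ifPn => [_|/asboolP].
    move=> i /=; rewrite in_itv/= ffunE; have /andP[h1 h2] := hqP i.
    by move: h1 h2; move: (k.+1%:R^-1) => u h1 h2; apply/andP; split; lra.
  case=> y yb; apply: he; split=> // j i; rewrite ord1 {j}.
  have := yb i; rewrite /= in_itv/= ffunE => /andP[h3 h4]; have /andP[h1 h2] := hqP i.
  rewrite /ball /= ltr_norml; move: ke h1 h2 h3 h4; move: (k.+1%:R^-1) => u *.
  by apply/andP; split; lra.
apply: countable_bigcupT_measurable => // z; case: ifPn => // _.
apply: (@measurable_box n (fun i =>
  `]ratr (z.1 i) - z.2.+1%:R^-1, ratr (z.1 i) + z.2.+1%:R^-1[%classic)) => i.
exact: measurable_itv.
Qed.

Lemma closed_measurable_rV n (A : set 'rV[R]_n) : closed A -> measurable A.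
Proof.
by move/closed_openC/open_measurable_rV/measurableC; rewrite setCK.
Qed.

Lemma continuous_measurable_rV n (f : 'rV[R]_n -> R) : continuous f ->
  measurable_fun setT (f : 'rV[R]_n -> measurableTypeR R).
Proof.
move=> cf; apply: (measurability _ (RGenOInfty.measurableE R)) => _ [_ [a ->] <-].
rewrite setTI; apply: open_measurable_rV; by apply: open_comp => // x _; exact: cf.
Qed.

Lemma leb_bounded n (A : set 'rV[R]_n) : measurable A -> bounded_set A ->
  (leb n A < +oo)%E.
Proof.
move=> mA [M [_ hM]]; pose K := `|M| + 1.
have MK : M < K by rewrite /K (le_lt_trans (ler_norm M))// ltrDl.
pose B : 'I_n -> set (measurableTypeR R) := fun=> `[- K, K]%classic.
have mB i : measurable (B i) by exact: measurable_itv.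
apply: (@le_lt_trans _ _ (leb n [set x | forall i, B i (x 0 i)])).
  apply: le_measure; rewrite ?inE//; first exact: measurable_box.
  move=> x Ax i; rewrite /B /= in_itv /= -ler_norml.
  exact: le_trans (normr_coord _ _) (hM _ MK _ Ax).
rewrite leb_box//.
suff : (0 <= \big[mule/1]_(i < n) lebesgue_measure (B i) < +oo)%E by case/andP.
elim/big_ind : _ => [|x y /andP[x0 xoo] /andP[y0 yoo]|i _].
- by rewrite lee_fin ler01 ltry.
- by rewrite mule_ge0//= lte_mul_pinfty// ge0_fin_numE.
- rewrite measure_ge0 /B /= lebesgue_measure_itv /=.
  by case: ifP => _ //; rewrite ?ltry// -EFinB ltry.
Qed.

Lemma leb_open_gt0 n (O : set 'rV[R]_n) : open O -> O !=set0 -> (0 < leb n O)%E.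
Proof.
move=> oO [x Ox].
have /nbhs_ballP[e /= e0 he] : nbhs x O by apply: open_nbhs_nbhs.
pose B : 'I_n -> set (measurableTypeR R) := fun i => `]x 0 i - e, x 0 i + e[%classic.
have mB i : measurable (B i) by exact: measurable_itv.
apply: (@lt_le_trans _ _ (leb n [set x | forall i, B i (x 0 i)])); last first.
  apply: le_measure; rewrite ?inE//; [exact: measurable_box|exact: open_measurable_rV|].
  move=> y By; apply: he; split=> // j i; rewrite ord1 {j}.
  have := By i; rewrite /B /= in_itv/= => /andP[h3 h4].
  by rewrite /ball /= ltr_norml; apply/andP; split; lra.
rewrite leb_box//; elim/big_ind : _ => [|y z y0 z0|i _]; first by rewrite lte_fin.
  exact: mule_gt0.
rewrite /B lebesgue_measure_itv /= lte_fin ltrD2l gtrN// -EFinB lte_fin; lra.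
Qed.

(** If only the first coordinate of [nu] is nonzero, the hyperplane is a point times a space.
    Otherwise each of its sections at a fixed first coordinate is a hyperplane one dimension lower,
    null by induction. *)
Lemma hyperplane_null n (nu : 'rV[R]_n) (c : R) : nu != 0 ->
  leb n (hyperplane nu c) = 0%E.
Proof.
elim: n nu c => [nu c|n IHn nu c nu0].
  by move=> /eqP[]; apply/rowP => -[].
have mH m (v : 'rV[R]_m) b : measurable (hyperplane v b).
  apply: closed_measurable_rV.
  apply: (@closed_comp _ _ (fun x : 'rV[R]_m => dotv v x) [set b]).
    by move=> x _; exact: dotv_continuous_r.
  exact: closed_eq.
pose nu' : 'rV[R]_n := \row_i nu 0 (lift 0 i).
have dotE z : dotv nu (cons_vec z) = nu 0 0 * z.1 + dotv nu' z.2.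
  rewrite /dotv big_ord_recl cons_vec0; congr (_ + _).
  by apply: eq_bigr => i _; rewrite cons_vecS mxE.
have [nu'0|nu'0] := eqVneq nu' 0.
  have nu00 : nu 0 0 != 0.
    apply: contraNneq nu0 => e; apply/eqP/rowP => i; rewrite [in RHS]mxE.
    case: (unliftP 0 i) => [j ->|-> //].
    by have /rowP/(_ j) := nu'0; rewrite !mxE.
  have -> : hyperplane nu c = [set x : 'rV[R]_n.+1 | [set c / nu 0 0] (x 0 0) /\
      [set: 'rV[R]_n] (\row_i x 0 (lift 0 i))].
    apply/seteqP; split=> x; rewrite /hyperplane /=.
      move=> <-; split=> //; rewrite /dotv big_ord_recl big1 ?addr0;
        first by rewrite mulrAC mulfV ?mul1r.
      by move=> i _; have /rowP/(_ i) := nu'0; rewrite !mxE => ->; rewrite mul0r.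
    move=> [e _]; rewrite /dotv big_ord_recl big1 ?addr0; first by rewrite e mulrCA mulfV ?mulr1.
    by move=> i _; have /rowP/(_ i) := nu'0; rewrite !mxE => ->; rewrite mul0r.
  have := @leb_stepX R n (leb n) [set c / nu 0 0] setT (measurable_set1 _) measurableT.
  by rewrite lebesgue_measure_set1 mul0e.
apply: integral0_eq => x _ /=; rewrite -[RHS](IHn nu' (c - nu 0 0 * x) nu'0).
congr (leb n _); apply/seteqP; split=> y; rewrite xsectionE /hyperplane /= dotE /=.
  by move=> <-; rewrite addrC addKr.
by move=> ->; rewrite addrC subrK.
Qed.

Lemma continuous_integrable n (D : set 'rV[R]_n) (f : 'rV[R]_n -> R) :
  measurable D -> bounded_set D -> continuous f -> (leb n).-integrable D (EFin \o f).
Proof.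
move=> mD bD cf; have [K _ hK] := bounded_continuous bD cf.
apply: measurable_bounded_integrable => //.
- exact: leb_bounded.
- by apply: measurable_funTS; exact: continuous_measurable_rV.
- by exists K; split=> [|N KN x Dx]; [exact: num_real|exact: le_trans (hK x Dx) (ltW KN)].
Qed.

(** Restricted to interior points because a closed [D], such as the domain of a face, may have thin
    parts of measure 0. *)
Lemma Rintegral_eq0_interior n (D : set 'rV[R]_n) (f : 'rV[R]_n -> R) :
  measurable D -> bounded_set D -> continuous f -> (forall x, 0 <= f x) ->
  \int[leb n]_(x in D) f x = 0 -> forall x, D° x -> f x = 0.
Proof.
move=> mD bD cf f0 If0 x Dx; apply/eqP; rewrite eq_le f0 andbT leNgt; apply/negP => fx.
pose O := D° `&` [set y | 0 < f y].
have oO : open O.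
  apply: openI; first exact: open_interior.
  apply: (@open_comp _ _ f [set y | 0 < y]) => [y _|]; first exact: cf.
  exact: open_gt.
have : (0 < leb n O)%E by apply: leb_open_gt0 => //; exists x.
have : (\int[leb n]_(x in D) `|(EFin \o f) x| = 0)%E.
  have fi := continuous_integrable mD bD cf.
  under eq_integral do rewrite /= ger0_norm//.
  have := If0; rewrite /Rintegral => /eqP; rewrite fine_eq0; first by move=> /eqP.
  exact: integrable_fin_num.
have mf : measurable_fun D (EFin \o f).
  by apply/measurable_EFinP; apply: measurable_funTS; exact: continuous_measurable_rV.
move=> /(ae_eq_integral_abs _ mD mf)[N [mN N0 sub]].
rewrite lt0e => /andP[/eqP ne _]; apply: ne; apply/eqP; rewrite -measure_le0 -N0.
apply: le_measure; rewrite ?inE//; first exact: open_measurable_rV.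
move=> y [/interior_subset Dy fy]; apply: sub => /= /(_ Dy) [e].
by move: fy; rewrite /= e ltxx.
Qed.

End LebesgueRowVectors.

(** * Integrals of functions known only up to a null set *)

Section AlmostEverywhere.
Context d (T : measurableType d) {R : realType} (mu : {measure set T -> \bar R}).

(** No measurability is involved: the integral of a nonnegative function is a supremum over the
    simple functions below it. *)
Lemma ge0_integral_le (D : set T) (f g : T -> \bar R) :
  (forall x, D x -> 0 <= f x)%E -> (forall x, D x -> f x <= g x)%E ->
  (\int[mu]_(x in D) f x <= \int[mu]_(x in D) g x)%E.
Proof.
move=> f0 fg; have g0 x : D x -> (0 <= g x)%E by move=> Dx; apply: le_trans (fg _ Dx); exact: f0.
rewrite !ge0_integralE//; apply: le_ereal_sup => _ [h hf <-].
exists h => // x; apply: le_trans (hf x) _; rewrite /patch.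
by case: ifPn => // /set_mem; exact: fg.
Qed.

(** The integrands of the scheme contain [a] and the load, which agree with Borel functions only off
    null sets, hence no measurability of [f]. The upper bound [u] is infinite on [N], the lower
    bound [l] is 0 there. *)
Lemma ge0_ae_eq_integral_nonmeasurable (D N : set T) (f g : T -> \bar R) :
  measurable D -> measurable N -> mu N = 0%E ->
  (forall x, D x -> 0 <= f x)%E -> (forall x, D x -> 0 <= g x)%E ->
  (forall x, D x -> ~ N x -> f x = g x) -> measurable_fun D g ->
  (\int[mu]_(x in D) f x = \int[mu]_(x in D) g x)%E.
Proof.
move=> mD mN N0 f0 g0 fg mg; apply/eqP; rewrite eq_le; apply/andP; split.
  pose u x := (g x + (cst +oo \_ N) x)%E.
  have u0 x : (0 <= (cst +oo \_ N) x :> \bar R)%E.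
    by rewrite /patch /=; case: ifP => _ //; rewrite leey.
  have mu' : measurable_fun D u.
    apply: emeasurable_funD => //; apply: measurable_funTS.
    exact/(measurable_restrictT _ mN).
  rewrite (@ge0_ae_eq_integral _ _ _ mu D g u)//.
  - apply: ge0_integral_le => // x Dx; have [Nx|nNx] := pselect (N x).
      by rewrite /u /patch mem_set// addey ?leey//; have := g0 _ Dx; case: (g x).
    by rewrite /u /patch memNset// adde0 fg.
  - by move=> x Dx; rewrite /u adde_ge0// g0.
  - exists N; split=> // x /= h; apply: contrapT => nNx; apply: h => Dx.
    by rewrite /u /patch memNset// adde0.
pose l := g \_ (~` N).
have ml : measurable_fun D l.
  apply/(measurable_restrict g (measurableC mN) mD).
  by apply: measurable_funS mg => // x [].
have l0 x : D x -> (0 <= l x)%E by move=> Dx; rewrite /l /patch; case: ifP => // _; exact: g0.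
rewrite (@ge0_ae_eq_integral _ _ _ mu D g l)//.
- apply: ge0_integral_le => // x Dx; rewrite /l /patch; case: ifPn => [/set_mem nNx|_].
    by rewrite -fg.
  exact: f0.
- exists N; split=> // x /= h; apply: contrapT => nNx; apply: h => Dx.
  by rewrite /l /patch mem_set.
Qed.

(* [f] need not be measurable: it is squeezed between two measurable functions
   equal to [g] off [N]. *)
Lemma ae_eq_Rintegral (D N : set T) (f g : T -> R) : measurable D -> measurable N ->
  mu N = 0%E -> (forall x, D x -> ~ N x -> f x = g x) -> measurable_fun D g ->
  \int[mu]_(x in D) f x = \int[mu]_(x in D) g x.
Proof.
move=> mD mN N0 fg mg; rewrite /Rintegral; congr fine.
rewrite integralE [RHS]integralE; congr (_ - _)%E.
  apply: ge0_ae_eq_integral_nonmeasurable mN N0 _ _ _ _ => // [x Dx nNx|].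
    by rewrite !funeposE fg.
  by apply: measurable_funepos; exact/measurable_EFinP.
apply: ge0_ae_eq_integral_nonmeasurable mN N0 _ _ _ _ => // [x Dx nNx|].
  by rewrite !funenegE fg.
by apply: measurable_funeneg; exact/measurable_EFinP.
Qed.
End AlmostEverywhere.

(** * Polynomials *)

Section Pk.
Context {R : realType}.

Lemma Pk_const n l (c : R) : Pk l (fun _ : 'rV[R]_n => c).
Proof.
exists (mpolyC n c); last by move=> x; rewrite mevalC.
by rewrite msizeC; case: (c != 0).
Qed.

Lemma Pk_lin n l (a : R) (u v : 'rV[R]_n -> R) :
  Pk l u -> Pk l v -> Pk l (fun x => a * u x + v x).
Proof.
move=> [q qs qE] [r rs rE]; exists (a *: q + r); last first.
  by move=> x; rewrite mevalD mevalZ qE rE.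
apply: leq_trans (msizeD_le _ _) _; rewrite geq_max rs andbT.
exact: leq_trans (msizeZ_le _ _) qs.
Qed.

Lemma PkZ n l (a : R) (u : 'rV[R]_n -> R) : Pk l u -> Pk l (fun x => a * u x).
Proof.
move=> Pu; have := Pk_lin a Pu (@Pk_const n l 0).
by under eq_fun do rewrite addr0.
Qed.

Lemma PkD n l (u v : 'rV[R]_n -> R) : Pk l u -> Pk l v -> Pk l (fun x => u x + v x).
Proof.
by move=> Pu Pv; have := Pk_lin 1 Pu Pv; under eq_fun do rewrite mul1r.
Qed.

Lemma PkB n l (u v : 'rV[R]_n -> R) : Pk l u -> Pk l v -> Pk l (fun x => u x - v x).
Proof.
move=> Pu Pv; have := Pk_lin (-1) Pv Pu.
by under eq_fun do rewrite mulN1r addrC.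
Qed.

Lemma Pk_sum n l (I : Type) (s : seq I) (P : pred I) (u : I -> 'rV[R]_n -> R) :
  (forall i, P i -> Pk l (u i)) -> Pk l (fun x => \sum_(i <- s | P i) u i x).
Proof.
move=> Pu; elim: s => [|i s IHs].
  by under eq_fun do rewrite big_nil; exact: Pk_const.
have [Pi|/negbTE Pi] := boolP (P i); under eq_fun do rewrite big_cons Pi; last exact: IHs.
by apply: PkD => //; exact: Pu.
Qed.

Lemma Pk_le n l l' (u : 'rV[R]_n -> R) : (l <= l')%N -> Pk l u -> Pk l' u.
Proof. by move=> ll' [q qs qE]; exists q => //; apply: leq_trans qs _. Qed.

Lemma Pk_coordM n l i (u : 'rV[R]_n -> R) : Pk l u -> Pk l.+1 (fun x => x 0 i * u x).
Proof.
move=> [q qs qE]; exists (mpolyX R (mnm1 i) * q); last first.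
  by move=> x; rewrite mevalM mevalXU qE.
have [->|q0] := eqVneq q 0; first by rewrite mulr0 msize0.
rewrite msizeM//; first by rewrite msizeX mdeg1.
by rewrite -(msize_poly_eq0 (mpolyX R (mnm1 i))) msizeX.
Qed.

Lemma Pk_coord n i : Pk 1 (fun x : 'rV[R]_n => x 0 i).
Proof.
by have := Pk_coordM i (@Pk_const n 0 1); under eq_fun do rewrite mulr1.
Qed.

(** Lets properties of polynomial functions be proved without opening their [mpoly] representation.
    The last clause raises a monomial of low degree to the level [l]. *)
Lemma Pk_ind n (P : nat -> ('rV[R]_n -> R) -> Prop) :
  (forall l a u v, P l u -> P l v -> P l (fun x => a * u x + v x)) ->
  (forall l c, P l (fun=> c)) ->
  (forall l i u, P l u -> P l.+1 (fun x => x 0 i * u x)) ->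
  (forall l u, P l u -> P l.+1 u) ->
  forall l v, Pk l v -> P l v.
Proof.
move=> Plin Pcst PX PS l v [q qs qE].
have Ple l1 l2 u : (l1 <= l2)%N -> P l1 u -> P l2 u.
  move=> /subnK <-; elim: (l2 - l1)%N => [//|k IHk] /IHk; rewrite addSn; exact: PS.
have Pmon k : forall al : 'I_n -> nat, (\sum_i al i)%N = k ->
    P k (fun x : 'rV[R]_n => \prod_i x 0 i ^+ al i).
  elim: k => [|k IHk] al alk.
    rewrite (_ : (fun x => _) = fun=> 1) //; apply/funext => x; rewrite big1// => i _.
    move/eqP: alk; rewrite sum_nat_eq0 => /forallP/(_ i)/eqP ->; exact: expr0.
  have [j alj] : exists j, (0 < al j)%N.
    apply: contrapT => h; move/eqP: alk; rewrite big1// => i _.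
    by apply/eqP; rewrite -leqn0 leqNgt; apply/negP => ?; apply: h; exists i.
  rewrite (_ : (fun x => _) = fun x : 'rV[R]_n => x 0 j * \prod_i x 0 i ^+ (al i - (i == j))).
    apply/PX/IHk; rewrite (bigD1 j)//= eqxx.
    under eq_bigr => i /negbTE -> do rewrite subn0.
    by move: alk; rewrite (bigD1 j)//=; lia.
  apply/funext => x; rewrite (bigD1 j)//= [in RHS](bigD1 j)//= eqxx mulrA.
  rewrite -exprS subn1 prednK//; congr (_ * _).
  by apply: eq_bigr => i /negbTE ->; rewrite subn0.
have -> : v = fun x : 'rV[R]_n => \sum_(m <- msupp q) mcoeff m q * \prod_i x 0 i ^+ m i.
  by apply/funext => x; rewrite qE mevalE.
have Pm m : m \in msupp q -> P l (fun x : 'rV[R]_n => \prod_i x 0 i ^+ m i).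
  move=> mq; apply: (Ple (mdeg m)); last by apply: Pmon; rewrite mdegE.
  by rewrite -ltnS; apply: leq_trans qs; exact: msize_mdeg_lt.
suff Ps s : {subset s <= msupp q} ->
    P l (fun x : 'rV[R]_n => \sum_(m <- s) mcoeff m q * \prod_i x 0 i ^+ m i) by exact: Ps.
elim: s => [_|m s IHs sub].
  by under eq_fun do rewrite big_nil; exact: Pcst.
under eq_fun do rewrite big_cons; apply: Plin.
  by apply: Pm; apply: sub; rewrite inE eqxx.
by apply: IHs => m' m's; apply: sub; rewrite inE m's orbT.
Qed.

Lemma Pk_continuous n l (v : 'rV[R]_n -> R) : Pk l v -> continuous v.
Proof.
move=> Pv; move: l v Pv; apply: Pk_ind => [_ a u v cu cv|_ c|_ i u cu|//].
- by apply: add_fun_continuous => //; apply: mul_fun_continuous => //; exact: const_fun_continuous.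
- exact: const_fun_continuous.
- by apply: mul_fun_continuous => //; exact: coord_continuous.
Qed.

Lemma Pk_comp_affine n m l (L : 'rV[R]_m -> 'rV[R]_n) (v : 'rV[R]_n -> R) :
  (forall i, exists (b : R) (c : 'I_m -> R), forall y, L y 0 i = b + \sum_j c j * y 0 j) ->
  Pk l v -> Pk l (fun y => v (L y)).
Proof.
move=> aff; move: l v; apply: Pk_ind => [l a u v|l c|l i u Pu|l u].
- exact: Pk_lin.
- exact: Pk_const.
- have [b [c Lc]] := aff i.
  rewrite (_ : (fun y => _) = fun y : 'rV[R]_m => b * u (L y) + \sum_j c j * (y 0 j * u (L y))).
    apply: Pk_lin; first exact: Pk_le Pu.
    by apply: Pk_sum => j _; apply: PkZ; exact: Pk_coordM.
  apply/funext => y; rewrite Lc mulrDl mulr_suml; congr (_ + _).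
  by apply: eq_bigr => j _; rewrite mulrA.
- exact: Pk_le.
Qed.

Lemma Pk_line n l (v : 'rV[R]_n -> R) (x0 d : 'rV[R]_n) : Pk l v ->
  exists q : {poly R}, forall t, v (x0 + t *: d) = q.[t].
Proof.
move: l v; apply: Pk_ind => [_ a u v [q qE] [r rE]|_ c|_ i u [q qE]|//].
- by exists (a *: q + r) => t; rewrite qE rE hornerD hornerZ.
- by exists c%:P => t; rewrite hornerC.
- exists (((x0 0 i)%:P + d 0 i *: 'X) * q) => t.
  by rewrite qE hornerM hornerD hornerC hornerZ hornerX !mxE [t * _]mulrC.
Qed.

(** On the line from an interior point [x0] to any [x], [v] is a univariate polynomial with
    infinitely many roots near the parameter 0. *)
Lemma Pk_eq0_open n l (v : 'rV[R]_n -> R) (O : set 'rV[R]_n) : Pk l v ->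
  O° !=set0 -> (forall x, O x -> v x = 0) -> v = fun=> 0.
Proof.
move=> Pv [x0 /nbhs_ballP[e /= e0 he]] v0; apply/funext => x.
have [q qE] := Pk_line x0 (x - x0) Pv.
suff q0 : q = 0 by rewrite -(subrKC x0 x) -[x - x0]scale1r qE q0 horner0.
apply: contrapT => /eqP q0.
(* The parameters in [s] are [size q] distinct numbers that move [x0] by less than [e], which are
   too many roots for [q]. The added 1 makes [D] positive also when [x = x0]. *)
pose D : R := `|x - x0| + 1.
have D0 : 0 < D by rewrite ltr_wpDl.
pose s := [seq e / (D * k.+2%:R) | k <- iota 0 (size q)].
have us : uniq s.
  rewrite map_inj_uniq ?iota_uniq// => i j /(mulfI (lt0r_neq0 e0))/invr_inj.
  by move=> /(mulfI (lt0r_neq0 D0))/eqP; rewrite eqr_nat => /eqP [].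
have rs : all (root q) s.
  apply/allP => _ /mapP[k _ ->]; apply/rootP; rewrite -qE; apply: v0; apply: he.
  rewrite -ball_normE /= opprD addrA subrr sub0r normrN normrZ gtr0_norm; last first.
    by rewrite divr_gt0// mulr_gt0.
  rewrite mulrAC ltr_pdivrMr ?mulr_gt0// ltr_pM2l//.
  apply: (@lt_le_trans _ _ D); first by rewrite ltrDl.
  by rewrite ler_pMr// ler1n.
by have := max_poly_roots q0 rs us; rewrite size_map size_iota ltnn.
Qed.

Lemma Pk_derive n l (v : 'rV[R]_n.+1 -> R) (d : 'rV[R]_n.+1) : Pk l v ->
  (forall x, derivable v x d) /\ Pk l ('D_d v).
Proof.
(* [Pk l v] is carried along the induction because the product rule brings back the undifferentiated
   factor. *)
move=> Pv; suff : [/\ Pk l v, forall x, derivable v x d & Pk l ('D_d v)] by case.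
move: l v Pv; apply: Pk_ind => [l a u v [Pu du Du] [Pv dv Dv]|l c|l i u [Pu du Du]|l u [Pu du Du]].
- split; first exact: Pk_lin.
    by move=> x; apply: derivableD => //; apply: derivableM.
  rewrite (_ : 'D_d _ = fun x => a * 'D_d u x + 'D_d v x); first exact: Pk_lin.
  apply/funext => x.
  rewrite (@deriveD _ _ _ (fun x => a * u x) v)//; last by apply: derivableM.
  by rewrite (@deriveM _ _ (cst a) u)//= derive_cst scaler0 addr0.
- split; [exact: Pk_const| |].
    by move=> x; exact: derivable_cst.
  rewrite (_ : 'D_d _ = fun=> 0); first exact: Pk_const.
  by apply/funext => x; rewrite derive_cst.
- have dc x : is_derive x d (fun y : 'rV[R]_n.+1 => y 0 i) (d 0 i).
    have lim_dc : h^-1 *: (((fun y : 'rV[R]_n.+1 => y 0 i) \o shift x) (h *: d) - x 0 i)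
        @[h --> 0^'] --> d 0 i.
      apply: cvg_near_cst; near=> h; rewrite /= !mxE addrK.
      by rewrite /GRing.scale /= mulKf//; near: h; exact: nbhs_dnbhs_neq.
    by apply: DeriveDef; [apply/cvg_ex; exists (d 0 i)|exact: cvg_lim].
  split; first exact: Pk_coordM.
    by move=> x; apply: derivableM.
  rewrite (_ : 'D_d _ = fun x : 'rV[R]_n.+1 => d 0 i * u x + x 0 i * 'D_d u x).
    by apply: Pk_lin; [exact: Pk_le Pu|exact: Pk_coordM].
  apply/funext => x; rewrite (@deriveM _ _ (fun y : 'rV[R]_n.+1 => y 0 i) u)//=.
  by rewrite derive_val addrC; congr (_ + _); rewrite /GRing.scale /= mulrC.
- by split=> //; apply: Pk_le (leqnSn l) _.
Unshelve. all: by end_near. Qed.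

Lemma Pk_grad n l (v : 'rV[R]_n.+1 -> R) : Pk l v -> Pkv l (grad v).
Proof.
move=> Pv i; rewrite (_ : (fun x => _) = 'D_(delta_mx 0 i) v).
  exact: (Pk_derive _ Pv).2.
by apply/funext => x; rewrite mxE.
Qed.

(** The coordinates of [x] are brought to 0 one after the other; along each such move [v] has zero
    derivative. [xk m] is [x] with its first [m] coordinates erased. *)
Lemma Pk_grad_eq0 n l (v : 'rV[R]_n.+1 -> R) : Pk l v -> grad v = (fun=> 0) ->
  forall x, v x = v 0.
Proof.
move=> Pv gv0 x.
have step i (y : 'rV[R]_n.+1) t : v (t *: delta_mx 0 i + y) = v y.
  pose g (s : R) := v (s *: delta_mx 0 i + y).
  have gE s h : g (h *: 1 + s) = v (h *: delta_mx 0 i + (s *: delta_mx 0 i + y)).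
    by rewrite /g [h *: 1]mulr1 scalerDl addrA.
  have dg s : is_derive s (1 : R) g 0.
    have [dv _] := Pk_derive (delta_mx 0 i) Pv.
    have /= D0 : 'D_(delta_mx 0 i) v (s *: delta_mx 0 i + y) = 0.
      by have := congr1 (fun G : 'rV[R]_n.+1 -> 'rV[R]_n.+1 => G (s *: delta_mx 0 i + y) 0 i) gv0;
        rewrite !mxE.
    apply: DeriveDef.
      rewrite /derivable; under eq_fun do rewrite /= gE.
      exact: dv.
    rewrite -[RHS]D0 /derive; under eq_fun do rewrite /= gE.
    by [].
  have := is_derive_0_is_cst t 0 dg.
  by rewrite /g scale0r add0r.
pose xk m : 'rV[R]_n.+1 := \row_i (if (i < m)%N then 0 else x 0 i).
have xkv m : (m <= n.+1)%N -> v (xk m) = v x.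
  elim: m => [_|m IHm mn]; first by congr v; apply/rowP => i; rewrite mxE.
  rewrite -IHm; last exact: ltnW.
  rewrite -[LHS](step (Ordinal mn) _ (x 0 (Ordinal mn))); congr v.
  apply/rowP => i; rewrite !mxE eqxx /= -val_eqE /= ltnS leq_eqVlt.
  have [im|im] := eqVneq (i : nat) m; last by rewrite mulr0 add0r.
  rewrite im ltnn mulr1 addr0; congr (x 0 _); exact: val_inj.
rewrite -(xkv n.+1)//; congr v; apply/rowP => i.
by rewrite !mxE ltn_ord.
Qed.

End Pk.

(** * Finite-dimensional subspaces *)

Section FiniteDimension.
Context {R : realType}.

Definition spanned (E : lmodType R) (J : finType) (e : J -> E) : set E :=
  [set \sum_j c j *: e j | c in [set: J -> R]].

(** The spaces of the scheme are sets of functions inside infinite-dimensional modules. The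
    generating family need not be free. *)
Definition fdim (E : lmodType R) (W : set E) : Prop :=
  exists (J : finType) (e : J -> E), W = spanned e.

(** Linearity is relative to [W] because the operators chosen by [xget] are controlled on discrete
    functions only. *)
Definition linear_on (E : lmodType R) (W : set E) (F : lmodType R) (f : E -> F) : Prop :=
  forall a u v, W u -> W v -> f (a *: u + v) = a *: f u + f v.

Section subspace.
Variables (E : lmodType R) (W : set E).
Hypothesis fW : fdim W.

Lemma fdim0 : W 0.
Proof.
have [J [e ->]] := fW; exists (fun=> 0) => //.
by rewrite big1// => j _; rewrite scale0r.
Qed.

Lemma fdim_lin a u v : W u -> W v -> W (a *: u + v).
Proof.
have [J [e ->]] := fW => -[c _ <-] [c' _ <-]; exists (fun j => a * c j + c' j) => //.
rewrite scaler_sumr -big_split; apply: eq_bigr => j _.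
by rewrite scalerDl scalerA.
Qed.

Lemma fdimZ a u : W u -> W (a *: u).
Proof. by move=> Wu; rewrite -[_ *: _]addr0; apply: fdim_lin => //; exact: fdim0. Qed.

Lemma fdimD u v : W u -> W v -> W (u + v).
Proof. by move=> Wu Wv; rewrite -[u]scale1r; exact: fdim_lin. Qed.

Lemma fdimB u v : W u -> W v -> W (u - v).
Proof. by move=> Wu Wv; rewrite addrC -scaleN1r; exact: fdim_lin. Qed.

Lemma fdim_sum (I : finType) (u : I -> E) (c : I -> R) : (forall i, W (u i)) ->
  W (\sum_i c i *: u i).
Proof.
move=> Wu; apply: (big_ind W); [exact: fdim0|exact: fdimD|].
by move=> i _; apply: fdimZ.
Qed.

Lemma linear_on0 (F : lmodType R) (f : E -> F) : linear_on W f -> f 0 = 0.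
Proof.
move=> lf; have := lf (-1) 0 0 fdim0 fdim0.
by rewrite scaler0 addr0 scaleN1r addNr.
Qed.

Lemma linear_on_sum (F : lmodType R) (f : E -> F) (I : finType) (u : I -> E) (c : I -> R) :
  linear_on W f -> (forall i, W (u i)) ->
  f (\sum_i c i *: u i) = \sum_i c i *: f (u i).
Proof.
move=> lf Wu.
suff [] : f (\sum_i c i *: u i) = \sum_i c i *: f (u i) /\ W (\sum_i c i *: u i) by [].
apply: (big_rec2 (fun x y => f y = x /\ W y)); first by split; [exact: linear_on0|exact: fdim0].
move=> i y x _ [fx Wx]; rewrite lf// fx; split=> //; exact: fdim_lin.
Qed.

Variables (B : E -> E -> R) (L : E -> R).
Hypotheses (Bl : forall z, W z -> linear_on W (B^~ z : E -> R^o))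
  (Br : forall w, W w -> linear_on W (B w : E -> R^o)).

Lemma riesz_unique : (forall w, W w -> B w w = 0 -> w = 0) ->
  forall w w', W w -> W w' -> (forall z, W z -> B w z = B w' z) -> w = w'.
Proof.
move=> Bpos w w' Ww Ww' e; apply/eqP; rewrite -subr_eq0; apply/eqP.
have Wd := fdimB Ww Ww'; apply: Bpos => //.
have := Bl Wd (-1) Ww' Ww; rewrite scaleN1r addrC => ->.
by rewrite e// scaleN1r addNr.
Qed.

(** As the generating family may be dependent, the matrix [A] of [B] may be singular. The system is
    still solvable: a cokernel vector of [A] yields a [w] with [B u w = 0] for all generators [u],
    hence [B w w = 0] and [w = 0], so that [L] vanishes on this combination too. *)
Lemma riesz : linear_on W (L : E -> R^o) -> (forall w, W w -> B w w = 0 -> w = 0) ->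
  exists2 w, W w & forall z, W z -> B w z = L z.
Proof.
move=> lL Bpos; have [J [e We]] := fW.
have We' j : W (e j).
  rewrite We; exists (fun i => (i == j)%:R) => //.
  by rewrite (bigD1 j)//= eqxx scale1r big1 ?addr0// => i /negbTE ->; rewrite scale0r.
pose A : 'M[R]_#|J| := \matrix_(i, j) B (e (enum_val i)) (e (enum_val j)).
pose l : 'rV[R]_#|J| := \row_j L (e (enum_val j)).
have comb (v : 'I_#|J| -> R) : W (\sum_i v i *: e (enum_val i)).
  exact: fdim_sum.
have : (l <= A)%MS.
  rewrite submxE; apply/eqP/rowP => k; rewrite [in RHS]mxE.
  have Ak (i : 'I_#|J|) : \sum_j B (e (enum_val i)) (e (enum_val j)) * cokermx A j k = 0.
    have /matrixP/(_ i k) := mulmx_coker A; rewrite mxE [RHS]mxE => Aik.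
    by rewrite -[RHS]Aik; apply: eq_bigr => j _; rewrite [A i j]mxE.
  pose w := \sum_j cokermx A j k *: e (enum_val j).
  have w0 : w = 0.
    apply: Bpos; first exact: comb.
    have := @linear_on_sum _ (B^~ w : E -> R^o) _ (fun j => e (enum_val j))
      (fun j => cokermx A j k) (Bl (comb _)) (fun _ => We' _).
    rewrite -/w => ->; rewrite big1// => i _.
    suff -> : B (e (enum_val i)) w = 0 by rewrite scaler0.
    have := @linear_on_sum _ (B (e (enum_val i)) : E -> R^o) _ (fun j => e (enum_val j))
      (fun j => cokermx A j k) (Br (We' _)) (fun _ => We' _).
    rewrite -/w => ->; rewrite -[RHS](Ak i).
    by apply: eq_bigr => j _; rewrite /GRing.scale /= mulrC.
  have := @linear_on_sum _ (L : E -> R^o) _ (fun j => e (enum_val j))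
      (fun j => cokermx A j k) lL (fun _ => We' _).
  rewrite -/w w0 (linear_on0 lL) => e0.
  rewrite mxE [RHS]e0; apply: eq_bigr => j _.
  by rewrite [l 0 j]mxE /GRing.scale /= mulrC.
move=> /submxP[c lc]; exists (\sum_i c 0 i *: e (enum_val i)); first exact: comb.
have Be j : B (\sum_i c 0 i *: e (enum_val i)) (e j) = L (e j).
  have := @linear_on_sum _ (B^~ (e j) : E -> R^o) _ (fun j => e (enum_val j))
      (fun i => c 0 i) (Bl (We' j)) (fun _ => We' _).
  move=> ->; have /rowP/(_ (enum_rank j)) := lc; rewrite !mxE enum_rankK => ->.
  by apply: eq_bigr => i _; rewrite mxE enum_rankK.
move=> z; rewrite {1}We => -[d _ <-].
rewrite (@linear_on_sum _ (L : E -> R^o) _ e d lL We').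
rewrite (@linear_on_sum _ (B _ : E -> R^o) _ e d (Br (comb _)) We').
by apply: eq_bigr => j _; rewrite Be.
Qed.

End subspace.

Lemma fdim_set0 (E : lmodType R) : fdim [set 0 : E].
Proof.
exists void, (fun=> 0); apply/seteqP; split=> [_ ->|_ [c _ <-]].
  by exists (fun=> 0) => //; rewrite big1// => -[].
by rewrite big1// => -[].
Qed.

Lemma fdim_pair (E F : lmodType R) (W : set E) (V : set F) : fdim W -> fdim V ->
  fdim [set x : E * F | W x.1 /\ V x.2].
Proof.
move=> [I [e ->]] [J [f ->]].
exists (I + J)%type, (fun z => match z with inl i => (e i, 0) | inr j => (0, f j) end).
set h := fun z : I + J => _.
have sumE (c : I + J -> R) :
    \sum_z c z *: h z = (\sum_i c (inl i) *: e i, \sum_j c (inr j) *: f j).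
  have sum1 : (\sum_z c z *: h z).1 = \sum_z (c z *: h z).1.
    by apply: (big_rec2 (fun (x : E * F) y => x.1 = y)) => // ? ? ? _ <-.
  have sum2 : (\sum_z c z *: h z).2 = \sum_z (c z *: h z).2.
    by apply: (big_rec2 (fun (x : E * F) y => x.2 = y)) => // ? ? ? _ <-.
  apply: injective_projections; rewrite ?sum1 ?sum2 big_sumType /=.
    by rewrite [X in _ + X]big1 ?addr0// => j _; rewrite scaler0.
  by rewrite [X in X + _]big1 ?add0r// => i _; rewrite scaler0.
apply/seteqP; split=> [[x y] /= [[c _ cx] [d _ dy]]|_ [c _ <-]].
  exists (fun z => match z with inl i => c i | inr j => d j end); first by [].
  by rewrite sumE -cx -dy.
by rewrite sumE; split; [exists (c \o inl)|exists (c \o inr)].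
Qed.

Lemma fdim_fun (J : finType) (E : lmodType R) (W : J -> set E) :
  (forall j, fdim (W j)) -> fdim [set f : J -> E | forall j, W j (f j)].
Proof.
move=> /choice[K hK].
pose e j := projT1 (cid (hK j)); have eP j : W j = spanned (e j) by exact: (projT2 (cid (hK j))).
exists {j : J & K j}, (fun z j => if tag z == j then e (tag z) (tagged z) else 0).
have sumE (c : {j : J & K j} -> R) j :
    (\sum_z c z *: (fun j => if tag z == j then e (tag z) (tagged z) else 0)) j =
    \sum_k c (Tagged K k) *: e j k.
  rewrite fct_sumE.
  rewrite (eq_bigr (fun z => c (Tagged K (tagged z)) *:
    (if tag z == j then e (tag z) (tagged z) else 0))); last by case.
  rewrite -(@sig_big_dep _ _ _ _ K xpredT (fun _ => xpredT)
    (fun i k => c (Tagged K k) *: (if i == j then e i k else 0)))/=.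
  rewrite (bigD1 j)//= eqxx [X in _ + X]big1 ?addr0// => i /negbTE ij.
  by rewrite big1// => k _; rewrite ij scaler0.
apply/seteqP; split=> [f fW|_ [c _ <-] j]; last first.
  by rewrite sumE eP; exists (fun k => c (Tagged K k)).
have hc j : exists c : K j -> R, f j = \sum_k c k *: e j k.
  by have := fW j; rewrite eP => -[c _ <-]; exists c.
exists (fun z => projT1 (cid (hc (tag z))) (tagged z)) => //.
by apply/funext => j; rewrite sumE /= -(projT2 (cid (hc j))).
Qed.

Lemma fdim_image (E F : lmodType R) (W : set E) (g : E -> F) : linear_on setT g ->
  fdim W -> fdim (g @` W).
Proof.
move=> lg [J [e ->]]; exists J, (g \o e).
have g0 : g 0 = 0.
  by have := lg (-1) 0 0 I I; rewrite scaler0 addr0 scaleN1r addNr.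
have gs c : g (\sum_j c j *: e j) = \sum_j c j *: g (e j).
  by apply: (big_rec2 (fun x y => g y = x)) => // j y x _ <-; rewrite lg.
apply/seteqP; split=> [_ [_ [c _ <-] <-]|_ [c _ <-]].
  by exists c.
by exists (\sum_j c j *: e j) => //; exists c.
Qed.

Lemma fdim_Pk n l : fdim (@Pk R n l).
Proof.
exists (bmultinom n l.+1), (fun m (x : 'rV[R]_n) => \prod_i x 0 i ^+ bmnm m i).
apply/seteqP; split=> [v [q qs qE]|_ [c _ <-]].
  exists (fun m => mcoeff (bmnm m) q) => //; apply/funext => x.
  rewrite fct_sumE qE [in RHS](mpolywE qs) raddf_sum; apply: eq_bigr => m _ /=.
  by rewrite mevalZ mevalX.
rewrite (_ : \sum_j _ = fun x : 'rV[R]_n =>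
    \sum_(m : bmultinom n l.+1) c m * \prod_i x 0 i ^+ bmnm m i).
  apply: Pk_sum => m _; apply: PkZ; exists (mpolyX R (bmnm m)).
    by rewrite msizeX; exact: bmdeg.
  by move=> x; rewrite mevalX.
by apply/funext => x; rewrite fct_sumE.
Qed.

(** A generating family of least length is free. Freeness is what turns a vanishing discrete
    function into vanishing coordinates. *)
Lemma fdim_basis (E : lmodType R) (W : set E) : fdim W ->
  exists m (e : 'I_m -> E), W = spanned e /\
    forall c : 'I_m -> R, \sum_i c i *: e i = 0 -> forall i, c i = 0.
Proof.
move=> [J [e0 We0]].
have exm : exists m, `[< exists e : 'I_m -> E, W = spanned e >].
  exists #|J|; apply/asboolP; exists (fun i => e0 (enum_val i)); rewrite We0.
  apply/seteqP; split=> _ [c _ <-].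
    by exists (fun i => c (enum_val i)) => //;
      rewrite [RHS](reindex _ (onW_bij _ (@enum_val_bij J))).
  exists (fun j => c (enum_rank j)) => //; rewrite (reindex _ (onW_bij _ (@enum_val_bij J)))/=.
  by apply: eq_bigr => i _; rewrite enum_valK.
case: (ex_minnP exm) => m /asboolP[e We] minm.
exists m, e; split=> // c c0 i0; apply/eqP/negPn/negP => ci0.
case: m e We minm c c0 i0 ci0 => [|m] e We minm c c0 i0 ci0; first by case: i0 ci0.
suff : (m.+1 <= m)%N by rewrite ltnn.
apply: minm; apply/asboolP; exists (fun j => e (lift i0 j)); rewrite We.
have ei0 : e i0 = \sum_j (- (c (lift i0 j) / c i0)) *: e (lift i0 j).
  move: c0; rewrite (bigD1_ord i0)//= => /eqP; rewrite addr_eq0 => /eqP c0.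
  apply: (scalerI ci0); rewrite c0 scaler_sumr -sumrN; apply: eq_bigr => j _.
  by rewrite scalerA mulrN mulrCA mulfV// mulr1 scaleNr.
apply/seteqP; split=> _ [d _ <-].
  exists (fun j => d (lift i0 j) - d i0 * (c (lift i0 j) / c i0)) => //.
  rewrite [RHS](bigD1_ord i0)//= ei0 scaler_sumr -big_split; apply: eq_bigr => j _ /=.
  by rewrite scalerA -scalerDl mulrN addrC.
exists (fun i => if unlift i0 i is Some j then d j else 0) => //.
rewrite (bigD1_ord i0)//= unlift_none scale0r add0r.
by apply: eq_bigr => j _; rewrite liftK.
Qed.

End FiniteDimension.

(** * Projections and reconstructions *)

Lemma interior_interior (T : topologicalType) (A : set T) : A°° = A°.
Proof. by apply/interior_id; exact: open_interior. Qed.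

Lemma fun_linE (R : realType) (T : Type) (E : lmodType R) (a : R) (u v : T -> E) x :
  (a *: u + v) x = a *: u x + v x.
Proof. by []. Qed.

Section Integrals.
Context {R : realType} {n : nat}.
Variable D : set 'rV[R]_n.
Hypotheses (mD : measurable D) (bD : bounded_set D).

Lemma Rint_lin (f g : 'rV[R]_n -> R) (a : R) : continuous f -> continuous g ->
  \int[leb n]_(x in D) (a * f x + g x) =
  a * \int[leb n]_(x in D) f x + \int[leb n]_(x in D) g x.
Proof.
move=> cf cg; have caf : continuous (fun x => a * f x).
  by apply: mul_fun_continuous => //; exact: const_fun_continuous.
by rewrite RintegralD// ?RintegralZl//; apply: continuous_integrable.
Qed.

Lemma RintB (f g : 'rV[R]_n -> R) : continuous f -> continuous g ->
  \int[leb n]_(x in D) (f x - g x) =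
  \int[leb n]_(x in D) f x - \int[leb n]_(x in D) g x.
Proof. by move=> cf cg; rewrite RintegralB//; apply: continuous_integrable. Qed.

Lemma Pk_int_sqr_eq0 l (v : 'rV[R]_n -> R) : D° !=set0 -> Pk l v ->
  \int[leb n]_(x in D) (v x * v x) = 0 -> v = fun=> 0.
Proof.
move=> D0 Pv I0; apply: (@Pk_eq0_open _ _ l _ D°) => //; first by rewrite interior_interior.
move=> x Dx; apply/eqP; rewrite -sqrf_eq0 expr2; apply/eqP; move: x Dx.
have cv := Pk_continuous Pv.
apply: (Rintegral_eq0_interior mD bD) => //; first exact: mul_fun_continuous.
by move=> x; rewrite -expr2 sqr_ge0.
Qed.

Lemma Pkv_continuous l (phi : 'rV[R]_n -> 'rV[R]_n) : Pkv l phi -> continuous phi.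
Proof. by move=> Pphi; apply: rV_continuous => i; exact: Pk_continuous (Pphi i). Qed.

Lemma Pkv_int_sqr_eq0 l (phi : 'rV[R]_n -> 'rV[R]_n) : D° !=set0 -> Pkv l phi ->
  \int[leb n]_(x in D) dotv (phi x) (phi x) = 0 -> phi = fun=> 0.
Proof.
move=> D0 Pphi I0; apply/funext => x; apply/rowP => i; rewrite [RHS]mxE.
suff e : (fun x => phi x 0 i) = fun=> 0 by have := congr1 (fun f => f x) e.
apply: (Pk_eq0_open (Pphi i) _ (O := D°)); first by rewrite interior_interior.
move=> y Dy; suff -> : phi y = 0 by rewrite mxE.
apply: dotv_eq0; move: y Dy; have cphi := Pkv_continuous Pphi.
apply: (Rintegral_eq0_interior mD bD) => //; first exact: dotv_fun_continuous.
by move=> y; exact: dotv_ge0.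
Qed.

Section l2proj.
Variable l : nat.
Hypothesis D0 : D° !=set0.

Let mulc (f g : 'rV[R]_n -> R) :
  continuous f -> continuous g -> continuous (fun x : 'rV[R]_n => f x * g x) :=
  @mul_fun_continuous R _ f g.

Lemma l2projP (w : 'rV[R]_n -> R) : continuous w ->
  Pk l (l2proj l D w) /\ forall z, Pk l z ->
    \int[leb n]_(x in D) (l2proj l D w x * z x) = \int[leb n]_(x in D) (w x * z x).
Proof.
move=> cw; apply: (@xgetPex _ (fun=> 0) [set v | Pk l v /\ forall z, Pk l z ->
    \int[leb n]_(x in D) (v x * z x) = \int[leb n]_(x in D) (w x * z x)]).
have [||||v Pv vP] := @riesz R _ _ (@fdim_Pk R n l)
  (fun v z => \int[leb n]_(x in D) (v x * z x)) (fun z => \int[leb n]_(x in D) (w x * z x)).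
- move=> z /Pk_continuous cz a u v /Pk_continuous cu /Pk_continuous cv.
  rewrite -Rint_lin; [|exact: mulc..].
  by apply: eq_Rintegral => x _; rewrite fun_linE mulrDl -mulrA.
- move=> z /Pk_continuous cz a u v /Pk_continuous cu /Pk_continuous cv.
  rewrite -Rint_lin; [|exact: mulc..].
  by apply: eq_Rintegral => x _; rewrite fun_linE mulrDr mulrCA.
- move=> a u v /Pk_continuous cu /Pk_continuous cv.
  rewrite -Rint_lin; [|exact: mulc..].
  by apply: eq_Rintegral => x _; rewrite fun_linE mulrDr mulrCA.
- by move=> w' Pw; exact: Pk_int_sqr_eq0 Pw.
by exists v.
Qed.

Lemma l2proj_unique (w v : 'rV[R]_n -> R) : continuous w -> Pk l v ->
  (forall z, Pk l z ->
    \int[leb n]_(x in D) (v x * z x) = \int[leb n]_(x in D) (w x * z x)) ->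
  l2proj l D w = v.
Proof.
move=> cw Pv vE; have [Pw wE] := l2projP cw.
apply: (@riesz_unique R _ _ (@fdim_Pk R n l) (fun v z => \int[leb n]_(x in D) (v x * z x))) => //.
- move=> z /Pk_continuous cz a u1 u2 /Pk_continuous cu /Pk_continuous cv.
  rewrite -Rint_lin; [|exact: mulc..].
  by apply: eq_Rintegral => x _; rewrite fun_linE mulrDl -mulrA.
- by move=> w' Pw'; exact: Pk_int_sqr_eq0 Pw'.
by move=> z Pz; rewrite wE// vE.
Qed.

Lemma l2proj_id v : Pk l v -> l2proj l D v = v.
Proof. by move=> Pv; apply: l2proj_unique => //; exact: Pk_continuous Pv. Qed.

Lemma l2proj_lin a u v : continuous u -> continuous v ->
  l2proj l D (a *: u + v) = a *: l2proj l D u + l2proj l D v.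
Proof.
move=> cu cv; have [Pu uE] := l2projP cu; have [Pv vE] := l2projP cv.
have cPu := Pk_continuous Pu; have cPv := Pk_continuous Pv.
apply: l2proj_unique; [|exact: Pk_lin|].
  apply: add_fun_continuous => //; apply: mul_fun_continuous => //.
  exact: const_fun_continuous.
move=> z Pz; have cz := Pk_continuous Pz.
transitivity (a * \int[leb n]_(x in D) (l2proj l D u x * z x) +
    \int[leb n]_(x in D) (l2proj l D v x * z x)).
  rewrite -Rint_lin; [|exact: mulc..].
  by apply: eq_Rintegral => x _; rewrite fun_linE mulrDl -mulrA.
rewrite uE// vE// -Rint_lin; [|exact: mulc..].
by apply: eq_Rintegral => x _; rewrite fun_linE mulrDl -mulrA.
Qed.
End l2proj.
End Integrals.

Lemma pair_fun_lin1 (R : realType) (I J : Type) (E F : lmodType R) (a : R)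
  (u v : (I -> E) * (J -> F)) i : (a *: u + v).1 i = a *: u.1 i + v.1 i.
Proof. by []. Qed.

Section Operators.
Context {R : realType} {n : nat} (M : mesh R n) (k : nat).
Hypothesis eltP : forall T : telt M, [/\ open (elt T), bounded_set (elt T) & elt T !=set0].
Hypothesis fdomP : forall F : tface M,
  [/\ closed (fdom F), bounded_set (fdom F) & (fdom F)° !=set0].

Implicit Types (T : telt M) (F : tface M).

Let mT T : measurable (elt T).
Proof. by have [oT _ _] := eltP T; exact: open_measurable_rV. Qed.
Let bT T : bounded_set (elt T).
Proof. by have [] := eltP T. Qed.
Let iT T : (elt T)° !=set0.
Proof. by have [/interior_id -> _] := eltP T. Qed.
Let mF F : measurable (fdom F).
Proof. by have [cF _ _] := fdomP F; exact: closed_measurable_rV. Qed.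
Let bF F : bounded_set (fdom F).
Proof. by have [] := fdomP F. Qed.
Let iF F : (fdom F)° !=set0.
Proof. by have [] := fdomP F. Qed.

Let mulc m (f g : 'rV[R]_m -> R) :
  continuous f -> continuous g -> continuous (fun x : 'rV[R]_m => f x * g x) :=
  @mul_fun_continuous R _ f g.
Let subc m (f g : 'rV[R]_m -> R) :
  continuous f -> continuous g -> continuous (fun x : 'rV[R]_m => f x - g x) :=
  @sub_fun_continuous R _ f g.
Let dotc m p (f g : 'rV[R]_m -> 'rV[R]_p) : continuous f -> continuous g ->
  continuous (fun x : 'rV[R]_m => dotv (f x) (g x)) := @dotv_fun_continuous R _ _ f g.

Lemma Pk_chart F l v : Pk l v -> Pk l (v \o chart F).
Proof.
apply: Pk_comp_affine => i; exists (org F 0 i), (fun j => frm F j i) => y.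
by rewrite !mxE; congr (_ + _); apply: eq_bigr => j _; rewrite mulrC.
Qed.

Lemma chart_continuous F : continuous (chart F).
Proof.
apply: rV_continuous => i; apply: (@Pk_continuous _ _ 1).
exact: (Pk_chart F (Pk_coord i)).
Qed.

Lemma fdim_Uh : fdim (@Uh R n M k).
Proof.
exact: (fdim_pair (fdim_fun (fun T : telt M => fdim_Pk n.+1 k))
  (fdim_fun (fun F : tface M => fdim_Pk n k))).
Qed.

Lemma fdim_Uh0 (Omega : set 'rV[R]_n.+1) : fdim (@Uh0 R n M k Omega).
Proof.
pose W F : set ('rV[R]_n -> R) :=
  if `[< boundary_face Omega F >] then [set 0] else @Pk R n k.
have fW F : fdim (W F).
  by rewrite /W; case: ifP => _; [exact: fdim_set0|exact: fdim_Pk].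
have := fdim_pair (fdim_fun (fun T : telt M => fdim_Pk n.+1 k)) (fdim_fun fW).
congr fdim; apply/seteqP; split=> v.
  move=> [v1 v2]; split; first split=> // F.
    by have := v2 F; rewrite /W; case: ifP => // _ ->; exact: Pk_const.
  by move=> F bF'; have := v2 F; rewrite /W asboolT.
move=> [[v1 v2] v0]; split=> // F; rewrite /W; case: ifP => [/asboolP/v0 ->//|_].
exact: v2.
Qed.

Lemma fdim_Pkv m l : fdim (@Pkv R m l).
Proof.
pose g (f : 'I_m -> 'rV[R]_m -> R) (x : 'rV[R]_m) : 'rV[R]_m := \row_i f i x.
have lg : linear_on setT g.
  by move=> a u v _ _; apply/funext => x; apply/rowP => i; rewrite !mxE.
have := fdim_image lg (fdim_fun (fun _ : 'I_m => fdim_Pk m l)).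
congr fdim; apply/seteqP; split=> [_ [f Pf <-] i|phi Pphi].
  by rewrite (_ : (fun x => _) = f i); [exact: Pf|apply/funext => x; rewrite mxE].
exists (fun i x => phi x 0 i) => //.
by apply/funext => x; apply/rowP => i; rewrite mxE.
Qed.

Lemma grad_lin l a (u v : 'rV[R]_n.+1 -> R) : Pk l u -> Pk l v ->
  grad (a *: u + v) = a *: grad u + grad v.
Proof.
move=> Pu Pv; apply/funext => x; apply/rowP => i; rewrite !mxE.
have [du _] := Pk_derive (delta_mx 0 i) Pu; have [dv _] := Pk_derive (delta_mx 0 i) Pv.
by rewrite deriveD//; [rewrite deriveZ|exact: derivableZ].
Qed.

Let dgrad_rhs T (v : hybrid M) (phi : 'rV[R]_n.+1 -> 'rV[R]_n.+1) : R :=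
    \int[leb n.+1]_(x in elt T) dotv (grad (v.1 T) x) (phi x) +
    \sum_(F | face_of T F) \int[leb n]_(y in fdom F)
      ((v.2 F y - v.1 T (chart F y)) * dotv (phi (chart F y)) (normal T F)).

Let jump_continuous T F (v : hybrid M) : Uh k v ->
  continuous (fun y => v.2 F y - v.1 T (chart F y)).
Proof.
move=> [v1 v2]; apply: subc; first exact: Pk_continuous (v2 F).
by have := Pk_continuous (Pk_chart F (v1 T)).
Qed.

Let flux_continuous T F phi : Pkv k phi ->
  continuous (fun y => dotv (phi (chart F y)) (normal T F)).
Proof.
move=> Pphi; apply: dotc; last exact: cst_continuous.
move=> y; apply: continuous_comp; [exact: chart_continuous|exact: Pkv_continuous Pphi _].
Qed.

Let dgrad_rhs_linl T phi : Pkv k phi ->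
  linear_on (@Uh R n M k) (dgrad_rhs T ^~ phi : hybrid M -> R^o).
Proof.
move=> Pphi a u v Uu Uv; rewrite /dgrad_rhs.
have [[u1 _] [v1 _]] := (Uu, Uv).
rewrite (_ : grad ((a *: u + v).1 T) = a *: grad (u.1 T) + grad (v.1 T));
  last exact: (grad_lin a (u1 T) (v1 T)).
have gu := Pkv_continuous (Pk_grad (u1 T)); have gv := Pkv_continuous (Pk_grad (v1 T)).
have cphi := Pkv_continuous Pphi.
rewrite scalerDr addrACA; congr (_ + _).
  rewrite -Rint_lin; [|by []|by []|exact: dotc|exact: dotc].
  by apply: eq_Rintegral => x _; rewrite fun_linE dotvDl dotvZl.
rewrite scaler_sumr -big_split; apply: eq_bigr => F _ /=.
rewrite -Rint_lin; [|by []|by []|by apply: mulc; [exact: jump_continuous|exact: flux_continuous]..].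
apply: eq_Rintegral => y _ /=.
rewrite !fctE /GRing.scale /=; ring.
Qed.

Let dgrad_rhs_linr T v : Uh k v -> linear_on (@Pkv R n.+1 k) (dgrad_rhs T v : _ -> R^o).
Proof.
move=> Uv a phi psi Pphi Ppsi; rewrite /dgrad_rhs.
have [v1 _] := Uv; have gv := Pkv_continuous (Pk_grad (v1 T)).
have cphi := Pkv_continuous Pphi; have cpsi := Pkv_continuous Ppsi.
rewrite scalerDr addrACA; congr (_ + _).
  rewrite -Rint_lin; [|by []|by []|exact: dotc|exact: dotc].
  by apply: eq_Rintegral => x _; rewrite fun_linE dotvDr dotvZr.
rewrite scaler_sumr -big_split; apply: eq_bigr => F _ /=.
rewrite -Rint_lin; [|by []|by []|by apply: mulc; [exact: jump_continuous|exact: flux_continuous]..].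
by apply: eq_Rintegral => y _ /=; rewrite fun_linE dotvDl dotvZl mulrDr mulrCA.
Qed.

Let dotint T (phi psi : 'rV[R]_n.+1 -> 'rV[R]_n.+1) : R :=
  \int[leb n.+1]_(x in elt T) dotv (phi x) (psi x).

Let dotint_linl T psi : continuous psi ->
  linear_on (@Pkv R n.+1 k) (dotint T ^~ psi : _ -> R^o).
Proof.
move=> cpsi a phi phi' /Pkv_continuous cphi /Pkv_continuous cphi'; rewrite /dotint.
rewrite -Rint_lin; [|by []|by []|exact: dotc|exact: dotc].
by apply: eq_Rintegral => x _; rewrite fun_linE dotvDl dotvZl.
Qed.

Let dotintC T phi psi : dotint T phi psi = dotint T psi phi.
Proof. by apply: eq_Rintegral => x _; rewrite dotvC. Qed.

Let dotint_pos T phi : Pkv k phi -> dotint T phi phi = 0 -> phi = 0.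
Proof. by move=> Pphi; exact: Pkv_int_sqr_eq0 Pphi. Qed.

Lemma dgradP T v : Uh k v -> is_dgrad k T v (dgrad k T v).
Proof.
move=> Uv; apply: (@xgetPex _ (fun=> 0) [set G | is_dgrad k T v G]).
have [||||G PG GE] := @riesz R _ _ (fdim_Pkv n.+1 k) (dotint T) (dgrad_rhs T v).
- by move=> psi /Pkv_continuous; exact: dotint_linl.
- move=> psi /Pkv_continuous cpsi a u w Pu Pw.
  by rewrite !(dotintC T psi); exact: dotint_linl.
- exact: dgrad_rhs_linr.
- exact: dotint_pos.
by exists G.
Qed.

Lemma dgrad_unique T v G : Uh k v -> is_dgrad k T v G -> dgrad k T v = G.
Proof.
move=> Uv [PG GE]; have [PG' GE'] := dgradP T Uv.
apply: (@riesz_unique R _ _ (fdim_Pkv n.+1 k) (dotint T)) => //.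
- by move=> psi /Pkv_continuous; exact: dotint_linl.
- exact: dotint_pos.
by move=> phi Pphi; rewrite /dotint GE// GE'.
Qed.

Lemma Pkv_lin m l a (u v : 'rV[R]_m -> 'rV[R]_m) : Pkv l u -> Pkv l v -> Pkv l (a *: u + v).
Proof. exact: (fdim_lin (fdim_Pkv m l)). Qed.

Lemma dgrad_lin T : linear_on (@Uh R n M k) (@dgrad R n M k T).
Proof.
move=> a u v Uu Uv; apply: dgrad_unique; first exact: (fdim_lin fdim_Uh).
have [Pu uE] := dgradP T Uu; have [Pv vE] := dgradP T Uv.
split; first exact: Pkv_lin.
move=> phi Pphi; rewrite -/(dotint T _ phi) -/(dgrad_rhs T _ phi).
rewrite dotint_linl//; last exact: Pkv_continuous Pphi.
by rewrite dgrad_rhs_linl// /dotint uE// vE.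
Qed.

Let scale_addl (a x y z w c : R) :
  a *: (x : R^o) + y + (a *: (z : R^o) + w) * c = a *: (x + z * c : R^o) + (y + w * c).
Proof. by rewrite /GRing.scale /=; ring. Qed.

Let scale_addr (a x y z w c : R) :
  a *: (x : R^o) + y + c * (a *: (z : R^o) + w) = a *: (x + c * z : R^o) + (y + c * w).
Proof. by rewrite /GRing.scale /=; ring. Qed.

(** The gradient form alone is degenerate on constants. Adding the product of the integrals makes it
    definite and merges the two conditions on the potential into a single equation, to which [riesz]
    applies. *)
Let pot_form T (q w : 'rV[R]_n.+1 -> R) : R :=
  dotint T (grad q) (grad w) +
  (\int[leb n.+1]_(x in elt T) q x) * (\int[leb n.+1]_(x in elt T) w x).

Let pot_rhs T (v : hybrid M) (w : 'rV[R]_n.+1 -> R) : R :=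
  dotint T (dgrad k T v) (grad w) +
  (\int[leb n.+1]_(x in elt T) v.1 T x) * (\int[leb n.+1]_(x in elt T) w x).

Let Rint_Pk_lin T l :
  linear_on (@Pk R n.+1 l) ((fun w => \int[leb n.+1]_(x in elt T) w x) : _ -> R^o).
Proof.
move=> a u v /Pk_continuous cu /Pk_continuous cv.
by rewrite -Rint_lin//; apply: eq_Rintegral => x _; rewrite fun_linE.
Qed.

Let pot_formC T q w : pot_form T q w = pot_form T w q.
Proof. by rewrite /pot_form dotintC mulrC. Qed.

Let dotint_grad_lin T (phi : 'rV[R]_n.+1 -> 'rV[R]_n.+1) l : continuous phi ->
  linear_on (@Pk R n.+1 l) ((fun w => dotint T phi (grad w)) : _ -> R^o).
Proof.
move=> cphi a u v Pu Pv; rewrite (grad_lin a Pu Pv) !(dotintC T phi).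
have gu := Pkv_continuous (Pk_grad Pu); have gv := Pkv_continuous (Pk_grad Pv).
rewrite /dotint -Rint_lin; [|by []|by []|exact: dotc|exact: dotc].
by apply: eq_Rintegral => x _; rewrite fun_linE dotvDl dotvZl.
Qed.

Let pot_form_linr T q : Pk k.+1 q -> linear_on (@Pk R n.+1 k.+1) (pot_form T q : _ -> R^o).
Proof.
move=> Pq a u v Pu Pv; rewrite /pot_form.
have gq := Pkv_continuous (Pk_grad Pq).
rewrite (dotint_grad_lin T gq a Pu Pv) (Rint_Pk_lin T a Pu Pv); exact: scale_addr.
Qed.

Let pot_form_linl T w : Pk k.+1 w -> linear_on (@Pk R n.+1 k.+1) (pot_form T ^~ w : _ -> R^o).
Proof.
by move=> Pw a u v Pu Pv; rewrite !(pot_formC T _ w); exact: pot_form_linr.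
Qed.

Let pot_rhs_linr T v : Uh k v -> linear_on (@Pk R n.+1 k.+1) (pot_rhs T v : _ -> R^o).
Proof.
move=> Uv a u w Pu Pw; rewrite /pot_rhs.
have [/Pkv_continuous gv _] := dgradP T Uv.
rewrite (dotint_grad_lin T gv a Pu Pw) (Rint_Pk_lin T a Pu Pw); exact: scale_addr.
Qed.

Let pot_rhs_linl T w : Pk k.+1 w -> linear_on (@Uh R n M k) (pot_rhs T ^~ w : hybrid M -> R^o).
Proof.
move=> Pw a u v Uu Uv; rewrite /pot_rhs (dgrad_lin T a Uu Uv).
have [Pgu _] := dgradP T Uu; have [Pgv _] := dgradP T Uv.
have [[u1 _] [v1 _]] := (Uu, Uv).
rewrite dotint_linl//; last exact: Pkv_continuous (Pk_grad Pw).
have e : \int[leb n.+1]_(x in elt T) (a *: u + v).1 T x =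
    a *: (\int[leb n.+1]_(x in elt T) u.1 T x : R^o) + \int[leb n.+1]_(x in elt T) v.1 T x.
  exact: (Rint_Pk_lin T a (u1 T) (v1 T)).
rewrite e; exact: scale_addl.
Qed.

Let vol_gt0 T : 0 < \int[leb n.+1]_(x in elt T) (1 : R).
Proof.
rewrite lt_def; apply/andP; split; last by apply: Rintegral_ge0.
apply/eqP => I0; have [x Tx] := iT T.
have cst1 : continuous (fun _ : 'rV[R]_n.+1 => 1 : R) by exact: const_fun_continuous.
have := Rintegral_eq0_interior (mT T) (bT T) cst1 (fun _ => ler01) I0 Tx.
by move/eqP; rewrite oner_eq0.
Qed.

Let pot_form_pos T w : Pk k.+1 w -> pot_form T w w = 0 -> w = 0.
Proof.
move=> Pw /eqP; rewrite paddr_eq0; last first.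
- by rewrite -expr2 sqr_ge0.
- by apply: Rintegral_ge0 => x _; exact: dotv_ge0.
move=> /andP[/eqP g0 /eqP]; have {}g0 := Pkv_int_sqr_eq0 (mT T) (bT T) (iT T) (Pk_grad Pw) g0.
have wc := Pk_grad_eq0 Pw g0.
move/eqP; rewrite mulf_eq0 orbb => /eqP iw.
suff w0 : w 0 = 0 by apply/funext => x; rewrite wc w0.
have : w 0 * \int[leb n.+1]_(x in elt T) (1 : R) = 0.
  rewrite -[RHS]iw -RintegralZl//; last first.
    by apply: continuous_integrable => //; exact: const_fun_continuous.
  by apply: eq_Rintegral => x _; rewrite mulr1 -(wc x).
by move=> /eqP; rewrite mulf_eq0 [X in _ || X]gt_eqF// orbF => /eqP.
Qed.

Let grad_const c : grad (fun _ : 'rV[R]_n.+1 => c : R) = fun=> 0.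
Proof. by apply/funext => x; apply/rowP => i; rewrite !mxE derive_cst. Qed.

Let is_potentialE T v q : Uh k v ->
  is_potential k T v q <-> Pk k.+1 q /\ forall w, Pk k.+1 w -> pot_form T q w = pot_rhs T v w.
Proof.
move=> Uv; have [PG _] := dgradP T Uv; have cG := Pkv_continuous PG.
have cv := Pk_continuous (Uv.1 T).
have gradB w : Pk k.+1 q -> Pk k.+1 w ->
    \int[leb n.+1]_(x in elt T) dotv (grad q x - dgrad k T v x) (grad w x) =
    dotint T (grad q) (grad w) - dotint T (dgrad k T v) (grad w).
  move=> Pq Pw; have cgq := Pkv_continuous (Pk_grad Pq); have cgw := Pkv_continuous (Pk_grad Pw).
  rewrite -RintB; [|by []|by []|exact: dotc|exact: dotc].
  by apply: eq_Rintegral => x _; rewrite dotvDl -scaleN1r dotvZl mulN1r.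
split=> [[Pq qG qm]|[Pq qE]].
  split=> // w Pw; rewrite /pot_form /pot_rhs.
  have /eqP := qG _ Pw; rewrite gradB// subr_eq0 => /eqP ->.
  have cq := Pk_continuous Pq.
  by move/eqP: qm; rewrite (RintB (mT T) (bT T) cq cv) subr_eq0 => /eqP ->.
(* The test function 1 removes the gradient terms and leaves the two integrals, both multiplied by
   the positive volume of the element. *)
have qm : \int[leb n.+1]_(x in elt T) q x = \int[leb n.+1]_(x in elt T) v.1 T x.
  have := qE _ (@Pk_const R n.+1 k.+1 1); rewrite /pot_form /pot_rhs (grad_const 1).
  have d0 (phi : 'rV[R]_n.+1 -> 'rV[R]_n.+1) : dotint T phi (fun=> 0) = 0.
    transitivity (\int[leb n.+1]_(x in elt T) (0 : R)); last by rewrite Rintegral_cst// mul0r.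
    by apply: eq_Rintegral => x _; rewrite /dotv big1// => i _; rewrite mxE mulr0.
  by rewrite !d0 !add0r => /mulIf; apply; rewrite gt_eqF.
split=> //; last by rewrite (RintB (mT T) (bT T) (Pk_continuous Pq) cv) qm subrr.
move=> w Pw; rewrite gradB//; have := qE _ Pw; rewrite /pot_form /pot_rhs qm.
by move=> /addIr ->; rewrite subrr.
Qed.

Lemma potentialP T v : Uh k v -> is_potential k T v (potential k T v).
Proof.
move=> Uv; apply: (@xgetPex _ (fun=> 0) [set q | is_potential k T v q]).
have [||||q Pq qE] := @riesz R _ _ (fdim_Pk n.+1 k.+1) (pot_form T) (pot_rhs T v).
- exact: pot_form_linl.
- exact: pot_form_linr.
- exact: pot_rhs_linr.
- exact: pot_form_pos.
by exists q; apply/is_potentialE.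
Qed.

Lemma potential_unique T v q : Uh k v -> is_potential k T v q -> potential k T v = q.
Proof.
move=> Uv /(is_potentialE _ _ Uv)[Pq qE].
have /(is_potentialE _ _ Uv)[Pq' qE'] := potentialP T Uv.
apply: (@riesz_unique R _ _ (fdim_Pk n.+1 k.+1) (pot_form T)) => //.
- exact: pot_form_linl.
- exact: pot_form_pos.
by move=> w Pw; rewrite qE// qE'.
Qed.

Lemma potential_lin T : linear_on (@Uh R n M k) (@potential R n M k T).
Proof.
move=> a u v Uu Uv; have Ul := fdim_lin fdim_Uh a Uu Uv.
apply: potential_unique => //; apply/(is_potentialE _ _ Ul).
have /(is_potentialE _ _ Uu)[Pu uE] := potentialP T Uu.
have /(is_potentialE _ _ Uv)[Pv vE] := potentialP T Uv.
split; first exact: Pk_lin.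
by move=> w Pw; rewrite pot_form_linl// pot_rhs_linl// uE// vE.
Qed.

Lemma Ppotential_Pk T v : Uh k v -> Pk k.+1 (Ppotential k T v).
Proof.
move=> Uv; have [Pp _ _] := potentialP T Uv.
apply: PkD; first exact: Pk_le (Uv.1 T).
apply: PkB => //; apply: (@Pk_le _ _ k) => //.
by have [] := l2projP (mT T) (bT T) k (iT T) (Pk_continuous Pp).
Qed.

Let lin3 (E : lmodType R) (a : R) (x y z x' y' z' : E) :
  a *: x + x' + (a *: y + y' - (a *: z + z')) = a *: (x + (y - z)) + (x' + (y' - z')).
Proof. by rewrite scalerDr scalerBr opprD [a *: y + y' + _]addrACA [LHS]addrACA. Qed.

Let lin2 (E : lmodType R) (a : R) (x y x' y' : E) :
  a *: x + x' - (a *: y + y') = a *: (x - y) + (x' - y').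
Proof. by rewrite scalerBr opprD [LHS]addrACA. Qed.

Let PpotentialE T v : Ppotential k T v =
  v.1 T + (potential k T v - l2proj k (elt T) (potential k T v)).
Proof. by []. Qed.

Lemma Ppotential_lin T : linear_on (@Uh R n M k) (@Ppotential R n M k T).
Proof.
move=> a u v Uu Uv; have [Pu _ _] := potentialP T Uu; have [Pv _ _] := potentialP T Uv.
rewrite !PpotentialE (potential_lin T a Uu Uv).
rewrite (l2proj_lin (mT T) (bT T) k (iT T) a (Pk_continuous Pu) (Pk_continuous Pv)).
by rewrite pair_fun_lin1 lin3.
Qed.

Let trace_continuous T F v : Uh k v -> continuous (fun y => v.2 F y - Ppotential k T v (chart F y)).
Proof.
move=> Uv; apply: subc; first exact: Pk_continuous (Uv.2 F).
by have := Pk_continuous (Pk_chart F (Ppotential_Pk T Uv)).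
Qed.

Lemma face_residual_Pk T F v : Uh k v -> Pk k (face_residual k T F v).
Proof.
by move=> Uv; have [] := l2projP (mF F) (bF F) k (iF F) (@trace_continuous T F v Uv).
Qed.

Let face_residualE T F v : face_residual k T F v =
  l2proj k (fdom F) (v.2 F - (Ppotential k T v \o chart F)).
Proof. by []. Qed.

Lemma face_residual_lin T F : linear_on (@Uh R n M k) (@face_residual R n M k T F).
Proof.
move=> a u v Uu Uv.
rewrite !face_residualE (Ppotential_lin T a Uu Uv).
rewrite -(l2proj_lin (mF F) (bF F) k (iF F) a (@trace_continuous T F u Uu)
  (@trace_continuous T F v Uv)).
congr l2proj; rewrite -lin2; congr (_ - _).
Qed.

End Operators.

(** * Geometry of the mesh *)

Section Geometry.
Context {R : realType} {n : nat}.
Implicit Types (A : set 'rV[R]_n.+1) (x y w : 'rV[R]_n.+1).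

Lemma segment_continuous x y : continuous (fun t : R => x + t *: y).
Proof.
apply: rV_continuous => i; under eq_fun do rewrite !mxE.
apply: add_fun_continuous; first exact: const_fun_continuous.
apply: mul_fun_continuous; last exact: const_fun_continuous.
by move=> t; exact: cvg_id.
Qed.

(** If the segment missed the boundary, its points in the interior of [A] would be exactly those in
    the closure, a subset of [0, 1] both open and closed. *)
Lemma segment_boundary A x y : A° x -> ~ A° y ->
  exists2 t : R, 0 <= t <= 1 & boundary A (x + t *: (y - x)).
Proof.
move=> Ax Ay; apply: contrapT => nb.
pose g (t : R) := x + t *: (y - x).
have cg : continuous g by exact: segment_continuous.
have := @segment_connected R 0 1; move/(_ (`[0, 1] `&` g @^-1` A°)) => H.
apply: Ay; suff [_] : (`[0, 1]%classic `&` g @^-1` A°) 1 by rewrite /g /= scale1r subrKC.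
rewrite H; first by rewrite /= in_itv/= ler01 lexx.
- exists 0; split; first by rewrite /= in_itv/= ler01 lexx.
  by rewrite /g /= scale0r addr0.
- exists (g @^-1` A°) => //; apply: open_comp; last exact: open_interior.
  by move=> t _; exact: cg.
exists (g @^-1` closure A).
  apply: closed_comp; last exact: closed_closure.
  by move=> t _; exact: cg.
apply/seteqP; split=> t [/= t01 gt]; split=> //.
  by apply: subset_closure; exact: interior_subset gt.
by apply: contrapT => nAt; apply: nb; exists t => //; move: t01; rewrite in_itv.
Qed.

Lemma off_hyperplane (O : set 'rV[R]_n.+1) (nu : 'rV[R]_n.+1) (c : R) :
  open O -> O !=set0 -> nu != 0 -> exists2 w, O w & dotv nu w != c.
Proof.
move=> oO [x Ox] nu0; have [ec|] := eqVneq (dotv nu x) c; last by exists x.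
have : nbhs (0 : R) ((fun t : R => x + t *: nu) @^-1` O).
  by apply: segment_continuous; rewrite scale0r addr0; apply: open_nbhs_nbhs.
move=> /nbhs_ballP[e /= e0 he]; exists (x + (e / 2) *: nu).
  apply: he; rewrite /ball /= sub0r normrN gtr0_norm ?divr_gt0//.
  by rewrite gtr_pMr// invf_lt1// ltr1n.
rewrite dotvDr dotvZr ec -subr_eq0 addrAC subrr add0r mulf_neq0 ?gt_eqF ?dotv_neq0//.
by rewrite divr_gt0.
Qed.

Lemma generic_point (s : seq ('rV[R]_n.+1 * R)) (O : set 'rV[R]_n.+1) :
  open O -> O !=set0 -> (forall z, z \in s -> z.1 != 0) ->
  exists2 w, O w & forall z, z \in s -> dotv z.1 w != z.2.
Proof.
elim: s O => [|z s IHs] O oO O0 s0; first by case: O0 => w Ow; exists w.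
have [|x Ox zx] := off_hyperplane z.2 oO O0 (nu := z.1).
  by apply: s0; rewrite inE eqxx.
have [|||w [Ow zw] sw] := IHs (O `&` [set w | dotv z.1 w != z.2]).
- apply: openI => //; apply: (@open_comp _ _ (dotv z.1) [set y | y != z.2]).
    by move=> y _; exact: dotv_continuous_r.
  exact: open_neq.
- by exists x.
- by move=> z' z's; apply: s0; rewrite inE z's orbT.
by exists w => // z'; rewrite inE => /orP[/eqP ->//|]; exact: sw.
Qed.

Lemma convex_no_boundary A (B : set 'rV[R]_n.+1) :
  (forall x y t, B x -> B y -> 0 <= t <= 1 -> B (x + t *: (y - x))) ->
  (forall x, B x -> ~ boundary A x) -> open A -> B `&` A !=set0 -> B `<=` A.
Proof.
move=> convB noB oA [x [Bx Ax]] y By; apply: contrapT => nAy.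
have [||t t01] := @segment_boundary A x y; [by rewrite (interior_id A).1..|].
by apply: noB; exact: convB.
Qed.

End Geometry.

Section Cluster.
Context {R : realType} {n : nat} (Omega : set 'rV[R]_n.+1) (h : R) (M : mesh R n).
Hypothesis meshM : is_mesh Omega h M.

Implicit Types (T : telt M) (F : tface M).

Lemma mesh_hyperplanes : exists2 s : seq ('rV[R]_n.+1 * R),
  (forall z, z \in s -> z.1 != 0) &
  forall T x, boundary (elt T) x -> exists2 z, z \in s & hyperplane z.1 z.2 x.
Proof.
have [[polyT _ _ _ _] _ _ _ _] := meshM.
have hs T : exists s : seq ('rV[R]_n.+1 * R), (forall z, z \in s -> z.1 != 0) /\
    forall x, boundary (elt T) x -> exists2 z, z \in s & hyperplane z.1 z.2 x.
  by have [[[_ _ _ [s s0 sP]] _] _] := polyT T; exists s.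
have [S hS] := choice hs.
exists (flatten [seq S T | T <- enum (telt M)]).
  by move=> z /flatten_mapP[T _ zT]; exact: (hS T).1.
move=> T x /(hS T).2[z zs zx]; exists z => //.
by apply/flatten_mapP; exists T; rewrite // mem_enum.
Qed.

Section face_neighbourhood.
Variables (s : seq ('rV[R]_n.+1 * R)) (T1 T2 : telt M) (x : 'rV[R]_n.+1) (z : 'rV[R]_n.+1 * R).
Hypotheses (s0 : forall z, z \in s -> z.1 != 0)
  (sP : forall T x, boundary (elt T) x -> exists2 z, z \in s & hyperplane z.1 z.2 x)
  (T12 : T1 != T2) (bT1 : boundary (elt T1) x) (bT2 : boundary (elt T2) x)
  (zs : z \in s) (zx : hyperplane z.1 z.2 x)
  (uniq_z : forall z', z' \in s -> hyperplane z'.1 z'.2 x ->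
     hyperplane z'.1 z'.2 = hyperplane z.1 z.2).

Lemma ball_off_other_hyperplanes : exists2 e : R, 0 < e &
  forall T y, `|x - y| < e -> boundary (elt T) y -> dotv z.1 y = z.2.
Proof.
have : nbhs x [set y | forall z', z' \in s -> dotv z'.1 x != z'.2 -> dotv z'.1 y != z'.2].
  elim: (s) => [|z' s' IHs']; first by apply: filterS filterT.
  have hz' : nbhs x [set y | dotv z'.1 x != z'.2 -> dotv z'.1 y != z'.2].
    have [xz'|xz'] := eqVneq (dotv z'.1 x) z'.2; first by apply: filterS filterT.
    have : open (dotv z'.1 @^-1` [set y | y != z'.2]).
      apply: (@open_comp _ _ (dotv z'.1)) => [y _|]; first exact: dotv_continuous_r.
      exact: open_neq.
    move=> o; by have := open_nbhs_nbhs (conj o xz'); apply: filterS => y yz' _; exact: yz'.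
  apply: filterS (filterI hz' IHs') => y [h1 h2] z''.
  by rewrite inE => /orP[/eqP ->//|]; exact: h2.
move=> /nbhs_ballP[e /= e0 he]; exists e => // T y xy bTy.
have [z' z's z'y] := sP bTy.
have xz' : dotv z'.1 x = z'.2.
  apply/eqP/negPn/negP => ne; have := he y _ z' z's ne.
  by rewrite -ball_normE z'y eqxx => /(_ xy).
by have : hyperplane z'.1 z'.2 y by []; rewrite (uniq_z z's xz').
Qed.

(** Near [x] all element boundaries lie in one hyperplane, which cuts a ball into the convex halves
    [B 1] and [B (-1)]. A half that meets an element is contained in it. [T1] and [T2] both reach
    [x], so each contains a half, and not the same one since elements are disjoint. *)
Lemma face_point_interior : (closure (elt T1) `|` closure (elt T2))° x.
Proof.
have [[polyT _ _ _ _] _ _ _ _] := meshM.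
have oT T : open (elt T) by have [[[]]] := polyT T.
have [e e0 he] := ball_off_other_hyperplanes.
pose B (sg : R) := [set y | `|x - y| < e /\ 0 < sg * (dotv z.1 y - z.2)].
have oball : open [set y | `|x - y| < e].
  by have := @ball_open R 'rV[R]_n.+1 x e; rewrite -ball_normE.
have oB sg : open (B sg).
  apply: openI => //.
  apply: (@open_comp _ _ (fun y => sg * (dotv z.1 y - z.2)) [set y | 0 < y]) => [y _|].
    apply: mul_fun_continuous; first exact: const_fun_continuous.
    by apply: sub_fun_continuous; [exact: dotv_continuous_r|exact: const_fun_continuous].
  exact: open_gt.
have convB sg u v t : B sg u -> B sg v -> 0 <= t <= 1 -> B sg (u + t *: (v - u)).
  move=> [xu su] [xv sv] /andP[t0 t1]; split.
    have -> : x - (u + t *: (v - u)) = (1 - t) *: (x - u) + t *: (x - v).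
      by apply/rowP => i; rewrite !mxE; ring.
    apply: le_lt_trans (ler_normD _ _) _; rewrite !normrZ !ger0_norm ?subr_ge0//.
    have [->|t_neq0] := eqVneq t 0; first by rewrite subr0 mul1r mul0r addr0.
    rewrite [ltRHS](_ : _ = (1 - t) * e + t * e); last by ring.
    apply: ler_ltD.
      by rewrite ler_wpM2l ?subr_ge0// ltW.
    by rewrite ltr_pM2l// lt_def t_neq0.
  rewrite dotvDr dotvZr dotvDr dotvNr.
  have -> : sg * (dotv z.1 u + t * (dotv z.1 v - dotv z.1 u) - z.2) =
    (1 - t) * (sg * (dotv z.1 u - z.2)) + t * (sg * (dotv z.1 v - z.2)) by ring.
  have [->|t_neq0] := eqVneq t 0; first by rewrite subr0 mul1r mul0r addr0.
  apply: ltr_wpDl; first by rewrite mulr_ge0 ?subr_ge0// ltW.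
  by rewrite mulr_gt0// lt_def t_neq0.
have noB sg T y : B sg y -> ~ boundary (elt T) y.
  by move=> [xy sy] /(he _ _ xy) e'; rewrite e' subrr mulr0 ltxx in sy.
have B0 sg : `|sg| = 1 -> B sg !=set0.
  move=> sg1; have nz := dotv_neq0 (s0 zs); pose d := e / 2 / (`|z.1| + 1).
  have N0 : 0 < `|z.1| + 1 by rewrite ltr_wpDl.
  have d0 : 0 < d by rewrite !divr_gt0.
  exists (x + (d * sg) *: z.1); split.
    rewrite opprD addrA subrr sub0r normrN normrZ normrM sg1 mulr1 gtr0_norm//.
    apply: (@lt_trans _ _ (d * (`|z.1| + 1))); first by rewrite ltr_pM2l// ltrDl.
    by rewrite /d divfK ?gt_eqF// gtr_pMr// invf_lt1// ltr1n.
  rewrite dotvDr zx dotvZr addrAC subrr add0r.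
  have sg2 : sg * sg = 1 by rewrite -expr2 -real_normK ?num_real// sg1 expr1n.
  by rewrite mulrA mulrCA sg2 mulr1 mulr_gt0.
have meet T : boundary (elt T) x -> exists2 sg : R, sg = 1 \/ sg = -1 & B sg `<=` elt T.
  move=> [clTx _].
  have [y [Ty xy]] : elt T `&` [set y | `|x - y| < e] !=set0.
    by apply: clTx; apply/nbhs_ballP; exists e; rewrite // -ball_normE.
  have [|w [Tw xw] zw] := off_hyperplane z.2 (openI (oT T) oball) _ (s0 zs); first by exists y.
  have [sg sg1 Bw] : exists2 sg : R, sg = 1 \/ sg = -1 & B sg w.
    have [lt|gt|e'] := ltgtP (dotv z.1 w) z.2.
    - by exists (-1); [right|split=> //; rewrite mulN1r oppr_gt0 subr_lt0].
    - by exists 1; [left|split=> //; rewrite mul1r subr_gt0].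
    - by rewrite e' eqxx in zw.
  exists sg => //; apply: (convex_no_boundary (convB sg) (noB sg T) (oT T)).
  by exists w.
have triv T T' y : elt T y -> elt T' y -> T = T'.
  have [[_ /trivIsetP tT _ _ _] _ _ _ _] := meshM.
  move=> Ty T'y; apply/eqP; apply/negPn/negP => ne.
  by have := tT _ _ I I ne; rewrite -subset0 => /(_ y (conj Ty T'y)).
have [sg1 sg1E B1] := meet _ bT1; have [sg2 sg2E B2] := meet _ bT2.
have sg12 : sg1 <> sg2.
  move=> e12; have sgn0 : `|sg1| = 1 by case: sg1E => ->; rewrite ?normrN normr1.
  have [y By] := B0 _ sgn0; move/eqP: T12; apply.
  by apply: (triv _ _ y); [exact: B1|apply: B2; rewrite -e12].
have cover y : `|x - y| < e -> dotv z.1 y != z.2 -> elt T1 y \/ elt T2 y.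
  move=> xy zy; have [sg sgE By] : exists2 sg : R, sg = 1 \/ sg = -1 & B sg y.
    have [lt|gt|e'] := ltgtP (dotv z.1 y) z.2.
    - by exists (-1); [right|split=> //; rewrite mulN1r oppr_gt0 subr_lt0].
    - by exists 1; [left|split=> //; rewrite mul1r subr_gt0].
    - by rewrite e' eqxx in zy.
  have [e1|ne1] := pselect (sg1 = sg); first by left; apply: B1; rewrite e1.
  have [e2|ne2] := pselect (sg2 = sg); first by right; apply: B2; rewrite e2.
  by exfalso; case: sgE sg1E sg2E ne1 ne2 sg12 => -> [] -> [] ->.
have : nbhs x [set y | `|x - y| < e].
  by apply/nbhs_ballP; exists e; rewrite // -ball_normE.
apply: filterS => y xy; apply: contrapT => ny.
pose O := [set y | `|x - y| < e] `&` ~` (closure (elt T1) `|` closure (elt T2)).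
have oO : open O.
  by apply: openI => //; apply: closed_openC; apply: closedU; exact: closed_closure.
have [|w [xw nw] zw] := off_hyperplane z.2 oO _ (s0 zs); first by exists y.
by apply: nw; case: (cover w xw zw) => ?; [left|right]; exact: subset_closure.
Qed.

End face_neighbourhood.

Definition aff (z : 'rV[R]_n.+1 * R) x := dotv z.1 x - z.2.

(* A cluster of elements without boundary faces which is closed under passing
   to a neighbour is empty: leave it along a segment that avoids the pairwise
   intersections of the hyperplanes carrying the faces. *)
Lemma no_closed_cluster (P : telt M -> Prop) :
  (forall T F, P T -> face_of T F -> ~ boundary_face Omega F) ->
  (forall T T' F, P T -> face_of T F -> face_of T' F -> P T') ->
  forall T, ~ P T.
Proof.
move=> noB nbP T0 PT0.
have [[polyT _ _ _ _] [_ _ _ intF _] bdF _ _] := meshM.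
have oT T : open (elt T) by have [[[]]] := polyT T.
have [s s0 sP] := mesh_hyperplanes.
pose K := \bigcup_(T in [set T | P T]) closure (elt T).
have cK : closed K.
  by apply: closed_bigcup => [|T _]; [exact: finite_finset|exact: closed_closure].
have [N hN] : exists N : R, forall x, K x -> `|x| <= N.
  have hN T : exists N : R, forall x, closure (elt T) x -> `|x| <= N.
    have [[[_ _ [N0 [_ hN]] _] _] _] := polyT T.
    exists (N0 + 1) => x.
    have cb := @closed_normr_le R n.+1 (N0 + 1).
    have sub : elt T `<=` [set y : 'rV[R]_n.+1 | `|y| <= N0 + 1].
      by move=> y Ty; apply: hN => //; rewrite ltrDl.
    by move=> /(closure_subset sub); rewrite -(closure_id _).1.
  have [N hNT] := choice hN.
  exists (\sum_T `|N T|) => x [T _ /hNT xN]; apply: le_trans xN _.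
  apply: le_trans (ler_norm _) _; rewrite (bigD1 T)//= lerDl.
  exact: sumr_ge0.
have [|z1 /= Kz1 sz1] := generic_point (closed_openC cK) _ s0.
  exists (const_mx (`|N| + 1)) => /hN; apply/negP; rewrite -ltNge.
  apply: (@lt_le_trans _ _ (`|N| + 1)).
    by rewrite (le_lt_trans (ler_norm N))// ltrDl.
  have := normr_coord (const_mx (`|N| + 1) : 'rV[R]_n.+1) 0; rewrite mxE.
  by apply: le_trans; rewrite ler_norm.
have az1 z : z \in s -> aff z z1 != 0 by move=> /sz1; rewrite subr_eq0.
(* The combination of [z] and [z'] that vanishes at [z1]: the hyperplane through [z1] and the
   intersection of the other two. A segment from [z1] through this intersection stays in it, so the
   other end [w] is chosen off all of them. *)
pose sep (z z' : 'rV[R]_n.+1 * R) : 'rV[R]_n.+1 * R :=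
  (aff z z1 *: z'.1 - aff z' z1 *: z.1, aff z z1 * z'.2 - aff z' z1 * z.2).
have affsep z z' w : aff (sep z z') w = aff z z1 * aff z' w - aff z' z1 * aff z w.
  rewrite /aff /sep /= dotvDl dotvNl !dotvZl /aff; ring.
pose s2 := [seq sep z z' | z <- s, z' <- [seq z' <- s | sep z z' \in [pred v | v.1 != 0]]].
have [|z /allpairsPdep|w Tw gw] := @generic_point _ _ s2 (elt T0) (oT T0) _ _.
- by have [_] := polyT T0.
- by move=> [z' [z'' [_]]]; rewrite mem_filter => /andP[+ _] ->.
have Kw : K° w.
  have sub : elt T0 `<=` K by move=> y Ty; exists T0 => //; exact: subset_closure.
  by apply: (interiorS sub); rewrite (interior_id (elt T0)).1.
have Kz : ~ K° z1 by move=> /interior_subset.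
have [t /andP[t0 t1] [clx ncx]] := segment_boundary Kw Kz.
set x := w + t *: (z1 - w) in clx ncx.
have Kx : K x by rewrite ((closure_id K).1 cK).
have [T PT clTx] := Kx.
have bTx : boundary (elt T) x.
  split=> //; rewrite (interior_id _).1// => Tx; apply: ncx.
  have sub : elt T `<=` K by move=> y Ty; exists T => //; exact: subset_closure.
  by apply: (interiorS sub); rewrite (interior_id (elt T)).1.
have : boundary (elt T) x by [].
rewrite bdF => -[F TF Fx].
have [T1 [T2 [T12 F1 F2]]] : interface F.
  by case: (intF F) => // bF; have := noB _ _ PT TF.
have PT1 : P T1 by apply: (nbP _ _ _ PT TF); apply/asboolP.
have PT2 : P T2 by apply: (nbP _ _ _ PT TF); apply/asboolP.
have [z zs zx] := sP _ _ (F1 _ Fx).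
have [uz|nuz] := pselect (forall z', z' \in s -> hyperplane z'.1 z'.2 x ->
     hyperplane z'.1 z'.2 = hyperplane z.1 z.2).
  have := face_point_interior s0 sP T12 (F1 _ Fx) (F2 _ Fx) zs zx uz.
  move=> fx; apply: ncx; move: fx; apply: interiorS => y [Ty|Ty]; [by exists T1|by exists T2].
have [z' [z's z'x zz']] : exists z', [/\ z' \in s, hyperplane z'.1 z'.2 x &
    hyperplane z'.1 z'.2 <> hyperplane z.1 z.2].
  apply: contrapT => nz; apply: nuz => z' z's z'x; apply: contrapT => ne.
  by apply: nz; exists z'.
have ax : aff z x = 0 by rewrite /aff zx subrr.
have ax' : aff z' x = 0 by rewrite /aff z'x subrr.
have affx v : aff v x = (1 - t) * aff v w + t * aff v z1.
  by rewrite /aff /x dotvDr dotvZr dotvDr dotvNr; ring.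
have t1' : 1 - t != 0.
  rewrite subr_eq0; apply/eqP => et; apply: Kz1; move: Kx.
  by rewrite /x -et scale1r subrKC.
(* [sep z z'] vanishes at [x], where both hyperplanes meet, and at [z1], a different point since [t]
   is not 1; being affine, it vanishes on the whole line and so at [w]. *)
have sep_w : aff (sep z z') w = 0.
  apply: (mulfI t1'); rewrite affsep mulr0.
  have e1 := ax; have e2 := ax'; rewrite affx in e1; rewrite affx in e2.
  have -> : (1 - t) * (aff z z1 * aff z' w - aff z' z1 * aff z w) =
    aff z z1 * ((1 - t) * aff z' w + t * aff z' z1) -
    aff z' z1 * ((1 - t) * aff z w + t * aff z z1) by ring.
  by rewrite e1 e2 !mulr0 subrr.
have [nz0|nz0] := eqVneq (sep z z').1 0; last first.
  have : sep z z' \in s2.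
    by apply/allpairsPdep; exists z, z'; rewrite mem_filter z's zs inE nz0.
  by move=> /gw; rewrite -subr_eq0 => /eqP[].
(* With a zero normal, [aff (sep z z')] is constant, equal to its value 0 at [w]. The two affine
   forms are then proportional, with nonzero factors by the choice of [z1], and define the same
   hyperplane. *)
have prop y : aff z z1 * aff z' y = aff z' z1 * aff z y.
  apply/eqP; rewrite -subr_eq0 -affsep -sep_w /aff nz0 -(scale0r 0) !dotvZl.
  by rewrite !mul0r.
apply: zz'; apply/seteqP; split=> y; rewrite /hyperplane /= => ey.
  have := prop y; rewrite {2}/aff ey subrr mulr0 => /esym/eqP.
  by rewrite mulf_eq0 (negbTE (az1 _ z's))/= subr_eq0 => /eqP.
have := prop y; rewrite {4}/aff ey subrr mulr0 => /eqP.
by rewrite mulf_eq0 (negbTE (az1 _ zs))/= subr_eq0 => /eqP.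
Qed.

End Cluster.

(** * Domains of the face charts *)

Section FaceCharts.
Context {R : realType} {n : nat} (Omega : set 'rV[R]_n.+1) (h : R) (M : mesh R n).
Hypothesis meshM : is_mesh Omega h M.
Hypothesis bOmega : bounded_set Omega.

Implicit Types (F : tface M).

Let frmK F y : (chart F y - org F) *m (frm F)^T = y.
Proof.
have [_ [_ frmP _ _ _] _ _ _] := meshM.
by rewrite /chart addrC addKr -mulmxA (frmP F).1 mulmx1.
Qed.

Lemma mulmx_affine_continuous q m (A : 'M[R]_(q, m)) (b : 'rV[R]_q) :
  continuous (fun x : 'rV[R]_q => (x - b) *m A).
Proof.
apply: rV_continuous => i; under eq_fun do rewrite mxE.
apply: sum_fun_continuous => j; under eq_fun do rewrite !mxE.
apply: mul_fun_continuous; last exact: const_fun_continuous.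
by apply: sub_fun_continuous; [exact: coord_continuous|exact: const_fun_continuous].
Qed.

(** The transpose of the frame inverts the chart, so the domain is a continuous image of the face,
    itself closed and contained in the bounded closure of [Omega]. *)
Lemma fdom_compact F : compact (fdom F).
Proof.
have [_ [_ frmP faceP _ _] _ _ _] := meshM; have [clF _ FO _] := faceP F.
have -> : fdom F = (fun x => (x - org F) *m (frm F)^T) @` face F.
  apply/seteqP; split=> [y Fy|_ [x Fx <-]]; first by exists (chart F y).
  have [y _ yx] := (frmP F).2 _ Fx.
  by rewrite /fdom /= -yx frmK yx.
apply: continuous_compact; first exact/continuous_subspaceT/mulmx_affine_continuous.
apply: bounded_closed_compact => //.
have [N [_ hN]] := bOmega; exists (N + 1); split=> [|N' N'N x Fx]; first exact: num_real.
have cb := @closed_normr_le R n.+1 N'.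
have sub : Omega `<=` [set y : 'rV[R]_n.+1 | `|y| <= N'].
  by move=> y Oy; apply: hN => //; rewrite (lt_trans _ N'N)// ltrDl.
have := closure_subset sub (FO _ Fx).
by rewrite -((closure_id _).1 cb).
Qed.

Variables (S : finType) (V : S -> 'I_n.+2 -> 'rV[R]_n.+1).
Hypothesis submesh : matching_simplicial_submesh Omega M V.

(** A cover by empty sets gives the empty set measure 0. Empty pieces count 0 also for n = 0, where
    a diameter to the power 0 would give 1. *)
Lemma face_neq0 F : face F !=set0.
Proof.
have [_ [_ _ faceP _ _] _ _ _] := meshM; have [_ _ _ hF] := faceP F.
apply/set0P/eqP => F0; move: hF; rewrite F0 ltNge => /negP; apply.
apply: ge_ereal_sup => _ [d d0 <-]; apply: ereal_inf_lbound.
exists (fun=> set0); first split.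
- by move=> x.
- move=> i; split; first by exists 0; split=> // N _ y [].
  rewrite /diam (_ : [set _ | _ in _] = set0) ?sup0 ?ltW//.
  by apply/seteqP; split=> // _ [z [[]]].
by rewrite eseries0// => i _ _; rewrite eqxx.
Qed.

Lemma chart_hull F (I : finType) (c : I -> R) (y : I -> 'rV[R]_n) : \sum_j c j = 1 ->
  \sum_j c j *: chart F (y j) = chart F (\sum_j c j *: y j).
Proof.
move=> c1; rewrite /chart; under eq_bigr do rewrite scalerDr.
rewrite big_split /= -scaler_suml c1 scale1r mulmx_suml; congr (_ + _).
by apply: eq_bigr => j _; rewrite scalemxAl.
Qed.

(** A nonempty face contains a face of some simplex. Read in the chart, its n + 1 vertices are
    affinely independent in R^n, so the points near their barycenter still have positive barycentric
    coordinates. *)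
Lemma fdom_interior F : (fdom F)° !=set0.
Proof.
have [_ [_ frmP _ _ _] _ _ _] := meshM.
have [[affV _ _ _] _ _ unionF] := submesh.
have [x0 Fx0] := face_neq0 F.
move: Fx0; rewrite unionF => -[[s i] /= sF _].
have FV j : face F (V s (lift i j)).
  apply: sF; exists (fun l => (l == lift i j)%:R); split.
  - by move=> l; rewrite ler0n.
  - move=> l; rewrite !inE negbK => /eqP ->.
    by rewrite (negbTE (neq_lift i j)).
  - by rewrite (bigD1 (lift i j))//= eqxx big1 ?addr0// => l /negbTE ->.
  by rewrite (bigD1 (lift i j))//= eqxx scale1r big1 ?addr0// => l /negbTE ->; rewrite scale0r.
have [y yV] : exists y : 'I_n.+1 -> 'rV[R]_n, forall j, chart F (y j) = V s (lift i j).
  have /choice[y yV] : forall j, exists y, chart F y = V s (lift i j).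
    by move=> j; have [y _ yE] := (frmP F).2 _ (FV j); exists y.
  by exists y.
have indep (c : 'I_n.+1 -> R) : \sum_j c j = 0 -> \sum_j c j *: chart F (y j) = 0 ->
    forall j, c j = 0.
  move=> c0 cV j; pose c' l := if unlift i l is Some l' then c l' else 0.
  have s1 : \sum_l c' l = 0.
    rewrite (bigD1_ord i)//= [c' i]/c' unlift_none add0r -[RHS]c0.
    by apply: eq_bigr => l _; rewrite /c' liftK.
  have s2 : \sum_l c' l *: V s l = 0.
    rewrite (bigD1_ord i)//= [c' i]/c' unlift_none scale0r add0r -[RHS]cV.
    by apply: eq_bigr => l _; rewrite /c' liftK yV.
  by have := affV s c' s1 s2 (lift i j); rewrite /c' liftK.
pose Y : 'M[R]_n := \matrix_(j, l) (y (lift 0 j) - y 0) 0 l.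
have rowY j : row j Y = y (lift 0 j) - y 0 by apply/rowP => l; rewrite !mxE.
have uY : Y \in unitmx.
  rewrite -row_free_unit; apply: inj_row_free => v vY.
  pose c (j : 'I_n.+1) := if unlift 0 j is Some j' then v 0 j' else - \sum_j v 0 j.
  have c0 : \sum_j c j = 0.
    rewrite big_ord_recl /c unlift_none addrC; apply/eqP; rewrite subr_eq0; apply/eqP.
    by apply: eq_bigr => j _; rewrite liftK.
  have cV : \sum_j c j *: chart F (y j) = 0.
    rewrite /chart; under eq_bigr do rewrite scalerDr.
    rewrite big_split /= -scaler_suml c0 scale0r add0r.
    have -> : \sum_j c j *: (y j *m frm F) = (v *m Y) *m frm F.
      rewrite (mulmx_sum_row v Y) big_ord_recl /c unlift_none scaleNr
        scaler_suml -sumrN -big_split mulmx_suml.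
      apply: eq_bigr => j _ /=; rewrite liftK rowY scalerBr mulmxBl !scalemxAl addrC.
      by [].
    by rewrite vY mul0mx.
  apply/rowP => j; rewrite [RHS]mxE -(indep c c0 cV (lift 0 j)).
  by rewrite /c liftK.
pose bary (x : 'rV[R]_n) := (x - y 0) *m invmx Y.
(* The n coordinates [1 / (n + 1)] leave the same weight to the vertex [y 0], so [w] is the
   barycenter. *)
pose t : 'rV[R]_n := const_mx n.+1%:R^-1.
pose w := y 0 + t *m Y.
have bw : bary w = t by rewrite /bary /w addrC addKr mulmxK.
exists w.
have cbary : continuous bary by exact: mulmx_affine_continuous.
have h1 : nbhs w [set x | forall j, 0 < bary x 0 j].
  apply: (@filter_forall _ _ (fun j x => 0 < bary x 0 j) (nbhs w)) => j.
  apply: (@continuous_nbhs_gt _ _ (fun x => bary x 0 j)).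
    exact: (continuous_coord (i := j) cbary).
  by rewrite bw mxE invr_gt0.
have h2 : nbhs w [set x | 0 < 1 - \sum_j bary x 0 j].
  apply: continuous_nbhs_gt.
    apply: sub_fun_continuous; first exact: const_fun_continuous.
    by apply: sum_fun_continuous => j; exact: continuous_coord.
  rewrite bw subr_gt0; under eq_bigr do rewrite mxE.
  rewrite sumr_const card_ord -[ltLHS]mulr_natl ltr_pdivrMr// mul1r ltr_nat.
  exact: ltnSn.
apply: filterS (filterI h1 h2) => x [x1 /= x2].
pose c (j : 'I_n.+1) := if unlift 0 j is Some j' then bary x 0 j' else 1 - \sum_j bary x 0 j.
have c1 : \sum_j c j = 1.
  rewrite big_ord_recl /c unlift_none -[RHS](subrK (\sum_j bary x 0 j)).
  by congr (_ + _); apply: eq_bigr => j _; rewrite liftK.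
have cx : \sum_j c j *: y j = x.
  rewrite big_ord_recl /c unlift_none scalerBl scale1r.
  have : bary x *m Y = x - y 0 by rewrite /bary mulmxKV.
  rewrite mulmx_sum_row => e; rewrite -[RHS](subrK (y 0)) -e [RHS]addrC -addrA; congr (_ + _).
  rewrite scaler_suml -sumrN -big_split; apply: eq_bigr => j _ /=.
  by rewrite liftK rowY scalerBr addrC.
rewrite /fdom /= -cx -chart_hull//; apply: sF.
exists (fun l => if unlift i l is Some j then c j else 0); split.
- move=> l; case: unliftP => // j _; rewrite /c.
  by case: unliftP => [j' _|_]; rewrite ltW.
- by move=> l; rewrite !inE negbK => /eqP ->; rewrite unlift_none.
- rewrite (bigD1_ord i)//= unlift_none add0r -[RHS]c1.
  by apply: eq_bigr => j _; rewrite liftK.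
rewrite [RHS](bigD1_ord i)//= unlift_none scale0r add0r.
by apply: eq_bigr => j _; rewrite liftK yV.
Qed.

End FaceCharts.

(** * Kernel of the energy *)

Section Kernel.
Context {R : realType} {n : nat} (M : mesh R n) (k : nat) (Omega : set 'rV[R]_n.+1) (h : R).
Hypothesis eltP : forall T : telt M, [/\ open (elt T), bounded_set (elt T) & elt T !=set0].
Hypothesis fdomP : forall F : tface M,
  [/\ closed (fdom F), bounded_set (fdom F) & (fdom F)° !=set0].
Hypothesis meshM : is_mesh Omega h M.

Implicit Types (T : telt M) (F : tface M) (v : hybrid M).

Let mT T : measurable (elt T).
Proof. by have [oT _ _] := eltP T; exact: open_measurable_rV. Qed.
Let bT T : bounded_set (elt T).
Proof. by have [] := eltP T. Qed.
Let iT T : (elt T)° !=set0.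
Proof. by have [/interior_id -> _] := eltP T. Qed.
Let mF F : measurable (fdom F).
Proof. by have [cF _ _] := fdomP F; exact: closed_measurable_rV. Qed.
Let bF F : bounded_set (fdom F).
Proof. by have [] := fdomP F. Qed.
Let iF F : (fdom F)° !=set0.
Proof. by have [] := fdomP F. Qed.

(** Testing the potential against itself shows that it is constant, hence equal to its own
    projection, and the correction in [Ppotential] cancels. *)
Lemma Ppotential_dgrad0 T v : Uh k v -> dgrad k T v = (fun=> 0) ->
  Ppotential k T v = v.1 T.
Proof.
move=> Uv g0; have [Pq qG _] := potentialP eltP fdomP T Uv.
have qc : forall x, potential k T v x = potential k T v 0.
  apply: (Pk_grad_eq0 Pq); apply: (Pkv_int_sqr_eq0 (mT T) (bT T) (iT T) (Pk_grad Pq)).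
  rewrite -[RHS](qG _ Pq); apply: eq_Rintegral => x _.
  by rewrite g0 subr0.
have e : potential k T v = fun=> potential k T v 0 by apply/funext.
apply/funext => x; rewrite /Ppotential (l2proj_id (mT T) (bT T) (iT T)).
  by rewrite subrr addr0.
by rewrite e; exact: Pk_const.
Qed.

(** By [Ppotential_dgrad0] a zero residual says that the face unknown is the trace of the element
    unknown. The face terms then drop out of the equation of the discrete gradient, and the test
    function [grad (v.1 T)] shows that this gradient is 0. *)
Lemma hybrid_const T v : Uh k v -> dgrad k T v = (fun=> 0) ->
  (forall F, face_of T F -> face_residual k T F v = fun=> 0) ->
  exists c : R, v.1 T = (fun=> c) /\ forall F, face_of T F -> v.2 F = fun=> c.
Proof.
move=> Uv g0 r0; have [v1 v2] := Uv.
have tr F : face_of T F -> forall y, v.2 F y = v.1 T (chart F y).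
  move=> TF y; have := r0 F TF; rewrite /face_residual (Ppotential_dgrad0 Uv g0).
  rewrite (l2proj_id (mF F) (bF F) (iF F)).
    by move/(congr1 (fun f => f y))/eqP; rewrite subr_eq0 => /eqP.
  by apply: PkB => //; exact: (Pk_chart F (v1 T)).
have [_ gE] := dgradP eltP fdomP T Uv.
have gv0 : grad (v.1 T) = fun=> 0.
  apply: (Pkv_int_sqr_eq0 (mT T) (bT T) (iT T) (Pk_grad (v1 T))).
  have := gE _ (Pk_grad (v1 T)); rewrite g0 [X in _ + X]big1 ?addr0.
    move=> <-; rewrite (_ : (fun x => _) = fun=> 0); first by rewrite Rintegral_cst// mul0r.
    by apply/funext => x; rewrite /dotv big1// => i _; rewrite mxE mul0r.
  move=> F TF; rewrite (_ : (fun y => _) = fun=> 0); first by rewrite Rintegral_cst// mul0r.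
  by apply/funext => y; rewrite tr// subrr mul0r.
have vc := Pk_grad_eq0 (v1 T) gv0.
exists (v.1 T 0); split; first by apply/funext => x; exact: vc.
by move=> F TF; apply/funext => y; rewrite tr// vc.
Qed.

Lemma hybrid_kernel v : Uh0 k Omega v -> (forall T, dgrad k T v = fun=> 0) ->
  (forall T F, face_of T F -> face_residual k T F v = fun=> 0) -> v = 0.
Proof.
move=> [Uv v0] g0 r0.
have /choice[c /all_and2[c1 c2]] := fun T => hybrid_const Uv (g0 T) (r0 T).
have cT T : c T = 0.
  apply/eqP/negPn; apply/negP => cT0.
  apply: (@no_closed_cluster _ _ _ _ _ meshM (fun T => c T != 0)) cT0.
  - move=> T' F cT' TF /v0 bF'; move/negP: cT'; apply.
    have := c2 _ _ TF; rewrite bF' => /(congr1 (fun f => f 0)) /= <-.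
    by rewrite eqxx.
  - move=> T1 T2 F cT1 TF1 TF2.
    have := c2 _ _ TF1; rewrite (c2 _ _ TF2) => /(congr1 (fun f => f 0)) /= ->.
    exact: cT1.
have [_ [_ _ _ intF _] _ _ _] := meshM.
apply/injective_projections; apply/funext.
  by move=> T; rewrite c1 cT.
move=> F; case: (intF F) => [[T [_ [_ FT _]]]|/v0 -> //].
by rewrite (c2 T) ?cT//; apply/asboolP.
Qed.
End Kernel.

(** * Continuity and bounds for power functions *)

Section PowerFunctions.
Context {R : realType}.

Lemma powR_continuous_pos (x r : R) : 0 < x -> {for x, continuous (@powR R ^~ r)}.
Proof.
move=> x0; apply: differentiable_continuous; apply/derivable1_diffP.
by apply: derivable_powR; rewrite in_itv/= x0.
Qed.

Lemma norm_powR_continuous (r : R) : 0 < r -> continuous (fun t : R => `|t| `^ r).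
Proof.
move=> r0 t; have [->|t0] := eqVneq t 0; last first.
  apply: (@continuous_comp _ _ _ (fun t : R => `|t|) (@powR R ^~ r)).
    exact: norm_continuous.
  by apply: powR_continuous_pos; rewrite normr_gt0.
apply/cvgrPdist_lt => e e0; rewrite normr0 powR0 ?gt_eqF//.
have d0 : 0 < e `^ r^-1 by rewrite powR_gt0.
apply/nbhs_ballP; exists (e `^ r^-1) => // y; rewrite /ball /= sub0r normrN => yd.
rewrite sub0r normrN ger0_norm ?powR_ge0//.
have -> : e = (e `^ r^-1) `^ r by rewrite -powRrM mulVf ?gt_eqF// powRr1// ltW.
by apply: gt0_ltr_powR; rewrite ?nnegrE// ltW.
Qed.

Lemma norm_signed_powR (p t : R) : 1 < p -> `|(`|t| `^ (p - 2) * t)| = `|t| `^ (p - 1).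
Proof.
move=> p1; rewrite normrM ger0_norm ?powR_ge0// mulrC.
rewrite -(@mulr_powRB1 _ `|t| (p - 1))//; last by rewrite subr_gt0.
by congr (_ * _ `^ _); rewrite -addrA -opprD.
Qed.

Lemma signed_powR_continuous (p : R) : 1 < p -> continuous (fun t : R => `|t| `^ (p - 2) * t).
Proof.
move=> p1 t; have [->|t0] := eqVneq t 0; last first.
  apply: cvgM; last exact: cvg_id.
  apply: (@continuous_comp _ _ _ (fun t : R => `|t|) (@powR R ^~ (p - 2))).
    exact: norm_continuous.
  by apply: powR_continuous_pos; rewrite normr_gt0.
have p0 : 0 < p - 1 by rewrite subr_gt0.
have := norm_powR_continuous p0 (x := 0).
move=> /cvgrPdist_lt h; apply/cvgrPdist_lt => e e0; have := h e e0.
apply: filterS => y; rewrite normr0 powR0 ?gt_eqF// sub0r normrN mulr0 sub0r normrN.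
by rewrite norm_signed_powR// ger0_norm// powR_ge0.
Qed.

Lemma signed_powRM (p t : R) : 1 < p -> `|t| `^ (p - 2) * t * t = `|t| `^ p.
Proof.
move=> p1; rewrite -mulrA -expr2 -real_normK ?num_real// expr2 mulrCA.
rewrite -(@mulr_powRB1 _ `|t| p)//; last exact: lt_trans p1.
rewrite -(@mulr_powRB1 _ `|t| (p - 1))//; last by rewrite subr_gt0.
by congr (_ * _); rewrite mulrC; congr (_ * _ `^ _); rewrite -addrA -opprD.
Qed.

Lemma powR_ge1D (t q : R) : 0 <= t -> 1 <= q -> t <= 1 + t `^ q.
Proof.
move=> t0 q1; have [t1|t1] := leP t 1; first by rewrite (le_trans t1)// lerDl powR_ge0.
by rewrite (le_trans (le1r_powR (ltW t1) q1))// lerDr.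
Qed.

Lemma enorm_le n (x : 'rV[R]_n) (C : R) : (forall i, `|x 0 i| <= C) ->
  enorm x <= Num.sqrt (n%:R * C ^+ 2).
Proof.
move=> xC; apply: ler_wsqrtr; rewrite /dotv.
apply: (@le_trans _ _ (\sum_(i < n) C ^+ 2)); last by rewrite sumr_const card_ord mulr_natl.
apply: ler_sum => i _; rewrite -expr2 -real_normK ?num_real//.
by rewrite lerXn2r ?nnegrE// (le_trans _ (xC i)).
Qed.

End PowerFunctions.

(** * Carathéodory functions *)

Section Caratheodory.
Context {R : realType}.

(** Dominated convergence concerns sequences; this converts it into continuity. *)
Lemma seq_continuous N (F : 'rV[R]_N -> R) :
  (forall c (u : nat -> 'rV[R]_N), u @ \oo --> c -> F (u j) @[j --> \oo] --> F c) ->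
  continuous F.
Proof.
move=> seqF c; apply: contrapT => nF.
have [e e0 he] : exists2 e : R, 0 < e &
    forall d : R, 0 < d -> exists2 x, `|c - x| < d & e <= `|F c - F x|.
  apply: contrapT => h; apply: nF; apply/(@cvgrPdist_lt _ _ _ (nbhs c) (nbhs_filter c)) => e e0.
  apply: contrapT => ne; apply: h; exists e => // d d0; apply: contrapT => nx; apply: ne.
  apply/nbhs_ballP; exists d => // x; rewrite -ball_normE /= => cx.
  by rewrite ltNge; apply/negP => le; apply: nx; exists x.
have /choice[u hu] : forall j : nat, exists x, `|c - x| < j.+1%:R^-1 /\ e <= `|F c - F x|.
  by move=> j; have [|x ? ?] := he j.+1%:R^-1; [rewrite invr_gt0|exists x].
have uc : u @ \oo --> c.
  apply/cvgrPdist_lt => d d0; have [k _ hk] := near_infty_natSinv_lt (PosNum d0).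
  by exists k => // j kj; apply: lt_trans (hu j).1 (hk _ kj).
have /cvgrPdist_lt/(_ e e0)[k _ hk] := seqF c u uc.
by have := hk k (leqnn k); rewrite ltNge (hu k).2.
Qed.

Lemma continuous_Rintegral d (T : measurableType d) (mu : {measure set T -> \bar R})
    (D : set T) N (Phi : T -> 'rV[R]_N -> R) : measurable D ->
  (forall c, measurable_fun D (Phi ^~ c)) ->
  (forall x, D x -> continuous (Phi x)) ->
  (forall K : R, exists2 g : T -> R, mu.-integrable D (EFin \o g) &
    forall x c, D x -> `|c| <= K -> `|Phi x c| <= g x) ->
  continuous (fun c => \int[mu]_(x in D) Phi x c).
Proof.
move=> mD mPhi cPhi dom; apply: seq_continuous => c u uc.
have /cvg_seq_bounded[K0 [_ hK]] : cvgn u by apply/cvg_ex; exists c.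
pose K := Num.max (K0 + 1) `|c|.
have uK j : `|u j| <= K.
  by rewrite le_max; apply/orP; left; apply: hK => //; rewrite ltrDl.
have [g ig gP] := dom K.
have [||||ic _ cvgI] := @dominated_convergence _ T R mu D mD (fun j x => (Phi x (u j))%:E)
  (fun x => (Phi x c)%:E) (EFin \o g) _ _ _ ig _.
- by move=> j; apply/measurable_EFinP; exact: mPhi.
- by apply/measurable_EFinP; exact: mPhi.
- apply/aeW => x Dx; apply: cvg_EFin; first exact: nearW.
  exact: (cvg_comp _ _ uc (cPhi x Dx c)).
- by apply/aeW => x j Dx; rewrite /= lee_fin; exact: gP.
apply: fine_cvg; rewrite fineK; first exact: cvgI.
exact: integrable_fin_num.
Qed.

(** [g] is a pointwise limit of maps with countably many rational values, and on each of their cells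
    the second argument of [b] is fixed. Measurability at rational points is thus enough, which
    leaves only countably many null sets to discard in [regularize]. *)
Lemma caratheodory_fun_measurable d (T : measurableType d) m (b : T -> 'rV[R]_m -> R)
    (g : T -> 'rV[R]_m) :
  (forall q : {ffun 'I_m -> rat}, measurable_fun setT (fun x => b x (\row_i ratr (q i)))) ->
  (forall x, continuous (b x)) ->
  (forall i, measurable_fun setT (fun x => g x 0 i)) ->
  measurable_fun setT (fun x => b x (g x)).
Proof.
move=> mb cb mg.
(* [gq (fl x j) j] rounds the coordinates of [g x] down to multiples of 1 / (j + 1). *)
pose gq (z : {ffun 'I_m -> int}) (j : nat) : 'rV[R]_m :=
  \row_i ratr ((z i)%:~R / j.+1%:R).
pose fl (x : T) (j : nat) : {ffun 'I_m -> int} := [ffun i => Num.floor (j.+1%:R * g x 0 i)].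
apply: (@measurable_fun_cvg _ _ _ _ (fun j x => b x (gq (fl x j) j))).
- move=> j _ Y mY; rewrite setTI.
  pose cell z : set T := [set x | forall i, (z i)%:~R <= j.+1%:R * g x 0 i < (z i + 1)%:~R].
  have -> : (fun x => b x (gq (fl x j) j)) @^-1` Y =
    \bigcup_(z in [set: {ffun 'I_m -> int}]) (cell z `&` (fun x => b x (gq z j)) @^-1` Y).
    apply/seteqP; split=> x /=.
      by move=> bY; exists (fl x j) => //; split=> // i; rewrite ffunE floor_itv.
    move=> [z _ [zx bY]]; suff -> : fl x j = z by [].
    by apply/ffunP => i; rewrite ffunE; apply: floor_def; exact: zx.
  apply: countable_bigcupT_measurable => // z; apply: measurableI.
    have -> : cell z = \bigcap_(i in [set: 'I_m]) ((fun x => j.+1%:R * g x 0 i) @^-1`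
        `[(z i)%:~R, (z i + 1)%:~R[%classic).
      by apply/seteqP; split=> y yA i; have := yA i; rewrite /= in_itv /=; [move=> + _|apply].
    apply: fin_bigcap_measurable => [|i _]; first exact: finite_finset.
    rewrite -[X in measurable X]setTI.
    have mgj : measurable_fun setT (fun x => j.+1%:R * g x 0 i) by exact: measurable_funM.
    by apply: mgj => //; exact: measurable_itv.
  have := mb [ffun i => (z i)%:~R / j.+1%:R] measurableT Y mY; rewrite setTI.
  rewrite (_ : \row_i _ = gq z j)//.
  by apply/rowP => i; rewrite !mxE ffunE.
- move=> x _; apply: (@cvg_comp _ _ _ (fun j => gq (fl x j) j) (b x)); last exact: cb.
  apply/cvgrPdist_lt => e e0; have [k _ hk] := near_infty_natSinv_lt (PosNum e0).
  exists k => // j /hk /= je; apply: le_lt_trans je.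
  apply: normr_rV_le => // i; rewrite !mxE ffunE fmorph_div/= ratr_int ratr_nat.
  have j0 : 0 < j.+1%:R :> R by [].
  have /andP[f1 f2] := floor_itv (j.+1%:R * g x 0 i).
  rewrite ger0_norm; last by rewrite subr_ge0 ler_pdivrMr// [leRHS]mulrC f1.
  rewrite -[leRHS]mul1r ler_pdivlMr// mulrBl divfK ?gt_eqF// lerBlDl [g x 0 i * _]mulrC.
  by rewrite ltW// (lt_le_trans f2)// intrD.
Qed.

End Caratheodory.

(** * Borel version of the data *)

Section Regularization.
Context {R : realType} {n : nat} (Omega : set 'rV[R]_n.+1).
Hypotheses (mO : measurable Omega) (bO : bounded_set Omega).

Lemma subset_null m (A B : set 'rV[R]_m) : measurable A -> A `<=` B -> measurable B ->
  leb m B = 0%E -> leb m A = 0%E.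
Proof.
move=> mA AB mB B0; apply/eqP; rewrite eq_le measure_ge0 andbT -B0.
by apply: le_measure; rewrite ?inE.
Qed.

(** On a bounded domain the constant 1 is integrable, and [|g|] is at most 1 plus its power [q]. *)
Lemma in_Lq_integrable (q : R) (g : 'rV[R]_n.+1 -> R) : 1 <= q -> in_Lq Omega q g ->
  exists (g' : 'rV[R]_n.+1 -> R) (N : set 'rV[R]_n.+1),
  [/\ measurable N, leb n.+1 N = 0%E, forall x, Omega x -> ~ N x -> g x = g' x &
      (leb n.+1).-integrable Omega (EFin \o g')].
Proof.
move=> q1 [[g' mg' [N [mN N0 sub]]] Lg].
have gg' x : Omega x -> ~ N x -> g x = g' x.
  by move=> Ox nNx; apply: contrapT => ne; apply: nNx; apply: sub => /= /(_ Ox).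
exists g', N; split=> //.
have mpow : measurable_fun Omega (fun x => `|g' x| `^ q).
  have mnorm : measurable_fun Omega (fun x => `|g' x|) by exact: measurableT_comp.
  exact: (measurableT_comp (measurable_powR q) mnorm).
have ipow : (leb n.+1).-integrable Omega (fun x => (`|g' x| `^ q)%:E).
  apply/integrableP; split; first exact/measurable_EFinP.
  rewrite (eq_integral (fun x => (`|g' x| `^ q)%:E)); last first.
    by move=> x _; rewrite /= ger0_norm// powR_ge0.
  rewrite -(@ge0_ae_eq_integral_nonmeasurable _ _ _ (leb n.+1) Omega N
    (fun x => (`|g x| `^ q)%:E))//.
  - by move=> x Ox nNx; rewrite gg'.
  - exact/measurable_EFinP.
have icst : (leb n.+1).-integrable Omega (EFin \o (fun=> 1 : R)).
  by apply: continuous_integrable => //; exact: const_fun_continuous.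
have := integrableD mO icst ipow; apply: le_integrable => //.
  exact/measurable_EFinP.
move=> x Ox; rewrite /= lee_fin [leRHS]ger0_norm ?addr_ge0 ?powR_ge0//.
exact: powR_ge1D.
Qed.

Definition tail (z : 'rV[R]_n.+2) : 'rV[R]_n.+1 := \row_i z 0 (lift 0 i).

Lemma tail_continuous : continuous tail.
Proof.
by apply: rV_continuous => i; under eq_fun do rewrite mxE; exact: coord_continuous.
Qed.

Variables (p : R) (a : 'rV[R]_n.+1 -> R -> 'rV[R]_n.+1 -> 'rV[R]_n.+1) (f : 'rV[R]_n.+1 -> R).
Hypotheses (p1 : 1 < p) (LL : leray_lions Omega p a f).

(** The arguments [s] and [xi] of [a] are packed in one row [z], to make a Carathéodory function of
    a single vector variable. *)
Definition regular_on (N : set 'rV[R]_n.+1) (x : 'rV[R]_n.+1) (z : 'rV[R]_n.+2) : 'rV[R]_n.+1 :=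
  if `[< Omega x /\ ~ N x >] then a x (z 0 0) (tail z) else 0.

Let q1 : 1 <= conjugate_exponent p.
Proof.
have p0 : 0 < p - 1 by rewrite subr_gt0.
by rewrite /conjugate_exponent ler_pdivlMr// mul1r gerBl.
Qed.

(** [N] collects the exceptional sets of continuity, growth and coercivity, those of the integrable
    versions of the bound and of the load, and one for each component of [a] at each rational
    argument, as measurability is given argument by argument. *)
Lemma regularize : exists N : set 'rV[R]_n.+1,
  [/\ measurable N, leb n.+1 N = 0%E,
   (forall (q : {ffun 'I_n.+2 -> rat}) i, measurable_fun setT
      (fun x => regular_on N x (\row_j ratr (q j)) 0 i)) &
   [/\ forall x, continuous (regular_on N x),
     (exists (g : 'rV[R]_n.+1 -> R) (beta r : R),
       [/\ (leb n.+1).-integrable setT (EFin \o g), 0 <= beta, 0 <= r & forall x z,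
        enorm (regular_on N x z) <= g x + beta * `|z 0 0| `^ r + beta * enorm (tail z) `^ (p - 1)]),
     (exists2 lambda : R, 0 < lambda & forall x, Omega x -> ~ N x -> forall z,
        lambda * enorm (tail z) `^ p <= dotv (regular_on N x z) (tail z)) &
     (exists2 f' : 'rV[R]_n.+1 -> R, (leb n.+1).-integrable Omega (EFin \o f') &
        forall x, Omega x -> ~ N x -> f x = f' x)]].
Proof.
have [[[N1 [mN1 N10 sub1]] carm] [abar [beta [r [Labar beta0 r0 _ [N2 [mN2 N20 sub2]]]]]] _
  [lam lam0 [N3 [mN3 N30 sub3]]] Lf] := LL.
have [g' [N4 [mN4 N40 gg' ig']]] := in_Lq_integrable q1 Labar.
have [f' [N5 [mN5 N50 ff' if']]] := in_Lq_integrable q1 Lf.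
pose J := ({ffun 'I_n.+2 -> rat} * 'I_n.+1)%type.
pose zq (q : {ffun 'I_n.+2 -> rat}) : 'rV[R]_n.+2 := \row_j ratr (q j).
have hJ (z : J) : exists hN : ('rV[R]_n.+1 -> R) * set 'rV[R]_n.+1,
    [/\ measurable_fun Omega hN.1, measurable hN.2, leb n.+1 hN.2 = 0%E &
     forall x, Omega x -> ~ hN.2 x -> a x (zq z.1 0 0) (tail (zq z.1)) 0 z.2 = hN.1 x].
  have [h mh [Nh [mNh Nh0 subh]]] := carm (zq z.1 0 0) (tail (zq z.1)) z.2.
  exists (h, Nh); split=> //= x Ox nNx; apply: contrapT => ne; apply: nNx.
  by apply: subh => /= /(_ Ox).
have [hN hNP] := choice hJ.
(* Enumerates the exceptional sets of the countable type [J]; a number that codes no element of [J]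
   contributes the empty set. *)
pose Nk (k : nat) := if @unpickle J k is Some z then (hN z).2 else set0.
have mNk k : measurable (Nk k) by rewrite /Nk; case: unpickle => // z; have [] := hNP z.
have Nk0 k : leb n.+1 (Nk k) = 0%E.
  by rewrite /Nk; case: unpickle => [z|]; [have [] := hNP z|rewrite measure0].
pose N6 := \bigcup_k Nk k.
have mN6 : measurable N6 by exact: bigcup_measurable.
have N60 : leb n.+1 N6 = 0%E.
  have [B [mB B0 NB]] : (leb n.+1).-negligible N6.
    by apply: negligible_bigcup => k; exists (Nk k); split; [exact: mNk|exact: Nk0|].
  exact: subset_null mN6 NB mB B0.
pose N := N1 `|` N2 `|` N3 `|` N4 `|` N5 `|` N6.
have mN : measurable N by do !apply: measurableU.
have N0 : leb n.+1 N = 0%E.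
  have U0 A B : measurable A -> measurable B -> leb n.+1 A = 0%E -> leb n.+1 B = 0%E ->
      leb n.+1 (A `|` B) = 0%E by move=> mA mB A0 B0; rewrite measureU0.
  by do 5 (apply: (U0) => //; try by do !apply: measurableU).
exists N; split=> //.
- move=> q i; pose z : J := (q, i); have [mh mNz Nz0 hE] := hNP z.
  have sub6 : (hN z).2 `<=` N by move=> x Nx; right; exists (pickle z); rewrite /Nk ?pickleK.
  have -> : (fun x => regular_on N x (zq q) 0 i) = (hN z).1 \_ (Omega `\` N).
    apply/funext => x; rewrite /regular_on /patch; case: asboolP => [[Ox nNx]|nx].
      by rewrite mem_set//; apply: hE => // /sub6.
    by rewrite memNset ?mxE.
  apply/(measurable_restrictT _ (measurableD mO mN)).
  by apply: measurable_funS mh => // x [].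
split.
- move=> x; rewrite /regular_on; case: asboolP => [[Ox nNx]|nx]; last exact: cst_continuous.
  have nN1 : ~ N1 x by move=> ?; apply: nNx; do 5 left.
  have cax : continuous (fun z : R * 'rV[R]_n.+1 => a x z.1 z.2).
    by apply: contrapT => nc; apply: nN1; apply: sub1 => /= /(_ Ox).
  move=> z; apply: (@continuous2_cvg _ _ _ _ _ _ _ _ (a x) (z 0 0) (tail z)).
  - exact: nbhs_filter.
  - exact: (cax (z 0 0, tail z)).
  - exact: coord_continuous.
  - exact: tail_continuous.
- exists (fun x => `|(g' \_ Omega) x|), beta, r; split=> //; [|exact: ltW|].
    have /integrable_abse : (leb n.+1).-integrable setT (EFin \o (g' \_ Omega)).
      rewrite -restrict_EFin; apply/integrable_restrict => //.
      by rewrite setTI.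
    by [].
  move=> x z; rewrite /regular_on; case: asboolP => [[Ox nNx]|nx]; last first.
    rewrite /enorm /dotv big1 ?sqrtr0; last by move=> i _; rewrite mxE mul0r.
    by rewrite !addr_ge0// mulr_ge0 ?powR_ge0// ltW.
  have nN2 : ~ N2 x by move=> ?; apply: nNx; do 4 left; right.
  have nN4 : ~ N4 x by move=> ?; apply: nNx; do 2 left; right.
  have : forall s xi, enorm (a x s xi) <= abar x + beta * `|s| `^ r + beta * enorm xi `^ (p - 1).
    by apply: contrapT => nc; apply: nN2; apply: sub2 => /= /(_ Ox).
  move=> /(_ (z 0 0) (tail z)) /le_trans; apply; rewrite !lerD2r gg'//.
  by rewrite /patch mem_set// ler_norm.
- exists lam => // x Ox nNx z; rewrite /regular_on asboolT//.
  have nN3 : ~ N3 x by move=> ?; apply: nNx; do 3 left; right.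
  have : forall s xi, lam * enorm xi `^ p <= dotv (a x s xi) xi.
    by apply: contrapT => nc; apply: nN3; apply: sub3 => /= /(_ Ox).
  by apply.
exists f' => // x Ox nNx; apply: ff' => // N5x; apply: nNx; by left; right.
Qed.

End Regularization.

(** * Integrals depending on the coordinates of a discrete function *)

Section ParametricIntegrals.
Context {R : realType}.

Lemma comb_continuous_l m q (v : 'I_m -> 'rV[R]_q) :
  continuous (fun c : 'rV[R]_m => \sum_j c 0 j *: v j).
Proof.
apply: rV_continuous => i; under eq_fun do rewrite summxE.
apply: sum_fun_continuous => j; under eq_fun do rewrite mxE.
apply: mul_fun_continuous; last exact: const_fun_continuous.
exact: coord_continuous.
Qed.

Lemma comb_continuous_r n m q (c : 'rV[R]_m) (rho : 'I_m -> 'rV[R]_n -> 'rV[R]_q) :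
  (forall j, continuous (rho j)) -> continuous (fun x => \sum_j c 0 j *: rho j x).
Proof.
move=> crho; apply: rV_continuous => i; under eq_fun do rewrite summxE.
apply: sum_fun_continuous => j; under eq_fun do rewrite mxE.
apply: mul_fun_continuous; first exact: const_fun_continuous.
exact: continuous_coord.
Qed.

Lemma comb_bounded n m q (D : set 'rV[R]_n) (rho : 'I_m -> 'rV[R]_n -> 'rV[R]_q) (K : R) :
  bounded_set D -> (forall j, continuous (rho j)) ->
  exists2 C : R, 0 <= C & forall x (c : 'rV[R]_m), D x -> `|c| <= K ->
    `|\sum_j c 0 j *: rho j x| <= C.
Proof.
move=> bD crho.
have hC j : exists C : R, 0 <= C /\ forall x, D x -> `|rho j x| <= C.
  have cn : continuous (fun x => `|rho j x|).
    move=> x; apply: (@continuous_comp _ _ _ (rho j) (fun y => `|y|)); first exact: crho.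
    exact: norm_continuous.
  by have [C C0 hC] := bounded_continuous bD cn; exists C; split=> // x /hC; rewrite normr_id.
have [C /all_and2[C0 hC']] := choice hC.
exists (`|K| * \sum_j C j); first by rewrite mulr_ge0// sumr_ge0.
move=> x c Dx cK; apply: le_trans (ler_norm_sum _ _ _) _; rewrite mulr_sumr.
apply: ler_sum => j _; rewrite normrZ ler_pM//; last exact: hC'.
by rewrite (le_trans (normr_coord c j))// (le_trans cK)// ler_norm.
Qed.

Lemma continuous_int_comb n m q (D : set 'rV[R]_n) (rho : 'I_m -> 'rV[R]_n -> 'rV[R]_q)
    (H : 'rV[R]_q -> R) (tau : 'rV[R]_n -> R) : measurable D -> bounded_set D ->
  (forall j, continuous (rho j)) -> continuous H -> continuous tau ->
  continuous (fun c : 'rV[R]_m => \int[leb n]_(x in D) (H (\sum_j c 0 j *: rho j x) * tau x)).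
Proof.
move=> mD bD crho cH ctau; apply: continuous_Rintegral => //.
- move=> c; apply: measurable_funTS; apply: continuous_measurable_rV.
  apply: mul_fun_continuous => // x.
  apply: (@continuous_comp _ _ _ (fun x => \sum_j c 0 j *: rho j x) H); last exact: cH.
  exact: comb_continuous_r.
- move=> x _; apply: mul_fun_continuous; last exact: const_fun_continuous.
  move=> c; apply: (@continuous_comp _ _ _ (fun c : 'rV[R]_m => \sum_j c 0 j *: rho j x) H).
    exact: comb_continuous_l.
  exact: cH.
move=> K; have [C C0 hC] := comb_bounded K bD crho.
have [KH KH0 hH] := bounded_continuous (@bounded_normr_le R q C) cH.
have [Kt Kt0 ht] := bounded_continuous bD ctau.
exists (fun=> KH * Kt); first by apply: continuous_integrable => //; exact: const_fun_continuous.
by move=> x c Dx cK; rewrite normrM ler_pM//; [apply: hH; exact: hC|exact: ht].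
Qed.

Section element.
Variables (n : nat) (b : 'rV[R]_n.+1 -> 'rV[R]_n.+2 -> 'rV[R]_n.+1).
Hypotheses (mb : forall (q : {ffun 'I_n.+2 -> rat}) i, measurable_fun setT
      (fun x => b x (\row_j ratr (q j)) 0 i))
  (cb : forall x, continuous (b x)).
Variables (g : 'rV[R]_n.+1 -> R) (beta r p : R).
Hypotheses (ig : (leb n.+1).-integrable setT (EFin \o g)) (beta0 : 0 <= beta)
  (r0 : 0 <= r) (p1 : 1 < p)
  (bg : forall x z, enorm (b x z) <=
      g x + beta * `|z 0 0| `^ r + beta * enorm (tail z) `^ (p - 1)).
Variables (D : set 'rV[R]_n.+1) (m : nat) (Z : 'I_m -> 'rV[R]_n.+1 -> 'rV[R]_n.+2)
  (w : 'rV[R]_n.+1 -> 'rV[R]_n.+1).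
Hypotheses (mD : measurable D) (bD : bounded_set D) (cZ : forall j, continuous (Z j))
  (cw : continuous w).

Lemma element_measurable (c : 'rV[R]_m) :
  measurable_fun D (fun x => dotv (b x (\sum_j c 0 j *: Z j x)) (w x)).
Proof.
apply: measurable_funTS; apply: measurable_sum => i; apply: measurable_funM; last first.
  by apply: continuous_measurable_rV; exact: continuous_coord.
apply: (@caratheodory_fun_measurable _ _ _ _ (fun x z => b x z 0 i)) => //.
  by move=> x; exact: continuous_coord.
move=> l; apply: continuous_measurable_rV;
apply: (@continuous_coord _ _ _ (fun x => \sum_j c 0 j *: Z j x)).
exact: comb_continuous_r.
Qed.

(** For [|c| <= K] the second argument of [b] stays in a fixed ball, so that the growth condition
    bounds [b] by [g] plus a constant. *)
Lemma element_dominated (K : R) : exists2 G : 'rV[R]_n.+1 -> R,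
  (leb n.+1).-integrable D (EFin \o G) &
  forall x (c : 'rV[R]_m), D x -> `|c| <= K ->
    `|dotv (b x (\sum_j c 0 j *: Z j x)) (w x)| <= G x.
Proof.
have [C C0 hC] := comb_bounded K bD cZ.
have cW : continuous (fun x => \sum_i `|w x 0 i|).
  by apply: sum_fun_continuous => i; apply: norm_fun_continuous; exact: continuous_coord.
have [W W0 hW] := bounded_continuous bD cW.
pose E := Num.sqrt (n.+1%:R * C ^+ 2).
pose A := beta * C `^ r + beta * E `^ (p - 1).
exists (fun x => W * (g x + A)).
  have igD : (leb n.+1).-integrable D (EFin \o g) by apply: integrableS ig.
  have iA : (leb n.+1).-integrable D (EFin \o fun=> A).
    by apply: continuous_integrable => //; exact: const_fun_continuous.
  exact: (integrableZl mD W (integrableD mD igD iA)).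
move=> x c Dx cK; set z := \sum_j _.
have zC i : `|z 0 i| <= C by apply: le_trans (normr_coord z i) _; exact: hC.
apply: le_trans (dotv_le _ _) _; rewrite mulrC ler_pM//.
- by rewrite sumr_ge0.
- exact: enorm_ge0.
- by apply: le_trans (hW _ Dx); rewrite ler_norm.
apply: le_trans (bg x z) _; rewrite -addrA lerD2l lerD// ler_wpM2l//.
  by apply: ge0_ler_powR; rewrite ?nnegrE.
have p1' : 0 <= p - 1 by rewrite subr_ge0 ltW.
apply: ge0_ler_powR; rewrite ?nnegrE ?enorm_ge0 ?sqrtr_ge0//.
by apply: enorm_le => i; rewrite mxE.
Qed.

Lemma element_continuous :
  continuous (fun c : 'rV[R]_m => \int[leb n.+1]_(x in D) dotv (b x (\sum_j c 0 j *: Z j x)) (w x)).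
Proof.
apply: continuous_Rintegral => //; [exact: element_measurable| |exact: element_dominated].
move=> x _; apply: dotv_fun_continuous; last exact: cst_continuous.
move=> c; apply: (@continuous_comp _ _ _ (fun c : 'rV[R]_m => \sum_j c 0 j *: Z j x) (b x)).
  exact: comb_continuous_l.
exact: cb.
Qed.

Lemma element_integrable (c : 'rV[R]_m) : (leb n.+1).-integrable D
  (EFin \o (fun x => dotv (b x (\sum_j c 0 j *: Z j x)) (w x))).
Proof.
have [G iG hG] := element_dominated `|c|.
apply: le_integrable iG => //; first by apply/measurable_EFinP; exact: element_measurable.
move=> x Dx; rewrite /= lee_fin; apply: le_trans (hG x c Dx (lexx _)) _.
exact: ler_norm.
Qed.
End element.

End ParametricIntegrals.

(** * Existence of a discrete solution *)

Lemma homogeneous_lower_bound (R : realType) m (p : R) (E : 'rV[R]_m -> R) : p != 0 ->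
  continuous E -> (forall c, 0 <= E c) -> (forall c, E c = 0 -> c = 0) ->
  (forall t c, 0 <= t -> E (t *: c) = t `^ p * E c) ->
  exists2 mu, 0 < mu & forall c, mu * `|c| `^ p <= E c.
Proof.
move=> p0 cE E0 E_eq0 EZ.
suff [mu mu0 hmu] : exists2 mu, 0 < mu & forall c : 'rV[R]_m, `|c| = 1 -> mu <= E c.
  exists mu => // c; have [->|c_neq0] := eqVneq c 0.
    by rewrite normr0 powR0// mulr0.
  have nc : 0 < `|c| by rewrite normr_gt0.
  rewrite -[in leRHS](_ : `|c| *: (`|c|^-1 *: c) = c); last first.
    by rewrite scalerA mulfV ?scale1r// gt_eqF.
  rewrite EZ// mulrC ler_wpM2l ?powR_ge0//; apply: hmu.
  by rewrite normrZ normfV normr_id mulVf// gt_eqF.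
(* The unit sphere is empty when [m = 0], and any positive [mu] does. *)
have [S0|noc] := pselect ([set c : 'rV[R]_m | `|c| = 1] !=set0); last first.
  by exists 1 => // c c1; exfalso; apply: noc; exists c.
have cS : compact [set c : 'rV[R]_m | `|c| = 1].
  apply: bounded_closed_compact.
    by exists 1; split; [exact: num_real|move=> M M1 c /= ->; exact: ltW].
  apply: (@closed_comp _ _ (fun c : 'rV[R]_m => `|c|) [set 1]); last exact: closed_eq.
  by move=> c _; exact: norm_continuous.
have [c1 c11 c1min] := compact_EVT_min S0 cS (continuous_subspaceT cE).
exists (E c1) => [|c cS1]; last by apply: c1min; rewrite inE.
rewrite lt_neqAle E0 andbT eq_sym; apply/eqP => /E_eq0 c10.
by move: c11; rewrite c10 inE /= normr0 => /esym/eqP; rewrite oner_eq0.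
Qed.

Lemma coercive_system (R : realType) m (p : R) (E : 'rV[R]_m -> R)
    (phi : 'I_m -> 'rV[R]_m -> R) (l : 'I_m -> R) : 1 < p ->
  continuous E -> (forall c, 0 <= E c) -> (forall c, E c = 0 -> c = 0) ->
  (forall t c, 0 <= t -> E (t *: c) = t `^ p * E c) ->
  (forall i, continuous (phi i)) -> (forall c, E c <= \sum_i c 0 i * phi i c) ->
  exists c, forall i, phi i c = l i.
Proof.
move=> p1 cE E0 E_eq0 EZ cphi Ephi.
have p0 : p != 0 by rewrite gt_eqF// (lt_trans _ p1).
have [mu mu0 hmu] := homogeneous_lower_bound p0 cE E0 E_eq0 EZ.
(* [coercive_zero] is stated in positive dimension. *)
case: m E phi l cE E0 E_eq0 EZ cphi Ephi hmu => [|m] E phi l cE E0 E_eq0 EZ cphi Ephi hmu.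
  by exists 0; case.
pose L := \sum_i `|l i|; have L0 : 0 <= L by apply: sumr_ge0.
(* Solves [mu * r]^ (p - 1) = L + 1[: for]|c| >= r[the energy, at least]mu * |c| [^ p], exceeds the
   load, at most [L * |c|]. *)
pose r := (((L + 1) / mu) `^ (p - 1)^-1).
have p10 : 0 < p - 1 by rewrite subr_gt0.
have LM : 0 < (L + 1) / mu by rewrite divr_gt0// ltr_wpDl.
have r0 : 0 < r by exact: powR_gt0.
have rE : mu * r `^ (p - 1) = L + 1.
  by rewrite /r -powRrM mulVf ?gt_eqF// powRr1 ?ltW// mulrC divfK ?gt_eqF.
pose G (c : 'rV[R]_m.+1) : 'rV[R]_m.+1 := \row_i (phi i c - l i).
have [|c rc|c Gc] := @coercive_zero _ _ G r; last first.
- exists c => i; apply/eqP; rewrite -subr_eq0.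
  by move/rowP: Gc => /(_ i); rewrite !mxE => /eqP.
- have c0 : 0 < `|c| by exact: lt_le_trans rc.
  have -> : dotv (G c) c = \sum_i c 0 i * phi i c - \sum_i c 0 i * l i.
    rewrite -sumrB; apply: eq_bigr => i _; rewrite mxE; ring.
  rewrite subr_gt0; apply: (@lt_le_trans _ _ (mu * `|c| `^ p)); last exact: le_trans (Ephi c).
  apply: (@le_lt_trans _ _ (`|c| * L)).
    apply: le_trans (ler_norm _) _; apply: le_trans (ler_norm_sum _ _ _) _.
    rewrite mulr_sumr; apply: ler_sum => i _; rewrite normrM ler_wpM2r//.
    exact: normr_coord.
  have -> : `|c| `^ p = `|c| * `|c| `^ (p - 1).
    by rewrite -{2}[`|c|]powRr1 ?ltW// -powRD ?subrKC// (gt_eqF c0) implybT.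
  rewrite mulrCA ltr_pM2l//; apply: (@lt_le_trans _ _ (L + 1)); first by rewrite ltrDl.
  rewrite -rE ler_pM2l// ge0_ler_powR ?nnegrE// ?ltW//.
apply: rV_continuous => i; under eq_fun do rewrite mxE.
apply: sub_fun_continuous; [exact: cphi|exact: const_fun_continuous].
Qed.

Lemma Rintegral_comb d (T : measurableType d) (R : realType) (mu : {measure set T -> \bar R})
    (D : set T) (I : Type) (s : seq I) (c : I -> R) (f : I -> T -> R) : measurable D ->
  (forall i, mu.-integrable D (EFin \o f i)) ->
  \int[mu]_(x in D) (\sum_(i <- s) c i * f i x) = \sum_(i <- s) c i * \int[mu]_(x in D) f i x.
Proof.
move=> mD fi.
suff [] : \int[mu]_(x in D) (\sum_(i <- s) c i * f i x) =
      \sum_(i <- s) c i * \int[mu]_(x in D) f i x /\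
  mu.-integrable D (EFin \o (fun x => \sum_(i <- s) c i * f i x)) by [].
elim: s => [|i s [IH1 IH2]].
  under eq_Rintegral do rewrite big_nil.
  rewrite big_nil Rintegral_cst// mul0r; split=> //.
  by rewrite (_ : EFin \o _ = cst 0%E); [exact: integrable0|apply/funext => x /=; rewrite big_nil].
have ici : mu.-integrable D (EFin \o (fun x => c i * f i x)).
  exact: (integrableZl mD (c i) (fi i)).
split.
  under eq_Rintegral do rewrite big_cons.
  by rewrite RintegralD// RintegralZl// big_cons IH1.
rewrite (_ : EFin \o _ = (fun x => (c i * f i x)%:E + (\sum_(i <- s) c i * f i x)%:E)%E).
  exact: integrableD.
by apply/funext => x /=; rewrite big_cons EFinD.
Qed.

(** The mesh places the elements inside the closure of [Omega] only. Points of an element outside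
    [Omega], where nothing is assumed of [a], lie in this null set. *)
Lemma boundary_null (R : realType) n (A : set 'rV[R]_n.+1) : polytopal A ->
  exists B : set 'rV[R]_n.+1, [/\ measurable B, leb n.+1 B = 0%E & boundary A `<=` B].
Proof.
move=> [_ _ _ [s s0 sP]].
have mH (z : 'rV[R]_n.+1 * R) : measurable (hyperplane z.1 z.2).
  apply: closed_measurable_rV.
  apply: (@closed_comp _ _ (dotv z.1) [set z.2]); last exact: closed_eq.
  by move=> x _; exact: dotv_continuous_r.
suff [B [mB B0 sB]] : exists B : set 'rV[R]_n.+1, [/\ measurable B, leb n.+1 B = 0%E &
    forall z x, z \in s -> hyperplane z.1 z.2 x -> B x].
  by exists B; split=> // x /sP[z zs zx]; exact: sB zs zx.
elim: s s0 {sP} => [|z s IHs] s0.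
  by exists set0; split=> //; rewrite measure0.
have [|B [mB B0 sB]] := IHs; first by move=> z' z's; apply: s0; rewrite inE z's orbT.
exists (hyperplane z.1 z.2 `|` B); split.
- exact: measurableU.
- by rewrite measureU0//; apply: hyperplane_null; rewrite s0// inE eqxx.
- move=> z' x; rewrite inE => /orP[/eqP ->|z's]; first by left.
  by move=> h; right; exact: sB z's h.
Qed.

Section Existence.
Context {R : realType} {n : nat} (M : mesh R n) (k : nat) (Omega : set 'rV[R]_n.+1) (h p : R).
Variables (a : 'rV[R]_n.+1 -> R -> 'rV[R]_n.+1 -> 'rV[R]_n.+1) (f f' g : 'rV[R]_n.+1 -> R)
  (N B : set 'rV[R]_n.+1) (beta r lam : R).
Hypothesis polyO : polytopal Omega.
Hypothesis p1 : 1 < p.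
Local Notation b := (regular_on Omega a N).
Hypotheses (mN : measurable N) (N0 : leb n.+1 N = 0%E)
  (mB : measurable B) (B0 : leb n.+1 B = 0%E) (sB : boundary Omega `<=` B)
  (mb : forall (q : {ffun 'I_n.+2 -> rat}) i, measurable_fun setT
      (fun x => b x (\row_j ratr (q j)) 0 i))
  (cb : forall x, continuous (b x))
  (ig : (leb n.+1).-integrable setT (EFin \o g)) (beta0 : 0 <= beta) (r0 : 0 <= r)
  (bg : forall x z, enorm (b x z) <=
      g x + beta * `|z 0 0| `^ r + beta * enorm (tail z) `^ (p - 1))
  (lam0 : 0 < lam)
  (coer : forall x, Omega x -> ~ N x -> forall z,
      lam * enorm (tail z) `^ p <= dotv (b x z) (tail z))
  (if' : (leb n.+1).-integrable Omega (EFin \o f'))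
  (ff' : forall x, Omega x -> ~ N x -> f x = f' x).
Hypothesis eltP : forall T : telt M, [/\ open (elt T), bounded_set (elt T) & elt T !=set0].
Hypothesis fdomP : forall F : tface M,
  [/\ closed (fdom F), bounded_set (fdom F) & (fdom F)° !=set0].
Hypothesis meshM : is_mesh Omega h M.
Variables (m : nat) (e : 'I_m -> hybrid M).
Hypothesis spanUh0 : Uh0 k Omega = spanned e.
Hypothesis free_e : forall c : 'I_m -> R, \sum_i c i *: e i = 0 -> forall i, c i = 0.

Implicit Types (T : telt M) (F : tface M) (v : hybrid M) (c : 'rV[R]_m).

Let mT T : measurable (elt T).
Proof. by have [oT _ _] := eltP T; exact: open_measurable_rV. Qed.
Let bT T : bounded_set (elt T).
Proof. by have [] := eltP T. Qed.
Let iT T : (elt T)° !=set0.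
Proof. by have [/interior_id -> _] := eltP T. Qed.
Let mF F : measurable (fdom F).
Proof. by have [cF _ _] := fdomP F; exact: closed_measurable_rV. Qed.
Let bF F : bounded_set (fdom F).
Proof. by have [] := fdomP F. Qed.
Let iF F : (fdom F)° !=set0.
Proof. by have [] := fdomP F. Qed.
Let mO : measurable Omega.
Proof. by have [oO _ _ _] := polyO; exact: open_measurable_rV. Qed.
Let bO : bounded_set Omega.
Proof. by have [] := polyO. Qed.

Let U c : hybrid M := \sum_j c 0 j *: e j.

Let Uh0e j : Uh0 k Omega (e j).
Proof.
rewrite spanUh0; exists (fun i => (i == j)%:R) => //.
by rewrite (bigD1 j)//= eqxx scale1r big1 ?addr0// => i /negbTE ->; rewrite scale0r.
Qed.

Let Uhe j : Uh k (e j). Proof. by have [] := Uh0e j. Qed.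

Let Uh0U c : Uh0 k Omega (U c).
Proof. by rewrite spanUh0; exists (c 0). Qed.

Let UhU c : Uh k (U c). Proof. by have [] := Uh0U c. Qed.

Let dgradU c T : dgrad k T (U c) = \sum_j c 0 j *: dgrad k T (e j).
Proof. exact: (linear_on_sum (fdim_Uh M k) (c 0) (dgrad_lin eltP fdomP T) Uhe). Qed.

Let face_residualU c T F : face_residual k T F (U c) = \sum_j c 0 j *: face_residual k T F (e j).
Proof. exact: (linear_on_sum (fdim_Uh M k) (c 0) (face_residual_lin eltP fdomP T F) Uhe). Qed.

Let U1 c T : (U c).1 T = \sum_j c 0 j *: (e j).1 T.
Proof.
have l1 : linear_on (@Uh R n M k) (fun v : hybrid M => v.1 T).
  by move=> x u v _ _; exact: pair_fun_lin1.
exact: (linear_on_sum (fdim_Uh M k) (c 0) l1 Uhe).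
Qed.

Let dgrad_continuous v T : Uh k v -> continuous (dgrad k T v).
Proof. by move=> Uv; have [/Pkv_continuous] := dgradP eltP fdomP T Uv. Qed.

Let face_residual_continuous v T F : Uh k v -> continuous (face_residual k T F v).
Proof. by move=> Uv; exact: (Pk_continuous (face_residual_Pk eltP fdomP T F Uv)). Qed.

(** Value and discrete gradient of a basis function in one row: the combination with coefficients
    [c] is then the argument of [b] at [U c]. *)
Let Z T j x : 'rV[R]_n.+2 := cons_vec ((e j).1 T x, dgrad k T (e j) x).

Let Z_continuous T j : continuous (Z T j).
Proof.
apply: rV_continuous => i; case: (unliftP 0 i) => [i' ->|->].
  under eq_fun do rewrite cons_vecS; apply: continuous_coord.
  exact: dgrad_continuous.
under eq_fun do rewrite cons_vec0.
exact: Pk_continuous ((Uhe j).1 T).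
Qed.

Let Z0 T c x : (\sum_j c 0 j *: Z T j x) 0 0 = (U c).1 T x.
Proof.
rewrite summxE U1 fct_sumE; apply: eq_bigr => j _; rewrite mxE cons_vec0.
by [].
Qed.

Let Ztail T c x : tail (\sum_j c 0 j *: Z T j x) = dgrad k T (U c) x.
Proof.
apply/rowP => i; rewrite mxE summxE dgradU fct_sumE summxE; apply: eq_bigr => j _.
by rewrite mxE cons_vecS mxE.
Qed.

Let elt_Omega T x : elt T x -> ~ B x -> Omega x.
Proof.
move=> Tx nBx; apply: contrapT => nOx; apply: nBx; apply: sB.
have [[_ _ clO _ _] _ _ _ _] := meshM; have [oO _ _ _] := polyO.
split; first by rewrite clO; exists T => //; exact: subset_closure.
by rewrite ((interior_id _).1 oO).
Qed.

Let elem c T v : R := \int[leb n.+1]_(x in elt T)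
  dotv (b x (\sum_j c 0 j *: Z T j x)) (dgrad k T v x).

Let elemE c T v : Uh k v ->
  \int[leb n.+1]_(x in elt T)
    dotv (a x ((U c).1 T x) (dgrad k T (U c) x)) (dgrad k T v x) = elem c T v.
Proof.
move=> Uv; apply: (@ae_eq_Rintegral _ _ _ (leb n.+1) (elt T) (N `|` B)).
- exact: mT.
- exact: measurableU.
- by rewrite measureU0.
- move=> x Tx nNBx; have nBx : ~ B x by move=> ?; apply: nNBx; right.
  rewrite /regular_on asboolT ?Z0 ?Ztail//; split; first exact: elt_Omega Tx nBx.
  by move=> ?; apply: nNBx; left.
apply: (@element_measurable _ _ b mb cb (elt T) m (Z T) (dgrad k T v)).
  exact: Z_continuous.
exact: dgrad_continuous.
Qed.

Let dotv_comb (y : 'rV[R]_n.+1) (d : 'rV[R]_m) (w : 'I_m -> 'rV[R]_n.+1) :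
  dotv y (\sum_i d 0 i *: w i) = \sum_i d 0 i * dotv y (w i).
Proof.
apply: (big_rec2 (fun s t => dotv y s = t)).
  by rewrite /dotv big1// => i _; rewrite mxE mulr0.
by move=> i s t _ <-; rewrite dotvDr dotvZr.
Qed.

Let elem_lin c d T : elem c T (U d) = \sum_i d 0 i * elem c T (e i).
Proof.
rewrite /elem -Rintegral_comb//.
  by apply: eq_Rintegral => x _; rewrite dgradU fct_sumE dotv_comb.
move=> i; exact: (element_integrable mb cb ig beta0 r0 p1 bg (mT T) (bT T)
  (@Z_continuous T) (@dgrad_continuous (e i) T (Uhe i)) c).
Qed.

Let psi_continuous c T F : continuous (fun y =>
  `|face_residual k T F (U c) y| `^ (p - 2) * face_residual k T F (U c) y).
Proof.
move=> y; apply: (@continuous_comp _ _ _ (face_residual k T F (U c))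
  (fun t => `|t| `^ (p - 2) * t)).
  by apply: face_residual_continuous.
exact: signed_powR_continuous.
Qed.

Let stab_lin c d T : stab k p T (U c) (U d) = \sum_i d 0 i * stab k p T (U c) (e i).
Proof.
rewrite /stab; under [RHS]eq_bigr do rewrite mulr_sumr.
rewrite [RHS]exchange_big /=; apply: eq_bigr => F _.
under [RHS]eq_bigr do rewrite mulrCA.
rewrite -mulr_sumr; apply: (congr1 (fun t => hface F `^ (1 - p) * t)).
pose psi y := `|face_residual k T F (U c) y| `^ (p - 2) * face_residual k T F (U c) y.
have psi_c : continuous psi by exact: psi_continuous.
transitivity (\int[leb n]_(y in fdom F) (\sum_i d 0 i * (psi y * face_residual k T F (e i) y))).
  apply: eq_Rintegral => y _.
  apply: (etrans (congr1 (fun w => psi y * w y) (face_residualU d T F))).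
  rewrite fct_sumE mulr_sumr.
  by apply: eq_bigr => i _; rewrite mulrCA.
pose q i y := psi y * face_residual k T F (e i) y.
apply: (@Rintegral_comb _ _ _ (leb n) _ _ (index_enum 'I_m) (d 0) q (mF F)) => i.
apply: continuous_integrable (mF F) (bF F) _; apply: mul_fun_continuous psi_c _.
exact: face_residual_continuous.
Qed.

Let hho_lin c d : hho_form k p a (U c) (U d) = \sum_i d 0 i * hho_form k p a (U c) (e i).
Proof.
rewrite /hho_form; under [RHS]eq_bigr do rewrite mulr_sumr.
rewrite [RHS]exchange_big /=; apply: eq_bigr => T _.
rewrite elemE// elem_lin stab_lin -big_split; apply: eq_bigr => i _ /=.
by rewrite elemE// mulrDr.
Qed.

Let broken_measurable v : Uh k v -> measurable_fun Omega (broken v).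
Proof.
move=> Uv; apply: measurable_sum => T; apply: measurable_funM.
  exact: measurable_indic.
by apply: measurable_funTS; apply: continuous_measurable_rV; exact: Pk_continuous (Uv.1 T).
Qed.

Let load_integrable v : Uh k v ->
  (leb n.+1).-integrable Omega (EFin \o (fun x => f' x * broken v x)).
Proof.
move=> Uv; have cS : continuous (fun x => \sum_T `|v.1 T x|).
  by apply: sum_fun_continuous => T; apply: norm_fun_continuous; exact: Pk_continuous (Uv.1 T).
have [C C0 hC] := bounded_continuous bO cS.
apply: (integrableMl mO if' (broken_measurable Uv)).
exists C; split; first exact: num_real.
move=> C' CC' x Ox; apply: le_trans (ltW CC'); apply: le_trans (hC x Ox).
rewrite [leRHS]ger0_norm ?sumr_ge0//; apply: le_trans (ler_norm_sum _ _ _) _.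
apply: ler_sum => T _; rewrite normrM ler_piMl// indicE.
by case: (_ \in _); rewrite ?normr1 ?normr0.
Qed.

Let loadE v : Uh k v -> \int[leb n.+1]_(x in Omega) (f x * broken v x) =
  \int[leb n.+1]_(x in Omega) (f' x * broken v x).
Proof.
move=> Uv; apply: (@ae_eq_Rintegral _ _ _ (leb n.+1) Omega N) => //.
  by move=> x Ox nNx; rewrite ff'.
by have /integrableP[/measurable_EFinP] := load_integrable Uv.
Qed.

Let load_lin d : \int[leb n.+1]_(x in Omega) (f x * broken (U d) x) =
  \sum_i d 0 i * \int[leb n.+1]_(x in Omega) (f x * broken (e i) x).
Proof.
rewrite loadE//; under [RHS]eq_bigr do rewrite loadE//.
rewrite -Rintegral_comb//; last by move=> i; exact: load_integrable.
apply: eq_Rintegral => x _; rewrite /broken.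
under [RHS]eq_bigr do rewrite mulrCA; rewrite -mulr_sumr; congr (_ * _).
under [RHS]eq_bigr do rewrite mulr_sumr; rewrite [RHS]exchange_big /=.
apply: eq_bigr => T _; rewrite U1 fct_sumE mulr_sumr; apply: eq_bigr => i _.
by rewrite mulrCA.
Qed.

Let enorm_powR_continuous q : continuous (fun z : 'rV[R]_q => enorm z `^ p).
Proof.
move=> z; rewrite (_ : (fun z : 'rV[R]_q => _) = fun z : 'rV[R]_q => `|enorm z| `^ p); last first.
  by apply/funext => y; rewrite ger0_norm ?enorm_ge0.
have ce : continuous (fun z : 'rV[R]_q => enorm z).
  by apply: enorm_fun_continuous => ?; exact: cvg_id.
apply: (@continuous_comp _ _ _ (fun z : 'rV[R]_q => enorm z) (fun t => `|t| `^ p)); first exact: ce.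
by apply: norm_powR_continuous; exact: lt_trans p1.
Qed.

Let grad_energy c T : R := \int[leb n.+1]_(x in elt T) (enorm (dgrad k T (U c) x) `^ p).
Let face_energy c T F : R := \int[leb n]_(y in fdom F) (`|face_residual k T F (U c) y| `^ p).
Let energy c : R := \sum_T (lam * grad_energy c T +
  \sum_(F | face_of T F) hface F `^ (1 - p) * face_energy c T F).

Let grad_density_continuous c T : continuous (fun x => enorm (dgrad k T (U c) x) `^ p).
Proof.
move=> x; apply: (@continuous_comp _ _ _ (dgrad k T (U c)) (fun z => enorm z `^ p)).
  exact: dgrad_continuous.
exact: enorm_powR_continuous.
Qed.

Let face_density_continuous c T F : continuous (fun y => `|face_residual k T F (U c) y| `^ p).
Proof.
move=> y; apply: (@continuous_comp _ _ _ (face_residual k T F (U c)) (fun t => `|t| `^ p)).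
  exact: face_residual_continuous.
by apply: norm_powR_continuous; exact: lt_trans p1.
Qed.

Let elem_coercive c T : lam * grad_energy c T <= elem c T (U c).
Proof.
pose den x := lam * enorm (dgrad k T (U c) x) `^ p.
have cden : continuous den.
  by apply: mul_fun_continuous; [exact: const_fun_continuous|exact: grad_density_continuous].
have den0 x : 0 <= den x by rewrite mulr_ge0 ?powR_ge0// ltW.
have iden := continuous_integrable (mT T) (bT T) cden.
have -> : lam * grad_energy c T = \int[leb n.+1]_(x in elt T) den x.
  by rewrite /grad_energy -RintegralZl//; apply: continuous_integrable.
have mden : measurable_fun (elt T) den.
  by apply: measurable_funTS; exact: continuous_measurable_rV.
have mOD : measurable (Omega `\` N) by exact: measurableD.
(* [coer] may fail outside [Omega `\` N], where [b] is 0: the density is cut off there. *)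
pose low := den \_ (Omega `\` N).
have lowE x : Omega x -> ~ N x -> low x = den x by move=> Ox nNx; rewrite /low /patch mem_set.
have low0 x : ~ (Omega x /\ ~ N x) -> low x = 0 by move=> nx; rewrite /low /patch memNset.
have mlow : measurable_fun (elt T) low.
  by apply/measurable_restrict => //; apply: measurable_funS mden => // x [].
rewrite -(@ae_eq_Rintegral _ _ _ (leb n.+1) (elt T) (N `|` B) low)//; first last.
- move=> x Tx nNBx; apply: lowE; first by apply: elt_Omega Tx _ => ?; apply: nNBx; right.
  by move=> ?; apply: nNBx; left.
- by rewrite measureU0.
- exact: measurableU.
apply: le_Rintegral => //.
- apply: le_integrable iden => //; first exact/measurable_EFinP.
  move=> x _; rewrite /= lee_fin [leRHS]ger0_norm//.
  have [[Ox nNx]|nx] := pselect (Omega x /\ ~ N x); first by rewrite lowE// ger0_norm.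
  by rewrite low0// normr0.
- exact: (element_integrable mb cb ig beta0 r0 p1 bg (mT T) (bT T)
    (@Z_continuous T) (@dgrad_continuous (U c) T (UhU c)) c).
move=> x Tx; have [[Ox nNx]|nx] := pselect (Omega x /\ ~ N x).
  by rewrite lowE// /den -Ztail; exact: coer.
rewrite low0// /regular_on asboolF// /dotv big1// => i _.
by rewrite mxE mul0r.
Qed.

Let energy_le c : energy c <= hho_form k p a (U c) (U c).
Proof.
apply: ler_sum => T _; rewrite elemE//; apply: lerD; first exact: elem_coercive.
apply: ler_sum => F _; rewrite ler_wpM2l ?powR_ge0// /face_energy.
rewrite le_eqVlt; apply/orP; left; apply/eqP; apply: eq_Rintegral => y _.
by rewrite signed_powRM.
Qed.

Let energy_continuous : continuous energy.
Proof.
apply: sum_fun_continuous => T; apply: add_fun_continuous.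
  apply: mul_fun_continuous; first exact: const_fun_continuous.
  rewrite (_ : (fun c => _) = fun c : 'rV[R]_m => \int[leb n.+1]_(x in elt T)
      (enorm (\sum_j c 0 j *: dgrad k T (e j) x) `^ p * 1)); last first.
    by apply/funext => c; apply: eq_Rintegral => x _; rewrite dgradU fct_sumE mulr1.
  apply: (@continuous_int_comb _ _ _ _ _ (fun j => dgrad k T (e j)) (fun z => enorm z `^ p)) => //.
    by move=> j; exact: dgrad_continuous.
  exact: const_fun_continuous.
apply: sum_fun_continuous => F; apply: mul_fun_continuous; first exact: const_fun_continuous.
(* Scalar residuals are written as rows of length 1 to fit [continuous_int_comb]. *)
rewrite (_ : (fun c => _) = fun c : 'rV[R]_m => \int[leb n]_(y in fdom F)
    (`|(\sum_j c 0 j *: (const_mx (face_residual k T F (e j) y) : 'rV[R]_1)) 0 0| `^ p * 1));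
  last first.
  apply/funext => c; apply: eq_Rintegral => x _; rewrite face_residualU fct_sumE mulr1 summxE.
  by congr (`|_| `^ p); apply: eq_bigr => j _; rewrite !mxE.
apply: (@continuous_int_comb _ _ _ _ _
  (fun j y => const_mx (face_residual k T F (e j) y) : 'rV[R]_1)
  (fun z => `|z 0 0| `^ p)) => //.
- move=> j; apply: rV_continuous => i; under eq_fun do rewrite mxE.
  exact: face_residual_continuous.
- move=> z; apply: (@continuous_comp _ _ _ (fun z : 'rV[R]_1 => z 0 0) (fun t => `|t| `^ p)).
    exact: coord_continuous.
  by apply: norm_powR_continuous; exact: lt_trans p1.
exact: const_fun_continuous.
Qed.

Let form_continuous i : continuous (fun c => hho_form k p a (U c) (e i)).
Proof.
rewrite /hho_form; apply: sum_fun_continuous => T; apply: add_fun_continuous.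
  rewrite (_ : (fun c => _) = fun c => elem c T (e i)); last by apply/funext => c; exact: elemE.
  exact: (element_continuous mb cb ig beta0 r0 p1 bg (mT T) (bT T)
    (@Z_continuous T) (@dgrad_continuous (e i) T (Uhe i))).
apply: sum_fun_continuous => F; apply: mul_fun_continuous; first exact: const_fun_continuous.
pose H (z : 'rV[R]_1) := `|z 0 0| `^ (p - 2) * z 0 0.
rewrite (_ : (fun c => _) = fun c : 'rV[R]_m => \int[leb n]_(y in fdom F)
    (H (\sum_j c 0 j *: (const_mx (face_residual k T F (e j) y) : 'rV[R]_1)) *
     face_residual k T F (e i) y)); last first.
  apply/funext => c; apply: eq_Rintegral => x _; rewrite /H summxE face_residualU fct_sumE.
  by congr (`|_| `^ _ * _ * _); apply: eq_bigr => j _; rewrite !mxE.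
apply: (@continuous_int_comb _ _ _ _ _
  (fun j y => const_mx (face_residual k T F (e j) y) : 'rV[R]_1) H) => //.
- move=> j; apply: rV_continuous => l; under eq_fun do rewrite mxE.
  exact: face_residual_continuous.
- move=> z; apply: (@continuous_comp _ _ _ (fun z : 'rV[R]_1 => z 0 0)
    (fun t => `|t| `^ (p - 2) * t)).
    exact: coord_continuous.
  exact: signed_powR_continuous.
exact: face_residual_continuous.
Qed.

Let energyZ t c : 0 <= t -> energy (t *: c) = t `^ p * energy c.
Proof.
move=> t0; have dZ T x : dgrad k T (U (t *: c)) x = t *: dgrad k T (U c) x.
  apply: (etrans (congr1 (fun w => w x) (dgradU (t *: c) T))).
  apply: etrans (esym (congr1 (fun w => t *: w x) (dgradU c T))).
  rewrite !fct_sumE scaler_sumr; apply: eq_bigr => j _.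
  by rewrite mxE -scalerA.
have rZ T F y : face_residual k T F (U (t *: c)) y = t * face_residual k T F (U c) y.
  apply: (etrans (congr1 (fun w => w y) (face_residualU (t *: c) T F))).
  apply: etrans (esym (congr1 (fun w => t * w y) (face_residualU c T F))).
  rewrite !fct_sumE mulr_sumr; apply: eq_bigr => j _.
  by rewrite mxE -scalerA.
have gZ T : grad_energy (t *: c) T = t `^ p * grad_energy c T.
  rewrite -RintegralZl//; last exact: continuous_integrable.
  apply: eq_Rintegral => x _; apply: (etrans (congr1 (fun z => enorm z `^ p) (dZ T x))).
  by rewrite enormZ ger0_norm// powRM ?enorm_ge0.
have fZ T F : face_energy (t *: c) T F = t `^ p * face_energy c T F.
  rewrite -RintegralZl//; last exact: continuous_integrable.
  apply: eq_Rintegral => y _; apply: (etrans (congr1 (fun z => `|z| `^ p) (rZ T F y))).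
  by rewrite normrM ger0_norm// powRM.
rewrite /energy mulr_sumr; apply: eq_bigr => T _; rewrite mulrDr gZ [RHS]addrC mulrCA addrC.
by congr (_ + _); rewrite mulr_sumr; apply: eq_bigr => F _; rewrite fZ mulrCA.
Qed.

Let grad_energy_ge0 c T : 0 <= grad_energy c T.
Proof. by apply: Rintegral_ge0 => x _; exact: powR_ge0. Qed.

Let face_energy_ge0 c T F : 0 <= face_energy c T F.
Proof. by apply: Rintegral_ge0 => y _; exact: powR_ge0. Qed.

Let energy_ge0 c : 0 <= energy c.
Proof.
apply: sumr_ge0 => T _; apply: addr_ge0; first by rewrite mulr_ge0// ltW.
by apply: sumr_ge0 => F _; rewrite mulr_ge0// powR_ge0.
Qed.

Let energy_eq0 c : energy c = 0 -> c = 0.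
Proof.
have face_ge0 T F : 0 <= hface F `^ (1 - p) * face_energy c T F by rewrite mulr_ge0// powR_ge0.
have sum_ge0 T : 0 <= \sum_(F | face_of T F) hface F `^ (1 - p) * face_energy c T F.
  by apply: sumr_ge0.
have grad_ge0 T : 0 <= lam * grad_energy c T by rewrite mulr_ge0// ltW.
move=> /eqP; rewrite psumr_eq0; last by move=> T _; rewrite addr_ge0.
move=> /allP E0.
have {}E0 T : lam * grad_energy c T = 0 /\
    \sum_(F | face_of T F) hface F `^ (1 - p) * face_energy c T F = 0.
  have := E0 T (mem_index_enum T); rewrite /= paddr_eq0//.
  by move=> /andP[/eqP ? /eqP].
have p0 : p != 0 by rewrite gt_eqF// (lt_trans _ p1).
have Uc0 : U c = 0.
  apply: (hybrid_kernel eltP fdomP meshM (Uh0U c)) => [T|T F TF].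
    have [/eqP + _] := E0 T; rewrite mulf_eq0 gt_eqF//= => /eqP gT.
    have g0 := Rintegral_eq0_interior (mT T) (bT T) (@grad_density_continuous c T)
      (fun x => powR_ge0 _ _) gT.
    have [Pg _] := dgradP eltP fdomP T (UhU c).
    apply/funext => x; apply/rowP => i; rewrite mxE.
    suff d0 : (fun x => dgrad k T (U c) x 0 i) = fun=> 0 by exact: (congr1 (fun w => w x) d0).
    apply: (Pk_eq0_open (O := (elt T)°) (Pg i)); first by rewrite interior_interior.
    by move=> y /g0 /powR_eq0_eq0 /enorm_eq0 ->; rewrite mxE.
  have [_ /eqP] := E0 T; rewrite psumr_eq0// => /allP /(_ F (mem_index_enum F)).
  have [_ _ _ _ /(_ F)[hF _]] := meshM.
  rewrite TF /= mulf_eq0 gt_eqF ?powR_gt0//= => /eqP fF.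
  have f0 := Rintegral_eq0_interior (mF F) (bF F) (@face_density_continuous c T F)
    (fun y => powR_ge0 _ _) fF.
  apply: (Pk_eq0_open (O := (fdom F)°) (face_residual_Pk eltP fdomP T F (UhU c))).
    by rewrite interior_interior.
  by move=> y /f0 /powR_eq0_eq0 /normr0_eq0.
by apply/rowP => i; rewrite mxE; exact: free_e Uc0 i.
Qed.

Lemma hho_solution : exists2 u : hybrid M, Uh0 k Omega u &
  forall v, Uh0 k Omega v -> hho_form k p a u v = \int[leb n.+1]_(x in Omega) (f x * broken v x).
Proof.
have energy_le_sum c : energy c <= \sum_i c 0 i * hho_form k p a (U c) (e i).
  by apply: le_trans (energy_le c) _; rewrite hho_lin.
pose load i := \int[leb n.+1]_(x in Omega) (f x * broken (e i) x).
have [c cP] := coercive_system load p1 energy_continuous energy_ge0 energy_eq0 energyZ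
  form_continuous energy_le_sum.
exists (U c) => // v; rewrite spanUh0 => -[d _ <-].
have -> : \sum_i d i *: e i = U (\row_i d i) by apply: eq_bigr => i _; rewrite mxE.
by rewrite hho_lin load_lin; apply: eq_bigr => i _; rewrite cP.
Qed.

End Existence.

Theorem theorem4p5 (R : realType) (n : nat) (Omega : set 'rV[R]_n.+1)
    (p : R) (k : nat) (rho : R) (H : set R) (Mh : R -> mesh R n) (h : R)
    (a : 'rV[R]_n.+1 -> R -> 'rV[R]_n.+1 -> 'rV[R]_n.+1)
    (f : 'rV[R]_n.+1 -> R) :
  polytopal Omega ->
  1 < p ->
  admissible_mesh_sequence Omega rho H Mh ->
  H h ->
  leray_lions Omega p a f ->
  exists2 u : hybrid (Mh h), Uh0 k Omega u &
    forall v : hybrid (Mh h), Uh0 k Omega v ->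
      hho_form k p a u v =
      \int[leb n.+1]_(x in Omega) (f x * broken v x).
Proof.
move=> polyO p1 [_ _ _ _ adm] /adm[meshM _ [S [V [subM _ _]]]] LL.
have [oO _ bO _] := polyO.
have mO : measurable Omega by exact: open_measurable_rV.
have [[eltM _ _ _ _] _ _ _ _] := meshM.
have eltP (T : telt (Mh h)) : [/\ open (elt T), bounded_set (elt T) & elt T !=set0].
  by have [[[? _ ? _] _] ?] := eltM T.
have fdomP (F : tface (Mh h)) : [/\ closed (fdom F), bounded_set (fdom F) & (fdom F)° !=set0].
  have cF : compact (fdom F) by exact: (@fdom_compact _ _ _ _ _ meshM bO F).
  split.
  - by apply: compact_closed cF; exact: norm_hausdorff.
  - exact: compact_bounded.
  - exact (fdom_interior meshM subM F).
have [N [mN N0 mb [cb [g [beta [r [ig beta0 r0 bg]]]] [lam lam0 coer] [f' if' ff']]]] :=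
  regularize mO bO p1 LL.
have [B [mB B0 sB]] := boundary_null polyO.
have [m [e [spanUh0 free_e]]] := fdim_basis (fdim_Uh0 (Mh h) k Omega).
exact: (hho_solution polyO p1 mN N0 mB B0 sB mb cb ig beta0 r0 bg lam0 coer if' ff'
  eltP fdomP meshM spanUh0 free_e).
Qed.
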